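(* The space $\mathcal Y(D)$ is Fréchet and its dual can be identified with $$\mathcal U(M\times\tilde M):=\{(u,\tilde u)\in L^1(M\times\tilde M)\mid \|u\|+\|\tilde u\|\in\mathcal U\}$$ through the bilinear form $$\langle y,(u,\tilde u)\rangle := E\left[\int y\,du+\int y_-\,d\tilde u\right].$$ Moreover, $L^\infty(D)$ is dense in $\mathcal Y(D)$, and for every $p\in\mathcal P$, every $y\in L^1(D)$ and every $(u,\tilde u)\in L^1(M\times\tilde M)$, $$E\left[\int y\,du+\int y_-\,d\tilde u\right]\le p(\|y\|)\,p^\circ(\|u\|+\|\tilde u\|)$$ and $$p^\circ(\|u\|+\|\tilde u\|)=\sup_{y\in L^\infty(D)}\left\{E\left[\int y\,du+\int y_-\,d\tilde u\right]\ \middle|\ p(\|y\|)\le 1\right\}.$$ In particular, $(u,\tilde u)\mapsto p^\circ(\|u\|+\|\tilde u\|)$ is the polar of $y\mapsto p(\|y\|)$.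
   Context: Spaces of random variables. $(\Omega,\mathcal F,P)$ is a complete probability space, $L^1=L^1(\Omega,\mathcal F,P)$ and $L^\infty=L^\infty(\Omega,\mathcal F,P)$. $\mathcal P$ is a countable collection of (extended real-valued) sublinear symmetric functions on $L^1$ (symmetric meaning $p(-\xi)=p(\xi)$), where each $p\in\mathcal P$ satisfies: (1) $p$ is lower semicontinuous on $L^1$; (2) there exists a constant $c$ such that $\frac1c\|\xi\|_{L^1}\le p(\xi)\le c\|\xi\|_{L^\infty}$ for all $\xi\in L^1$; (3) $p(\xi_1)\le p(\xi_2)$ whenever $|\xi_1|\le|\xi_2|$; (4) $p(\xi^\nu)\searrow 0$ whenever $(\xi^\nu)_{\nu=1}^\infty\subset L^\infty$ with $\xi^\nu\searrow 0$ almost surely. Let $\operatorname{dom}p=\{\xi\in L^1\mid p(\xi)<\infty\}$ and $\tilde{\mathcal Y}:=\bigcap_{p\in\mathcal P}\operatorname{dom}p$, endowed with the locally convex topology generated by $\mathcal P$; $\mathcal Y$ is the closure of $L^\infty$ in $\tilde{\mathcal Y}$. For $p\in\mathcal P$ and $\eta\in L^1$, $p^\circ(\eta):=\sup_{\xi\in L^\infty}\{E(\xi\eta)\mid p(\xi)\le 1\}$, and $\mathcal U:=\bigcup_{p\in\mathcal P}\operatorname{dom}p^\circ$, where $\operatorname{dom}p^\circ=\{\eta\in L^1\mid p^\circ(\eta)<\infty\}$. Path spaces. $D$ is the Banach space of cadlag functions $y$ on $[0,T]$ equipped with the supremum norm $\|y\|$; $T=+\infty$ is allowed, in which case $[0,T]$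 is understood as the one-point compactification of the positive reals. $y_-$ denotes the left limits of $y$. $M$ and $\tilde M$ are the spaces of (finite signed) Borel measures and of purely discontinuous (i.e. purely atomic) Borel measures on $[0,T]$, respectively, and $\|u\|$ denotes the total variation norm on $M$. $L^1(D)$ is the space of (measurable, not necessarily adapted) cadlag processes $y$ with $E\|y\|<\infty$, $L^\infty(D)$ is the space of those with $\|y\|\in L^\infty$, and $L^1(M\times\tilde M)$ is the space of pairs $(u,\tilde u)$ of random measures with values in $M\times\tilde M$ and $E[\|u\|+\|\tilde u\|]<\infty$. Processes that coincide almost surely everywhere on $[0,T]$ are identified. $\mathcal Y(D):=\{y\in L^1(D)\mid \|y\|\in\mathcal Y\}$ is equipped with the topology induced by the seminorms $y\mapsto p(\|y\|)$, $p\in\mathcal P$.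
   Formalization: The dual identification assumes the family of seminorms is directed (any two dominated up to a constant by a third; otherwise U need not be a vector space and the claim fails), and ũ has no atom at 0, where left limits are undefined; the family is nonempty and T>0. *)

(* Defs.v *)
From HB Require Import structures.
From mathcomp Require Import all_boot all_order all_algebra.
From mathcomp Require Import all_classical all_reals all_analysis.
From mathcomp Require Import measurable_realfun.

Set Implicit Arguments.
Unset Strict Implicit.
Unset Printing Implicit Defensive.
Import Order.TTheory GRing.Theory Num.Theory.
Import numFieldNormedType.Exports.

Local Open Scope classical_set_scope.
Local Open Scope ring_scope.

(* Elements of the function spaces below are plain functions.  A space of
   classes of functions is a subset [E] of a vector space [V] together with the
   subset [N] of those vectors that are identified with zero.  Its locally
   convex topology is generated by seminorms [q i], [i] in [I], that may take
   the value [+oo] outside [E]. *)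
Section SeminormTopology.
Context {R : realType} {V : lmodType R} {J : Type}.
Variables (I : set J) (q : J -> V -> \bar R) (E : set V).

Definition seminorm_nbhs (x : V) : set_system V :=
  [set A | exists (F : set J) (e : R), [/\ F `<=` I, finite_set F, 0 < e &
    forall y, E y -> (forall i, F i -> (q i (y - x)%R < e%:E)%E) -> A y]].

Definition seminorm_closure (S : set V) : set V :=
  [set x | E x /\ forall A, seminorm_nbhs x A -> S `&` A !=set0].

Definition seminorm_dense (S : set V) : Prop :=
  S `<=` E /\ E `<=` seminorm_closure S.

Definition seminorm_cauchy (F : set_system V) : Prop :=
  forall i (e : R), I i -> 0 < e ->
    exists2 A, F A & forall x y, A x -> A y -> (q i (x - y)%R < e%:E)%E.

(* The quotient of [E] by [N] is a Frechet space: Hausdorff, complete, with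
   topology generated by countably many seminorms. *)
Record frechet_mod (N : set V) : Prop := FrechetMod {
  frechet_zero : E 0 ;
  frechet_lin : forall (a : R) x y, E x -> E y -> E (a *: x + y) ;
  frechet_countable : countable I ;
  frechet_fin : forall i x, I i -> E x -> (0 <= q i x < +oo)%E ;
  frechet_tri : forall i x y, I i -> E x -> E y ->
    (q i (x + y)%R <= q i x + q i y)%E ;
  frechet_hom : forall i (a : R) x, I i -> E x ->
    q i (a *: x)%R = (`|a|%:E * q i x)%E ;
  frechet_hausdorff : forall x, E x ->
    ((forall i, I i -> q i x = 0%E) <-> N x) ;
  frechet_complete : forall F : set_system V, ProperFilter F -> F E ->
    seminorm_cauchy F -> exists2 x, E x & seminorm_nbhs x `<=` F }.

(* Only the restriction of [l] to [E] matters. *)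
Definition topological_dual (l : V -> R) : Prop :=
  (forall (a : R) x y, E x -> E y -> l (a *: x + y) = a * l x + l y) /\
  (forall x, E x -> l @ seminorm_nbhs x --> l x).

End SeminormTopology.

Section RandomVariables.
Context {R : realType} {d : measure_display} {Omega : measurableType d}.
Variable P : probability Omega R.
Implicit Types (p : (Omega -> R) -> \bar R) (PP : set ((Omega -> R) -> \bar R)).

Definition L1 : set (Omega -> R) := [set xi | xi \in Lfun P 1%E].
Definition Linf : set (Omega -> R) := [set xi | xi \in Lfun P +oo%E].

Definition L1_nbhs (xi : Omega -> R) : set_system (Omega -> R) :=
  seminorm_nbhs [set: unit] (fun _ zeta => 'N[P]_1[EFin \o zeta]%E) L1 xi.

(* The values of [p] outside [L1] are irrelevant; [adm_solid] makes [p]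
   well defined on almost-sure classes. *)
Record admissible p : Prop := Admissible {
  adm_subadd : forall xi zeta, L1 xi -> L1 zeta ->
    (p (xi + zeta)%R <= p xi + p zeta)%E ;
  adm_homog : forall (a : R) xi, 0 < a -> L1 xi ->
    p (a *: xi) = (a%:E * p xi)%E ;
  adm_sym : forall xi, L1 xi -> p (- xi) = p xi ;
  adm_lsc : forall xi (a : R), L1 xi -> (a%:E < p xi)%E ->
    \forall zeta \near L1_nbhs xi, (a%:E < p zeta)%E ;
  adm_bounds : exists2 c : R, 0 < c & forall xi, L1 xi ->
    ((c^-1)%:E * 'N[P]_1[EFin \o xi] <= p xi)%E /\
    (p xi <= c%:E * 'N[P]_+oo[EFin \o xi])%E ;
  adm_solid : forall xi zeta, L1 xi -> L1 zeta ->
    {ae P, forall w, `|xi w| <= `|zeta w|} -> (p xi <= p zeta)%E ;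
  adm_cvg0 : forall xi : nat -> Omega -> R, (forall n, Linf (xi n)) ->
    {ae P, forall w, nonincreasing_seq (fun n => xi n w) /\
                     xi n w @[n --> \oo] --> (0 : R)} ->
    nonincreasing_seq (fun n => p (xi n)) /\
    p (xi n) @[n --> \oo] --> 0%E }.

Definition dom_seminorm p : set (Omega -> R) :=
  [set xi | L1 xi /\ (p xi < +oo)%E].

Definition Ytilde PP : set (Omega -> R) :=
  [set xi | L1 xi /\ forall p, PP p -> dom_seminorm p xi].

Definition Yspace PP : set (Omega -> R) :=
  seminorm_closure PP (fun p xi => p xi) (Ytilde PP) Linf.

Definition polar p (eta : Omega -> R) : \bar R :=
  ereal_sup [set 'E_P[xi \* eta]%E |
             xi in [set xi | Linf xi /\ (p xi <= 1)%E]].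

Definition Uspace PP : set (Omega -> R) :=
  \bigcup_(p in PP) [set eta | L1 eta /\ (polar p eta < +oo)%E].

(* The balls of single seminorms form a base of neighbourhoods of zero.  This is
   equivalent to [Uspace PP], a union of subspaces, being a vector space. *)
Definition seminorm_directed PP : Prop :=
  forall p1 p2, PP p1 -> PP p2 -> exists2 p, PP p & exists2 c : R, 0 < c &
    forall xi, L1 xi -> (p1 xi <= c%:E * p xi)%E /\ (p2 xi <= c%:E * p xi)%E.

End RandomVariables.

(* Time runs through the subset [0, T] of [\bar R]; for [T = +oo] this is the
   one-point compactification of the positive reals.  Values of a path outside
   [0, T] are irrelevant. *)
Section Paths.
Context {R : realType}.
Variable T : \bar R.

Definition times : set (\bar R) := [set t | 0 <= t <= T]%E.

Definition left_nbhs (t : \bar R) : set_system (\bar R) :=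
  within [set s | (s < t)%E] (nbhs t).
Definition right_nbhs (t : \bar R) : set_system (\bar R) :=
  within [set s | (t < s)%E] (nbhs t).

Definition cadlag (f : \bar R -> R) : Prop :=
  (forall t, (0 <= t < T)%E -> f @ right_nbhs t --> f t) /\
  (forall t, (0 < t <= T)%E -> cvg (f @ left_nbhs t)).

Definition left_lim (f : \bar R -> R) (t : \bar R) : R := lim (f @ left_nbhs t).

Definition path_norm (f : \bar R -> R) : R := sup [set `|f t| | t in times].

Definition smeasure : Type := {charge set (\bar R) -> \bar R}.

Lemma hahn_ex (u : smeasure) :
  exists PN : set (\bar R) * set (\bar R), hahn_decomposition u PN.1 PN.2.
Proof. by have [A [B AB]] := Hahn_decomposition u; exists (A, B). Qed.

Definition hahnP (u : smeasure) := projT2 (cid (hahn_ex u)).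

Definition tv_norm (u : smeasure) : R :=
  fine (charge_variation (hahnP u) [set: \bar R]).

Definition sintegral (u : smeasure) (f : \bar R -> R) : R :=
  \int[jordan_pos (hahnP u)]_(t in times) f t -
  \int[jordan_neg (hahnP u)]_(t in times) f t.

Definition Mspace : set smeasure :=
  [set u | forall A, measurable A -> A `&` times = set0 -> u A = 0%E].

(* Left limits exist only on (0, T], so the measures integrating them do not
   charge 0; in particular the value of [left_lim f] at 0 is irrelevant. *)
Definition Mtilde : set smeasure :=
  [set u | [/\ Mspace u, u [set 0%E] = 0%E &
    exists2 C : set (\bar R), countable C &
      forall A, measurable A -> A `&` C = set0 -> u A = 0%E]].

End Paths.

Section Processes.
Context {R : realType} {d : measure_display} {Omega : measurableType d}.
Variables (P : probability Omega R) (T : \bar R).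
Implicit Types (y : Omega -> \bar R -> R)
               (u : Omega -> smeasure (R := R))
               (p : (Omega -> R) -> \bar R) (PP : set ((Omega -> R) -> \bar R)).

Definition proc_norm y (w : Omega) : R := path_norm T (y w).

Definition cadlag_process y : Prop :=
  (forall w, cadlag T (y w)) /\
  measurable_fun ([set: Omega] `*` times T) (fun z => y z.1 z.2).

Definition L1D : set (Omega -> \bar R -> R) :=
  [set y | cadlag_process y /\ L1 P (proc_norm y)].
Definition LinfD : set (Omega -> \bar R -> R) :=
  [set y | cadlag_process y /\ Linf P (proc_norm y)].
Definition YD PP : set (Omega -> \bar R -> R) :=
  [set y | L1D y /\ Yspace P PP (proc_norm y)].

Definition proc_seminorm p y : \bar R := p (proc_norm y).

Definition proc_null : set (Omega -> \bar R -> R) :=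
  [set y | {ae P, forall w, forall t, times T t -> y w t = 0}].

Definition random_measure u : Prop :=
  forall A, measurable A -> measurable_fun [set: Omega] (fun w => u w A).

(* Pairs [(u, \tilde u)]; the second measure integrates left limits. *)
Definition rmpair : Type :=
  ((Omega -> smeasure (R := R)) * (Omega -> smeasure (R := R)))%type.

Definition pair_norm (v : rmpair) (w : Omega) : R :=
  tv_norm (v.1 w) + tv_norm (v.2 w).

Definition L1M : set rmpair :=
  [set v | [/\ random_measure v.1, random_measure v.2,
               (forall w, Mspace T (v.1 w) /\ Mtilde T (v.2 w)) &
               L1 P (pair_norm v)]].
Definition UM PP : set rmpair :=
  [set v | L1M v /\ Uspace P PP (pair_norm v)].

Definition pair_eq (v v' : rmpair) : Prop :=
  {ae P, forall w, forall A, measurable A ->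
     v.1 w A = v'.1 w A /\ v.2 w A = v'.2 w A}.

Definition pair_lin (a : R) (v v' : rmpair) : rmpair :=
  ((fun w => cadd (cscale a (v.1 w)) (v'.1 w) : smeasure (R := R)),
   (fun w => cadd (cscale a (v.2 w)) (v'.2 w) : smeasure (R := R))).

Definition path_pairing y (v : rmpair) (w : Omega) : R :=
  sintegral T (v.1 w) (y w) + sintegral T (v.2 w) (left_lim (y w)).

Definition pairing y (v : rmpair) : \bar R := 'E_P[path_pairing y v]%E.

(* The pairing is a finite bilinear form, and [v |-> pairing ^~ v] embeds
   [UM PP], modulo almost sure equality, into the topological dual of [YD PP]. *)
Record dual_embedding PP : Prop := DualEmbedding {
  dual_integrable : forall y v, YD PP y -> UM PP v ->
    P.-integrable [set: Omega] (EFin \o path_pairing y v) ;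
  dual_pairing_lin : forall (a : R) y v v', YD PP y -> UM PP v -> UM PP v' ->
    pairing y (pair_lin a v v') = (a%:E * pairing y v + pairing y v')%E ;
  dual_continuous : forall v, UM PP v ->
    topological_dual PP proc_seminorm (YD PP) (fun y => fine (pairing y v)) ;
  dual_injective : forall v v', UM PP v -> UM PP v' ->
    ((forall y, YD PP y -> pairing y v = pairing y v') <-> pair_eq v v') }.

(* The embedding is an isomorphism of vector spaces onto the dual. *)
Record dual_identification PP : Prop := DualIdentification {
  dual_embed : dual_embedding PP ;
  dual_lin : forall (a : R) v v', UM PP v -> UM PP v' ->
    UM PP (pair_lin a v v') ;
  dual_surjective : forall l : (Omega -> \bar R -> R) -> R,
    topological_dual PP proc_seminorm (YD PP) l ->
    exists2 v, UM PP v & forall y, YD PP y -> (l y)%:E = pairing y v }.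

End Processes.

(* Main.v *)
Require Import Defs.
From HB Require Import structures.
From mathcomp Require Import all_boot all_order all_algebra.
From mathcomp Require Import all_classical all_reals all_analysis.
From mathcomp Require Import measurable_realfun ess_sup_inf ring lra.
Import Order.TTheory GRing.Theory Num.Theory.
Import numFieldNormedType.Exports.

Set Implicit Arguments.
Unset Strict Implicit.
Unset Printing Implicit Defensive.

Local Open Scope classical_set_scope.
Local Open Scope ring_scope.

Local Notation sintegral := Defs.sintegral.

(** The space [YD] inherits its structure from the solid space [Yspace] of random
variables through the supremum norm of paths.  A random variable belongs to
[Yspace] when its truncations converge to it in every seminorm ([YspaceP]), so
truncating the values of a path shows that bounded processes are dense.  A
sequence that is fast Cauchy for an enumeration of the seminorms converges almost
surely in the supremum norm, because every seminorm dominates the norm of [L1];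
the limit is cadlag, and lower semicontinuity of the seminorms turns this into
convergence in [YD] ([YD_complete]).

The inequality between the pairing and the product of [p] and its polar is that of
random variables, applied to the supremum norm of the path and the total variation
of the pair ([polar_holder]).  For its sharpness ([sign_process_norming]) one needs
cadlag processes with values in [-1, 1] whose pairing with (u, u')
approaches the total variation of both measures at once.  On a fine grid the path
takes the sign of u on each cell; then, on a short interval that ends just before
an atom s of u', it is changed to the sign of this atom.  As the interval shrinks,
the change is visible only in the left limit at s ([override_near],
[left_override_near]), so it concerns u' alone.  For these processes to be
measurable, the atoms of u' are enumerated as values of quantile functions of
distribution functions computed along the grid ([atom_time_onto]).

It remains to represent a functional l in the dual.  By continuity and
directedness |l y| is at most C p(|y|) ([dual_bound]), which makes l a difference
of positive functionals on bounded processes ([pos_functional_pf],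
[neg_functional_pf]).  For a positive functional and a random time s, the values
on the processes 1_A 1_[s, T] form a measure in A, with density F_s by the
Radon-Nikodym theorem.  The densities along the grid decrease with s and define a
random measure m; at a random time, F_s lies between the masses of ]s, T] and
[s, T], the difference from the latter being a part of the atom at s.  Moving these
parts of the atoms of m to the measure that integrates left limits gives a pair
whose pairing with 1_A 1_[s, T] is the given one ([positive_representation]).
Finally, a bounded cadlag process is uniformly close, off a set of small
probability, to a finite combination of processes 1_A 1_[s, T], where s runs
through the successive times at which the path has moved by more than a given
amount; hence two functionals that agree on the latter agree on all bounded
processes ([vanishing]), and by density on [YD].  The identity with l bounds
the polar of the pair by C, so the pair belongs to [UM]. *)

(** * One-sided neighbourhoods and grids of [0, T] *)

Section TimeTopology.
Context {R : realType}.
Implicit Types (s t : \bar R) (A : set (\bar R)) (f : \bar R -> R).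

Lemma contract_ge0 t : (0 <= t)%E -> 0 <= contract t.
Proof. by move=> t0; rewrite -(contract0 R) le_contract. Qed.

Lemma contract_gt0 t : (0 < t)%E -> 0 < contract t.
Proof. by move=> t0; rewrite -(contract0 R) lt_contract. Qed.

Lemma contract_lele1 t : contract t <= 1.
Proof. by have := contract_le1 t; rewrite ler_norml => /andP[]. Qed.

Lemma expand_ge0 (x : R) : 0 <= x <= 1 -> (0 <= expand x)%E.
Proof.
move=> /andP[x0 x1]; rewrite le_expandRL ?contract0 ?inE//.
by rewrite ger0_norm.
Qed.

Lemma left_nbhsP t A : (0 < t)%E ->
  left_nbhs t A <-> exists2 s, (0 <= s < t)%E & forall r, (s < r < t)%E -> A r.
Proof.
move=> t0; have ct := contract_gt0 t0; have ct1 := contract_lele1 t; split.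
- rewrite /left_nbhs /within /= => /nbhs_ballP[e /= e0 Be].
  pose c := Num.max 0 (contract t - e).
  have c01 : 0 <= c <= 1.
    by rewrite le_max lexx/= ge_max ler01/= lerBlDr (le_trans ct1)// lerDl ltW.
  have cn : `|c| <= 1 by rewrite ger0_norm; case/andP: c01.
  have ctc : c < contract t by rewrite gt_max ct/= ltrBlDr ltrDl.
  exists (expand c); first by rewrite expand_ge0//= lt_expandLR// inE.
  move=> r /andP[cr rt]; apply: Be => //.
  rewrite /ball/= /ereal_ball.
  have cr' : c < contract r by rewrite -lt_expandLR ?inE.
  rewrite gtr0_norm ?subr_gt0 ?lt_contract// ltrBlDr -ltrBlDl.
  by apply: le_lt_trans cr'; rewrite le_max lexx orbT.
- move=> [s /andP[s0 st] H]; rewrite /left_nbhs /within /=.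
  have : nbhs t [set y | (s < y)%E].
    by apply: open_nbhs_nbhs; split => //; exact: open_ereal_gt_ereal.
  by apply: filterS => r /= sr rt; apply: H; rewrite sr.
Qed.

Lemma right_nbhsP t T A : (0 <= t)%E -> (t < T)%E ->
  right_nbhs t A <-> exists2 s, (t < s <= T)%E & forall r, (t < r < s)%E -> A r.
Proof.
move=> t0 tT; have ct := contract_ge0 t0; have ct1 := contract_lele1 t; split.
- rewrite /right_nbhs /within /= => /nbhs_ballP[e /= e0 Be].
  have tT' : contract t < contract T by rewrite lt_contract.
  pose c := Num.min (contract T) (contract t + e).
  have c01 : 0 <= c <= 1.
    rewrite le_min (le_trans ct (ltW tT'))/= (addr_ge0 ct (ltW e0))/=.
    by rewrite ge_min contract_lele1.
  have cn : `|c| <= 1 by rewrite ger0_norm; case/andP: c01.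
  have ctc : contract t < c by rewrite lt_min tT'/= ltrDl.
  exists (expand c).
    by rewrite lt_expandRL ?inE// ctc le_expandLR ?inE// ge_min lexx.
  move=> r /andP[tr rc]; apply: Be => //.
  rewrite /ball/= /ereal_ball distrC.
  have rc' : contract r < c by rewrite -lt_expandRL ?inE.
  rewrite gtr0_norm ?subr_gt0 ?lt_contract// ltrBlDl.
  by apply: lt_le_trans rc' _; rewrite ge_min lexx orbT.
- move=> [s /andP[ts sT] H]; rewrite /right_nbhs /within /=.
  have : nbhs t [set y | (y < s)%E].
    by apply: open_nbhs_nbhs; split => //; exact: open_ereal_lt_ereal.
  by apply: filterS => r /= sr rt; apply: H; rewrite rt.
Qed.

Lemma ereal_dense s t : (0 <= s)%E -> (s < t)%E -> exists r, (s < r < t)%E.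
Proof.
move=> s0 st; pose c := (contract s + contract t) / 2.
have cst : contract s < contract t by rewrite lt_contract.
have cs := contract_ge0 s0; have ct1 := contract_lele1 t.
have c1 : contract s < c by rewrite /c; lra.
have c2 : c < contract t by rewrite /c; lra.
have cn : `|c| <= 1 by rewrite ger0_norm; rewrite /c; lra.
by exists (expand c); rewrite lt_expandRL ?inE// lt_expandLR ?inE// c1.
Qed.

Lemma left_nbhs_filter t : Filter (left_nbhs t).
Proof. exact: within_filter. Qed.

Lemma left_nbhs_proper t : (0 < t)%E -> ProperFilter (left_nbhs t).
Proof.
move=> t0; apply: Build_ProperFilter_ex => A /(left_nbhsP _ t0)[s /andP[s0 st] H].
have [r rst] := ereal_dense s0 st.
by exists r; apply: H.
Qed.

Lemma left_cvgP f t (l : R) : (0 < t)%E -> (f @ left_nbhs t --> l) <->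
  forall e, 0 < e -> exists2 s, (0 <= s < t)%E &
    forall r, (s < r < t)%E -> `|f r - l| < e.
Proof.
move=> t0; have FF := left_nbhs_filter t; split.
- move=> /cvgrPdist_lt fl e e0; have /(left_nbhsP _ t0)[s st H] := fl e e0.
  by exists s => // r /H; rewrite distrC.
- move=> H; apply/cvgrPdist_lt => e /H[s st {}H].
  by apply/(left_nbhsP _ t0); exists s => // r /H; rewrite distrC.
Qed.

Lemma right_cvgP f t T (l : R) : (0 <= t)%E -> (t < T)%E ->
  (f @ right_nbhs t --> l) <->
  forall e, 0 < e -> exists2 s, (t < s <= T)%E &
    forall r, (t < r < s)%E -> `|f r - l| < e.
Proof.
move=> t0 tT; have FF : Filter (right_nbhs t) by exact: within_filter.
split.
- move=> /cvgrPdist_lt fl e e0; have /(right_nbhsP _ t0 tT)[s st H] := fl e e0.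
  by exists s => // r /H; rewrite distrC.
- move=> H; apply/cvgrPdist_lt => e /H[s st {}H].
  by apply/(right_nbhsP _ t0 tT); exists s => // r /H; rewrite distrC.
Qed.

Lemma left_lim_eq f t (l : R) : (0 < t)%E -> f @ left_nbhs t --> l ->
  left_lim f t = l.
Proof.
by move=> t0 fl; have := left_nbhs_proper t0 => ?; apply/cvg_lim.
Qed.

End TimeTopology.

Section Grid.
Context {R : realType} (T : \bar R).
Hypothesis T0 : (0 < T)%E.
Implicit Types (s t : \bar R) (n k : nat).

(** Dyadic points in the coordinate [contract], which maps the extended half-line into
[0, 1], so that the case [T = +oo] is not special.  All indices from [2 ^ n] on give [T]. *)
Definition grid n k : \bar R := expand (contract T * (minn k (2 ^ n))%:R / 2 ^+ n).

Let gc n k : 0 <= contract T * (minn k (2 ^ n))%:R / 2 ^+ n <= contract T.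
Proof.
have cT := ltW (contract_gt0 T0).
rewrite divr_ge0 ?mulr_ge0//= ler_pdivrMr ?exprn_gt0// ler_wpM2l//.
by rewrite -natrX ler_nat geq_minr.
Qed.

Let gc1 n k : `|contract T * (minn k (2 ^ n))%:R / 2 ^+ n| <= 1.
Proof.
have /andP[a b] := gc n k; rewrite ger0_norm//.
by rewrite (le_trans b)// contract_lele1.
Qed.

Lemma contract_grid n k :
  contract (grid n k) = contract T * (minn k (2 ^ n))%:R / 2 ^+ n.
Proof. by rewrite /grid expandK// inE. Qed.

Lemma grid0 n : grid n 0 = 0%E.
Proof. by apply: contract_inj; rewrite contract_grid min0n mulr0 mul0r contract0. Qed.

Lemma grid_last n k : (2 ^ n <= k)%N -> grid n k = T.
Proof.
move=> nk; apply: contract_inj; rewrite contract_grid (minn_idPr nk) natrX mulfK//.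
Qed.

Lemma grid_times n k : times T (grid n k).
Proof.
have /andP[a b] := gc n k; rewrite /times /=; apply/andP; split.
  by rewrite le_expandRL ?inE ?contract0.
by rewrite le_expandLR ?inE.
Qed.

Lemma le_grid n k l : (k <= l)%N -> (grid n k <= grid n l)%E.
Proof.
move=> kl; rewrite -le_contract !contract_grid ler_wpM2r ?invr_ge0 ?exprn_ge0//.
rewrite ler_wpM2l ?(ltW (contract_gt0 T0))// ler_nat.
by rewrite leq_min geq_minr andbT (leq_trans (geq_minl _ _)).
Qed.

Lemma lt_grid n k l : (k < 2 ^ n)%N -> (k < l)%N -> (grid n k < grid n l)%E.
Proof.
move=> kn kl; rewrite -lt_contract !contract_grid ltr_pM2r ?invr_gt0 ?exprn_gt0//.
rewrite ltr_pM2l ?contract_gt0// ltr_nat.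
by rewrite leq_min (leq_ltn_trans (geq_minl _ _) kl) (leq_ltn_trans (geq_minl _ _) kn).
Qed.

Lemma gridS n k : grid n.+1 (2 * k) = grid n k.
Proof.
apply: contract_inj; rewrite !contract_grid expnS -minnMr natrM exprS.
by field.
Qed.

Lemma grid_refine n m k : (n <= m)%N -> grid n k = grid m (2 ^ (m - n) * k).
Proof.
move=> nm; rewrite -{1}(subnKC nm); elim: (m - n)%N => [|j IH].
  by rewrite addn0 mul1n.
by rewrite IH addnS expnS -mulnA gridS.
Qed.

Lemma grid_cellP n t : (0 <= t < T)%E ->
  exists2 k, (k < 2 ^ n)%N & (grid n k <= t < grid n k.+1)%E.
Proof.
move=> /andP[t0 tT]; have cT := contract_gt0 T0.
have ct : 0 <= contract t by exact: contract_ge0.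
have ctT : contract t < contract T by rewrite lt_contract.
pose x := contract t * 2 ^+ n / contract T.
have x0 : 0 <= x by rewrite divr_ge0 ?mulr_ge0 ?exprn_ge0// ltW.
have xE : contract t = contract T * x / 2 ^+ n.
  by rewrite [contract T * _]mulrC /x divfK ?mulfK ?expf_neq0 ?lt0r_neq0.
have xn : x < (2 ^ n)%:R.
  by rewrite /x ltr_pdivrMr// natrX mulrC ltr_pM2l ?exprn_gt0.
have kn : (Num.truncn x < 2 ^ n)%N by rewrite truncn_lt_nat.
exists (Num.truncn x) => //.
have /andP[k1 k2] := truncn_itv x0.
rewrite -le_contract -lt_contract !contract_grid xE (minn_idPl (ltnW kn)).
rewrite (minn_idPl kn) ler_pM2r ?invr_gt0 ?exprn_gt0// ler_pM2l// k1/=.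
by rewrite ltr_pM2r ?invr_gt0 ?exprn_gt0// ltr_pM2l.
Qed.

Lemma grid_cell_leftP n t : (0 < t <= T)%E ->
  exists2 k, (k < 2 ^ n)%N & (grid n k < t <= grid n k.+1)%E.
Proof.
move=> /andP[t0 tT].
have n0 : (0 < 2 ^ n)%N by rewrite expn_gt0.
have [tT'|Tt] := ltP t T; last first.
  have -> : t = T by apply/eqP; rewrite eq_le tT.
  exists (2 ^ n).-1; rewrite prednK//.
  by rewrite -(@grid_last n (2 ^ n))// lexx andbT lt_grid// prednK.
have [|k kn /andP[k1 k2]] := @grid_cellP n t; first by rewrite ltW.
move: k1; rewrite le_eqVlt => /predU1P[kt|k1]; last by exists k; rewrite // k1 ltW.
have k0 : (0 < k)%N.
  by rewrite lt0n; apply/eqP => k0; move: t0; rewrite -kt k0 grid0 ltxx.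
exists k.-1; first by rewrite (leq_ltn_trans (leq_pred _)).
rewrite prednK// kt lexx andbT -kt lt_grid//.
  by rewrite (leq_ltn_trans (leq_pred _)).
by rewrite prednK.
Qed.

Lemma grid_dense s t : (0 <= s)%E -> (s < t)%E -> (t <= T)%E ->
  exists n k, (s < grid n k < t)%E.
Proof.
move=> s0 st tT; have cT := contract_gt0 T0.
have st' : contract s < contract t by rewrite lt_contract.
pose e := (contract t - contract s) / contract T.
have e0 : 0 < e by rewrite divr_gt0// subr_gt0.
have [n ne] : exists n, (2 ^+ n)^-1 < e.
  pose m := Num.truncn e^-1; exists m.
  rewrite -[e]invrK ltf_pV2 ?posrE ?invr_gt0 ?exprn_gt0//.
  have ei : 0 <= e^-1 by rewrite invr_ge0 ltW.
  have /andP[_] := truncn_itv ei.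
  move=> /lt_le_trans; apply; rewrite -natrX ler_nat.
  by rewrite -/m ltn_expl.
have [|k kn /andP[k1 k2]] := @grid_cellP n s.
  by rewrite s0/= (lt_le_trans st).
exists n, k.+1; rewrite k2/=.
rewrite -lt_contract contract_grid (minn_idPl kn).
move: k1; rewrite -le_contract contract_grid (minn_idPl (ltnW kn)).
move: ne; rewrite /e ltr_pdivlMr//.
have -> : k.+1%:R = k%:R + 1 :> R by rewrite natr1.
by move: ((2 ^+ n)^-1) => q; nra.
Qed.

Lemma grid_near_right t s : (0 <= t)%E -> (t < s)%E -> (s <= T)%E ->
  exists N, forall n k, (N <= n)%N -> (grid n k <= t < grid n k.+1)%E ->
  (grid n k.+1 < s)%E.
Proof.
move=> t0 ts sT; have [N [j /andP[j1 j2]]] := grid_dense t0 ts sT.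
exists N => n k Nn /andP[k1 k2]; apply: le_lt_trans j2.
rewrite (grid_refine j Nn) le_grid// ltnNge; apply/negP => jk.
have := le_trans (le_grid _ jk) k1.
by rewrite -(grid_refine j Nn) leNgt j1.
Qed.

Lemma grid_near_left t s : (0 <= s)%E -> (s < t)%E -> (t <= T)%E ->
  exists N, forall n k, (N <= n)%N -> (grid n k < t <= grid n k.+1)%E ->
  (s < grid n k)%E.
Proof.
move=> s0 st tT; have [N [j /andP[j1 j2]]] := grid_dense s0 st tT.
exists N => n k Nn /andP[k1 k2]; apply: lt_le_trans j1 _.
rewrite (grid_refine j Nn) le_grid// leqNgt; apply/negP => jk.
have := le_trans k2 (le_grid _ jk).
by rewrite -(grid_refine j Nn) leNgt j2.
Qed.

Lemma grid_cell_uniq n k l t : (k < 2 ^ n)%N ->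
  (grid n k <= t < grid n k.+1)%E -> (grid n l <= t < grid n l.+1)%E -> k = l.
Proof.
move=> kn /andP[k1 k2] /andP[l1 l2]; apply/eqP; rewrite eqn_leq.
apply/andP; split; rewrite leqNgt; apply/negP => kl.
  by have := lt_le_trans l2 (le_trans (le_grid n kl) k1); rewrite ltxx.
by have := lt_le_trans k2 (le_trans (le_grid n kl) l1); rewrite ltxx.
Qed.

Lemma grid_cell_left_uniq n k l t :
  (grid n k < t <= grid n k.+1)%E -> (grid n l < t <= grid n l.+1)%E -> k = l.
Proof.
move=> /andP[k1 k2] /andP[l1 l2]; apply/eqP; rewrite eqn_leq.
apply/andP; split; rewrite leqNgt; apply/negP => kl.
  by have := lt_le_trans k1 (le_trans l2 (le_grid n kl)); rewrite ltxx.
by have := lt_le_trans l1 (le_trans k2 (le_grid n kl)); rewrite ltxx.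
Qed.

End Grid.

(** * Cadlag paths *)

Lemma mem_setb (X : Type) (b : X -> bool) x : (x \in [set y | b y]) = b x.
Proof. by apply/idP/idP => [/set_mem//|bx]; exact/mem_set. Qed.

Section Cadlag.
Context {R : realType} (T : \bar R).
Hypothesis T0 : (0 < T)%E.
Implicit Types (s t : \bar R) (f g : \bar R -> R).

(** Real induction: the supremum of the times up to which [S] holds throughout belongs
to [S] by the last hypothesis, and can be exceeded by the second one unless it is [T]. *)
Lemma time_induction (S : set (\bar R)) : S 0%E ->
  (forall t, (0 <= t < T)%E -> S t ->
     exists2 s, (t < s <= T)%E & forall r, (t <= r <= s)%E -> S r) ->
  (forall t, (0 < t <= T)%E -> (forall r, (0 <= r < t)%E -> S r) -> S t) ->
  forall t, times T t -> S t.
Proof.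
move=> S0 SR SL.
pose A := [set t | times T t /\ forall r, (0 <= r <= t)%E -> S r].
have A0 : A 0%E.
  split; first by rewrite /times /= lexx ltW.
  by move=> r r0; rewrite (_ : r = 0%E)//; apply/eqP; rewrite eq_le andbC.
pose s := ereal_sup A.
have s0 : (0 <= s)%E by exact: ereal_sup_ubound.
have sT : (s <= T)%E by apply: ub_ereal_sup => t [/andP[]].
have As r : (0 <= r < s)%E -> S r.
  move=> /andP[r0 /ereal_sup_gt[t [_ At] rt]].
  by apply: At; rewrite r0 ltW.
have Ss : S s.
  move: s0; rewrite le_eqVlt => /predU1P[<-//|s0].
  by apply: SL; rewrite ?s0.
have AS r : (0 <= r <= s)%E -> S r.
  move=> /andP[r0]; rewrite le_eqVlt => /predU1P[->//|rs].
  by apply: As; rewrite r0.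
have [sT'|Ts] := ltP s T; last first.
  by move=> t /andP[t0 tT]; apply: AS; rewrite t0 (le_trans tT).
have [|s' /andP[ss' s'T] H] := SR s _ Ss; first by rewrite s0.
suff : (s' <= s)%E by rewrite leNgt ss'.
apply: ereal_sup_ubound; split.
  by rewrite /times /= s'T (le_trans s0 (ltW ss')).
move=> r /andP[r0 rs']; have [rs|sr] := leP r s; first by apply: AS; rewrite r0.
by apply: H; rewrite (ltW sr).
Qed.

Lemma times0 : times T 0%E. Proof. by rewrite /times /= lexx ltW. Qed.
Lemma timesT : times T T. Proof. by rewrite /times /= lexx ltW. Qed.

Lemma cadlag_right f t : cadlag T f -> (0 <= t < T)%E ->
  forall e, 0 < e -> exists2 s, (t < s <= T)%E &
    forall r, (t <= r < s)%E -> `|f r - f t| < e.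
Proof.
move=> [+ _] /[dup] t0T /andP[t0 tT] e e0.
move=> /(_ t t0T)/(right_cvgP _ _ t0 tT)/(_ e e0)[s st H].
exists s => // r /andP[]; rewrite le_eqVlt => /predU1P[<- _|tr rs].
  by rewrite subrr normr0.
by apply: H; rewrite tr.
Qed.

Lemma cadlag_left f t : cadlag T f -> (0 < t <= T)%E ->
  f @ left_nbhs t --> left_lim f t.
Proof. by move=> [_ +] tT => /(_ t tT). Qed.

Lemma cadlag_leftP f t : cadlag T f -> (0 < t <= T)%E ->
  forall e, 0 < e -> exists2 s, (0 <= s < t)%E &
    forall r, (s < r < t)%E -> `|f r - left_lim f t| < e.
Proof.
by move=> cf /[dup] tT /andP[t0 _]; apply/left_cvgP => //; exact: cadlag_left.
Qed.

(** Boundedness on [0, t] extends beyond t by right-continuity, and the left limit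
closes the intervals, whence time induction. *)
Lemma cadlag_bounded f : cadlag T f ->
  exists M, forall t, times T t -> `|f t| <= M.
Proof.
move=> cf.
suff : forall t, times T t -> exists M, forall r, (0 <= r <= t)%E -> `|f r| <= M.
  by move=> /(_ T timesT)[M HM]; exists M.
apply: time_induction.
- exists `|f 0%E| => r r0; rewrite (_ : r = 0%E)//.
  by apply/eqP; rewrite eq_le andbC.
- move=> t /[dup] t0T /andP[t0 tT] [M HM].
  have [s /andP[ts sT] H] := cadlag_right cf t0T ltr01.
  have [s' /andP[ts' s's]] := ereal_dense t0 ts.
  exists s'; first by rewrite ts' (le_trans (ltW s's)).
  move=> r /andP[tr rs']; exists (Num.max M (1 + `|f t|)) => q /andP[q0 qr].
  rewrite le_max; have [qt|tq] := leP q t; first by rewrite HM// q0.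
  apply/orP; right; rewrite -[f q](subrK (f t)).
  rewrite (le_trans (ler_normD _ _))// lerD2r ltW// H// (ltW tq)/=.
  by rewrite (le_lt_trans qr)// (le_lt_trans rs').
- move=> t tT H; have [s /andP[s0 st] Hs] := cadlag_leftP cf tT ltr01.
  have [|M HM] := H s; first by rewrite s0.
  exists (Num.max (Num.max M (1 + `|left_lim f t|)) `|f t|) => q /andP[q0 qt].
  rewrite !le_max; have [qs|sq] := leP q s; first by rewrite HM// q0.
  move: qt; rewrite le_eqVlt => /predU1P[->|qt]; first by rewrite lexx orbT.
  apply/orP; left; apply/orP; right; rewrite -[f q](subrK (left_lim f t)).
  by rewrite (le_trans (ler_normD _ _))// lerD2r ltW// Hs// sq.
Qed.

Lemma le_path_norm f t : cadlag T f -> times T t -> `|f t| <= path_norm T f.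
Proof.
move=> /cadlag_bounded[M HM] tT; apply: ub_le_sup; last by exists t.
by exists M => _ [s sT <-]; exact: HM.
Qed.

Lemma path_norm_le f (M : R) : (forall t, times T t -> `|f t| <= M) ->
  path_norm T f <= M.
Proof.
move=> HM; apply: ge_sup; first by exists `|f 0%E|; exists 0%E => //; exact: times0.
by move=> _ [s sT <-]; exact: HM.
Qed.

Lemma path_norm_ge0 f : 0 <= path_norm T f.
Proof.
rewrite /path_norm; have [hs|/sup_out->//] := pselect (has_sup [set `|f t| | t in times T]).
by rewrite (le_trans (normr_ge0 (f 0%E)))// ub_le_sup//; [case: hs|exists 0%E => //; exact: times0].
Qed.

Lemma eq_path_norm f g : (forall t, times T t -> `|f t| = `|g t|) ->
  path_norm T f = path_norm T g.
Proof.
by move=> fg; congr sup; apply/seteqP; split => _ [t tT <-]; exists t; rewrite ?fg.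
Qed.

Lemma path_normZ (c : R) f : cadlag T f ->
  path_norm T (fun t => c * f t) = `|c| * path_norm T f.
Proof.
move=> cf; apply/eqP; rewrite eq_le; apply/andP; split.
  by apply: path_norm_le => t tT; rewrite normrM ler_wpM2l// le_path_norm.
have [->|c0] := eqVneq c 0; first by rewrite normr0 mul0r path_norm_ge0.
rewrite mulrC -ler_pdivlMr ?normr_gt0//; apply: path_norm_le => t tT.
rewrite ler_pdivlMr ?normr_gt0// mulrC -normrM.
apply: (@ub_le_sup _ [set `|c * f s| | s in times T]); last by exists t.
have [M HM] := cadlag_bounded cf; exists (`|c| * M) => _ [s sT <-].
by rewrite normrM ler_wpM2l// HM.
Qed.

Lemma path_normD f g : cadlag T f -> cadlag T g ->
  path_norm T (fun t => f t + g t) <= path_norm T f + path_norm T g.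
Proof.
move=> cf cg; apply: path_norm_le => t tT; rewrite (le_trans (ler_normD _ _))//.
by rewrite lerD// le_path_norm.
Qed.

Lemma path_norm_grid f (M : R) : cadlag T f ->
  (forall n k, `|f (grid T n k)| <= M) -> path_norm T f <= M.
Proof.
move=> cf HM; apply: path_norm_le => t /andP[t0].
rewrite le_eqVlt => /predU1P[->|tT].
  by rewrite -(@grid_last _ T T0 0 1)//.
apply/ler_addgt0Pr => e e0.
have [|s /andP[ts sT] H] := cadlag_right (t := t) cf _ e0; first by rewrite t0.
have [n [k /andP[tk ks]]] := grid_dense T0 t0 ts sT.
rewrite -[f t](subrK (f (grid T n k))) addrC.
rewrite (le_trans (ler_normD _ _))// lerD// distrC ltW// H//.
by rewrite ltW.
Qed.

Lemma cadlag_cst (c : R) : cadlag T (fun=> c).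
Proof.
split=> t _; first exact: cvg_cst.
exact: is_cvg_cst.
Qed.

Lemma left_lim_cst (c : R) t : (0 < t)%E -> left_lim (fun=> c) t = c.
Proof. by move=> t0; apply: left_lim_eq => //; exact: cvg_cst. Qed.

Lemma cadlagD f g : cadlag T f -> cadlag T g -> cadlag T (fun t => f t + g t).
Proof.
move=> [f1 f2] [g1 g2]; split=> t tT.
  by apply: cvgD; [exact: f1|exact: g1].
by apply: is_cvgD; [exact: f2|exact: g2].
Qed.

Lemma left_limD f g t : cadlag T f -> cadlag T g -> (0 < t <= T)%E ->
  left_lim (fun s => f s + g s) t = left_lim f t + left_lim g t.
Proof.
move=> cf cg tT; have /andP[t0 _] := tT.
have FF := left_nbhs_filter t.
by apply: left_lim_eq => //; apply: cvgD; exact: cadlag_left.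
Qed.

Lemma cadlagM f g : cadlag T f -> cadlag T g -> cadlag T (fun t => f t * g t).
Proof.
move=> [f1 f2] [g1 g2]; split=> t tT.
  by apply: cvgM; [exact: f1|exact: g1].
by apply: is_cvgM; [exact: f2|exact: g2].
Qed.

Lemma left_limM f g t : cadlag T f -> cadlag T g -> (0 < t <= T)%E ->
  left_lim (fun s => f s * g s) t = left_lim f t * left_lim g t.
Proof.
move=> cf cg tT; have /andP[t0 _] := tT.
have FF := left_nbhs_filter t.
by apply: left_lim_eq => //; apply: cvgM; exact: cadlag_left.
Qed.

Lemma cadlagZ (c : R) f : cadlag T f -> cadlag T (fun t => c * f t).
Proof. by apply: cadlagM; exact: cadlag_cst. Qed.

Lemma left_limZ (c : R) f t : cadlag T f -> (0 < t <= T)%E ->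
  left_lim (fun s => c * f s) t = c * left_lim f t.
Proof.
move=> cf tT; rewrite left_limM//; last exact: cadlag_cst.
by rewrite left_lim_cst//; case/andP: tT.
Qed.

Lemma cadlag_norm f : cadlag T f -> cadlag T (fun t => `|f t|).
Proof.
move=> [f1 f2]; split=> t tT; first by apply: cvg_norm; exact: f1.
by apply: is_cvg_norm; exact: f2.
Qed.

Lemma cadlag_ext f g : (forall t, times T t -> f t = g t) ->
  cadlag T f -> cadlag T g.
Proof.
move=> fg cf; split=> t /[dup] tT /andP[t0 t1].
- apply/(right_cvgP _ _ t0 t1) => e e0.
  have [s /andP[ts sT] H] := cadlag_right cf tT e0.
  exists s; rewrite ?ts// => r /andP[tr rs]; rewrite -!fg ?H ?ltW//.
    by rewrite /times /= t0 ltW.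
  by rewrite /times /= (le_trans t0 (ltW tr)) (le_trans (ltW rs)).
- apply/cvg_ex; exists (left_lim f t); apply/left_cvgP => // e e0.
  have [s /andP[s0 st] H] := cadlag_leftP cf tT e0.
  exists s; rewrite ?s0// => r /andP[sr rt]; rewrite -fg ?H ?sr//.
  by rewrite /times /= (le_trans s0 (ltW sr)) (le_trans (ltW rt)).
Qed.

Lemma cadlag_uniform_limit f :
  (forall e, 0 < e -> exists2 g, cadlag T g &
     forall t, times T t -> `|f t - g t| <= e) -> cadlag T f.
Proof.
move=> H; split=> t /[dup] tT /andP[t0 t1].
- apply/(right_cvgP _ _ t0 t1) => e e0.
  have e3 : 0 < e / 3 by rewrite divr_gt0.
  have [g cg fg] := H _ e3.
  have [s /andP[ts sT] Hs] := cadlag_right cg tT e3.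
  exists s; rewrite ?ts// => r /andP[tr rs].
  have r1 : times T r.
    by rewrite /times /= (le_trans t0 (ltW tr)) (le_trans (ltW rs)).
  have t2 : times T t by rewrite /times /= t0 ltW.
  have := fg _ r1; have := fg _ t2; have := Hs r; rewrite rs ltW// => /(_ isT).
  rewrite !ltr_norml !ler_norml; lra.
- have FF := left_nbhs_proper t0.
  apply: cauchy_cvg; apply/cauchy_exP => e e0.
  have e3 : 0 < e / 3 by rewrite divr_gt0.
  have [g cg fg] := H _ e3.
  have [s /andP[s0 st] Hs] := cadlag_leftP cg tT e3.
  exists (left_lim g t); rewrite /fmap /nbhs /=; apply/left_nbhsP => //.
  exists s; rewrite ?s0// => r /andP[sr rt].
  have r1 : times T r.
    by rewrite /times /= (le_trans s0 (ltW sr)) (le_trans (ltW rt)).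
  have := fg _ r1; have := Hs r; rewrite sr => /(_ rt).
  rewrite -ball_normE /ball_/= !ltr_norml !ler_norml; lra.
Qed.

Lemma left_lim_le f t (M : R) : cadlag T f ->
  (forall s, times T s -> `|f s| <= M) -> (0 < t <= T)%E -> `|left_lim f t| <= M.
Proof.
move=> cf HM tT; apply/ler_addgt0Pr => e e0.
have [s /andP[s0 st] H] := cadlag_leftP cf tT e0.
have [r /andP[sr rt]] := ereal_dense s0 st.
have r1 : times T r.
  rewrite /times /= (le_trans s0 (ltW sr)) (le_trans (ltW rt))//.
  by case/andP: tT.
have := HM _ r1; have := H r; rewrite sr => /(_ rt).
rewrite !ltr_norml !ler_norml; lra.
Qed.

Lemma left_lim_ext f g t : cadlag T f ->
  (forall s, times T s -> f s = g s) -> (0 < t <= T)%E -> left_lim f t = left_lim g t.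
Proof.
move=> cf fg tT; have /andP[t0 t1] := tT; apply/esym/left_lim_eq => //.
apply/left_cvgP => // e e0.
have [s /andP[s0 st] H] := cadlag_leftP cf tT e0.
exists s; rewrite ?s0// => r /andP[sr rt]; rewrite -fg ?H ?sr//.
by rewrite /times /= (le_trans s0 (ltW sr)) (le_trans (ltW rt)).
Qed.

Definition step (s t : \bar R) : R := (s <= t)%E%:R.

Lemma cadlag_step s : cadlag T (step s).
Proof.
split=> t /andP[t0 tT].
- apply/(right_cvgP _ _ t0 tT) => e e0; have [st|ts] := leP s t.
    exists T; rewrite ?tT ?lexx// => r /andP[tr rT].
    by rewrite /step st (le_trans st (ltW tr)) subrr normr0.
  exists (Order.min s T); first by rewrite lt_min ts tT ge_min lexx orbT.
  move=> r; rewrite lt_min => /and3P[tr rs rT].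
  by rewrite /step !leNgt ts rs subrr normr0.
- have [st|ts] := ltP s t; apply/cvg_ex.
    exists 1; apply/left_cvgP => // e e0.
    exists (Order.max 0%E s); first by rewrite le_max lexx/= gt_max t0.
    move=> r; rewrite gt_max => /andP[/andP[r0 sr] rt].
    by rewrite /step (ltW sr) subrr normr0.
  exists 0; apply/left_cvgP => // e e0; exists 0%E; rewrite ?lexx//.
  by move=> r /andP[_ rt]; rewrite /step leNgt (lt_le_trans rt ts) subrr normr0.
Qed.

Lemma left_lim_step s t : (0 < t)%E -> left_lim (step s) t = (s < t)%E%:R.
Proof.
move=> t0; apply: left_lim_eq => //; apply/left_cvgP => // e e0.
have [st|ts] := ltP s t.
  exists (Order.max 0%E s); first by rewrite le_max lexx/= gt_max t0.
  move=> r; rewrite gt_max => /andP[/andP[r0 sr] rt].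
  by rewrite /step (ltW sr) subrr normr0.
exists 0%E; rewrite ?lexx// => r /andP[_ rt].
by rewrite /step leNgt (lt_le_trans rt ts) subrr normr0.
Qed.

Definition cell n k : set (\bar R) := [set t | (grid T n k <= t < grid T n k.+1)%E].

(** Step functions on the cells of a grid.  A cadlag path is the limit of those that take
its values at the right ends of the cells, and its left limits are the limits of those
that take its values at the left ends; only countably many values of the path enter,
which gives the measurability of integrals of random paths. *)
Definition cellfun n (a : nat -> R) (b : R) t : R :=
  \sum_(k < 2 ^ n) a k * \1_(cell n k) t + b * \1_[set T] t.

Definition right_approx n f := cellfun n (fun k => f (grid T n k.+1)) (f T).

Definition left_approx n f t : R :=
  \sum_(k < 2 ^ n) f (grid T n k) * (grid T n k < t <= grid T n k.+1)%E%:R.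

Lemma cellfunE n k a b t : (k < 2 ^ n)%N -> cell n k t -> cellfun n a b t = a k.
Proof.
move=> kn kt; rewrite /cellfun (bigD1 (Ordinal kn))//= indicE mem_set// mulr1 big1.
  rewrite addr0 indicE in_set1 (_ : t == T = false) ?mulr0 ?addr0//; apply/eqP => tT.
  move: kt; rewrite tT /cell/= => /andP[_]; rewrite ltNge.
  by have /andP[_ ->] := grid_times T0 n k.+1.
move=> i ik; rewrite indicE memNset ?mulr0// => it.
by move/eqP: ik; apply; apply: val_inj => /=; exact: grid_cell_uniq it kt.
Qed.

Lemma cellfunT n a b : cellfun n a b T = b.
Proof.
rewrite /cellfun indicE in_set1 eqxx mulr1 big1 ?add0r// => k _.
rewrite indicE memNset ?mulr0//= => /andP[_]; rewrite ltNge.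
by have /andP[_ ->] := grid_times T0 n k.+1.
Qed.

Lemma times_cellP n t : times T t -> t = T \/ exists2 k, (k < 2 ^ n)%N & cell n k t.
Proof.
move=> /andP[t0]; rewrite le_eqVlt => /predU1P[->|tT]; first by left.
have [|k kn kt] := @grid_cellP _ T T0 n t; first by rewrite t0.
by right; exists k.
Qed.

Lemma cellfun_le n a b t (M : R) : (forall k, (k < 2 ^ n)%N -> `|a k| <= M) ->
  `|b| <= M -> times T t -> `|cellfun n a b t| <= M.
Proof.
move=> aM bM /(times_cellP n)[->|[k kn kt]]; first by rewrite cellfunT.
by rewrite (cellfunE _ _ kn kt) aM.
Qed.

Lemma left_approxE n k f t : (k < 2 ^ n)%N ->
  (grid T n k < t <= grid T n k.+1)%E -> left_approx n f t = f (grid T n k).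
Proof.
move=> kn kt; rewrite /left_approx (bigD1 (Ordinal kn))//= kt mulr1 big1 ?addr0//.
move=> i ik; rewrite (_ : (_ && _) = false) ?mulr0//; apply/negP => it.
by move/eqP: ik; apply; apply: val_inj => /=; exact: grid_cell_left_uniq it kt.
Qed.

Lemma right_approx_cvg f t : cadlag T f -> times T t ->
  right_approx n f t @[n --> \oo] --> f t.
Proof.
move=> cf /andP[t0]; rewrite le_eqVlt => /predU1P[->|tT].
  by under eq_fun do rewrite /right_approx cellfunT; exact: cvg_cst.
apply/cvgrPdist_lt => e e0.
have [|s /andP[ts sT] H] := cadlag_right (t := t) cf _ e0; first by rewrite t0.
have [N HN] := grid_near_right T0 t0 ts sT.
exists N => // n /= Nn.
have [|k kn kt] := @grid_cellP _ T T0 n t; first by rewrite t0.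
rewrite /right_approx (cellfunE _ _ kn kt) distrC H// (HN n k)//.
by case/andP: kt => _ /ltW ->.
Qed.

Lemma left_approx_cvg f t : cadlag T f -> (0 < t <= T)%E ->
  left_approx n f t @[n --> \oo] --> left_lim f t.
Proof.
move=> cf /[dup] tT /andP[t0 t1].
apply/cvgrPdist_lt => e e0.
have [s /andP[s0 st] H] := cadlag_leftP cf tT e0.
have [N HN] := grid_near_left T0 s0 st t1.
exists N => // n /= Nn.
have [k kn kt] := @grid_cell_leftP _ T T0 n t tT.
rewrite (left_approxE _ kn kt) distrC H// (HN n k)//.
by case/andP: kt.
Qed.

Lemma right_approx_le n f t (M : R) : (forall s, times T s -> `|f s| <= M) ->
  times T t -> `|right_approx n f t| <= M.
Proof.
move=> HM; apply: cellfun_le => [k kn|]; apply: HM; last exact: timesT.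
exact: grid_times.
Qed.

Definition lgrid n t : \bar R :=
  \big[Order.max/0%E]_(k < 2 ^ n | (grid T n k < t)%E) grid T n k.

Lemma lgridE n k t : (k < 2 ^ n)%N -> (grid T n k < t <= grid T n k.+1)%E ->
  lgrid n t = grid T n k.
Proof.
move=> kn /andP[kt tk]; apply/eqP; rewrite eq_le; apply/andP; split.
  apply: bigmax_le => [|i it]; first by case/andP: (grid_times T0 n k).
  apply: le_grid => //; rewrite leqNgt; apply/negP => ki.
  by have := lt_le_trans it (le_trans tk (le_grid T0 n ki)); rewrite ltxx.
by rewrite /lgrid; apply: (@le_bigmax_cond _ _ _ _ (Ordinal kn)).
Qed.

Lemma lgrid_lt n t : (0 < t <= T)%E -> (0 <= lgrid n t < t)%E.
Proof.
move=> tT; have [k kn kt] := grid_cell_leftP T0 n tT.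
rewrite (lgridE kn kt); case/andP: kt => -> _.
by case/andP: (grid_times T0 n k) => ->.
Qed.

Lemma lgrid_near s t : (s < t)%E -> (0 < t <= T)%E ->
  \forall n \near \oo, (s < lgrid n t)%E.
Proof.
move=> st /[dup] tT /andP[t0 t1].
have s1 : (0 <= Order.max 0%E s)%E by rewrite le_max lexx.
have s2 : (Order.max 0%E s < t)%E by rewrite gt_max t0.
have [N HN] := grid_near_left T0 s1 s2 t1.
exists N => // n /= Nn; have [k kn kt] := grid_cell_leftP T0 n tT.
have := HN n k Nn kt; rewrite (lgridE kn kt) gt_max.
by case/andP.
Qed.

Lemma left_approx_le n f t (M : R) : 0 <= M ->
  (forall s, times T s -> `|f s| <= M) -> times T t -> `|left_approx n f t| <= M.
Proof.
move=> M0 HM /andP[]; rewrite le_eqVlt => /predU1P[<- _|t0 tT].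
  rewrite /left_approx big1 ?normr0// => k _; rewrite ltNge.
  by have /andP[-> _] := grid_times T0 n k; rewrite mulr0.
have [|k kn kt] := @grid_cell_leftP _ T T0 n t; first by rewrite t0.
by rewrite (left_approxE _ kn kt) HM//; exact: grid_times.
Qed.

Lemma cadlag_sum n (F : nat -> \bar R -> R) : (forall k, cadlag T (F k)) ->
  cadlag T (fun t => \sum_(k < n) F k t).
Proof.
move=> cF; elim: n => [|n IH].
  by under eq_fun do rewrite big_ord0; exact: cadlag_cst.
under eq_fun do rewrite big_ord_recr/=; exact: cadlagD.
Qed.

Lemma cadlag_cellfun n a b : cadlag T (cellfun n a b).
Proof.
apply: (@cadlag_ext (fun t => \sum_(k < 2 ^ n) (a k * (step (grid T n k) t +
  (-1) * step (grid T n k.+1) t)) + b * step T t)).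
  move=> t /andP[t0 tT]; rewrite /cellfun; congr (_ + _).
    apply: eq_bigr => k _; congr (_ * _); rewrite /step indicE /cell mem_setb.
    have gk : (grid T n k <= grid T n k.+1)%E by exact: le_grid.
    have [g1|g1] := leP (grid T n k) t; have [g2|g2] := leP (grid T n k.+1) t.
    - by rewrite mulr1 subrr.
    - by rewrite mulr0 addr0.
    - by have := le_lt_trans (le_trans gk g2) g1; rewrite ltxx.
    - by rewrite mulr0 addr0.
  congr (_ * _); rewrite /step indicE in_set1; congr (_%:R).
  by rewrite eq_le tT.
apply: cadlagD.
  apply: (@cadlag_sum _ (fun k t => a k * (step (grid T n k) t +
    (-1) * step (grid T n k.+1) t))) => k; apply: cadlagZ.
  by apply: cadlagD; [exact: cadlag_step|apply: cadlagZ; exact: cadlag_step].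
by apply: cadlagZ; exact: cadlag_step.
Qed.

End Cadlag.

(** * Integrals against signed measures *)

Section FiniteMeasures.
Context {R : realType} d (X : measurableType d).

Section Add.
Variables m m' : {finite_measure set X -> \bar R}.

Definition madd : set X -> \bar R := measure_add m m'.

Let madd0 : madd set0 = 0%E. Proof. exact: measure0. Qed.
Let madd_ge0 A : (0 <= madd A)%E. Proof. exact: measure_ge0. Qed.
Let madd_sigma_additive : semi_sigma_additive madd.
Proof. exact: measure_semi_sigma_additive. Qed.

HB.instance Definition _ := isMeasure.Build _ _ _ madd
  madd0 madd_ge0 madd_sigma_additive.

Let madd_fin : fin_num_fun madd.
Proof. by move=> A mA; rewrite /madd measure_addE fin_numD !fin_num_measure. Qed.

HB.instance Definition _ := @Measure_isFinite.Build _ _ _ madd madd_fin.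
End Add.

Lemma maddE (m m' : {finite_measure set X -> \bar R}) A :
  madd m m' A = (m A + m' A)%E.
Proof. exact: measure_addE. Qed.

Definition mmul (k : {nonneg R}) (m : {finite_measure set X -> \bar R}) :
  {finite_measure set X -> \bar R} := mscale k m.

Lemma mmulE (k : {nonneg R}) (m : {finite_measure set X -> \bar R}) A :
  mmul k m A = (k%:num%:E * m A)%E.
Proof. by []. Qed.

Lemma integral_madd (m m' : {finite_measure set X -> \bar R}) D (f : X -> \bar R) :
  measurable D -> m.-integrable D f -> m'.-integrable D f ->
  (\int[madd m m']_(x in D) f x = \int[m]_(x in D) f x + \int[m']_(x in D) f x)%E.
Proof. by move=> mD mf m'f; rewrite -integral_measure_add. Qed.

Lemma ge0_integral_mmul k (m : {finite_measure set X -> \bar R}) D (f : X -> \bar R) :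
  measurable D -> measurable_fun D f -> (forall x, D x -> (0 <= f x)%E) ->
  (\int[mmul k m]_(x in D) f x = k%:num%:E * \int[m]_(x in D) f x)%E.
Proof. by move=> mD mf f0; rewrite -ge0_integral_mscale//. Qed.

End FiniteMeasures.

Lemma cvg_seq_le (R : realType) (u : nat -> R) l M :
  u n @[n --> \oo] --> l -> (forall n, u n <= M) -> l <= M.
Proof.
move=> ul uM; rewrite -(cvg_lim _ ul)//; apply: limr_le; last exact: nearW.
by apply/cvg_ex; exists l.
Qed.

Lemma cvg_seq_uniq (R : realType) (u : nat -> R) (l l' : R) :
  u n @[n --> \oo] --> l -> u n @[n --> \oo] --> l' -> l = l'.
Proof. by move=> ul ul'; rewrite -(cvg_lim _ ul)// -(cvg_lim _ ul'). Qed.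

Section FinNum.
Context {R : realFieldType}.
Implicit Types x y z t a b : \bar R.

Lemma fin_swap x y a b : (x - y = a - b)%E -> x \is a fin_num -> y \is a fin_num ->
  a \is a fin_num -> b \is a fin_num -> (x + b = y + a)%E.
Proof.
move: x y a b => [x| |] [y| |] [a| |] [b| |]//=.
by rewrite -!EFinB -!EFinD => -[xyab] _ _ _ _; apply: (congr1 EFin); lra.
Qed.

Lemma fin_swap' x y a b : x \is a fin_num -> y \is a fin_num ->
  a \is a fin_num -> b \is a fin_num -> (x + y = a + b)%E -> (x - a = b - y)%E.
Proof.
move: x y a b => [x| |] [y| |] [a| |] [b| |]//= _ _ _ _.
by rewrite -!EFinB -!EFinD => -[xyab]; apply: (congr1 EFin); lra.
Qed.

Lemma fin_lin (c : R) x y z t : x \is a fin_num -> y \is a fin_num ->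
  z \is a fin_num -> t \is a fin_num ->
  (c%:E * (x - y) + (z - t) = (c%:E * x + z) - (c%:E * y + t))%E.
Proof.
move: x y z t => [x| |] [y| |] [z| |] [t| |]// _ _ _ _.
by rewrite -?(EFinB, EFinM, EFinD); apply: (congr1 EFin); lra.
Qed.

Lemma fin_linN (c : R) x y z t : x \is a fin_num -> y \is a fin_num ->
  z \is a fin_num -> t \is a fin_num ->
  (c%:E * (x - y) + (z - t) = ((- c)%:E * y + z) - ((- c)%:E * x + t))%E.
Proof.
move: x y z t => [x| |] [y| |] [z| |] [t| |]// _ _ _ _.
by rewrite -?(EFinB, EFinM, EFinD); apply: (congr1 EFin); lra.
Qed.

Lemma fin_linD (c : R) x y z t : x \is a fin_num -> y \is a fin_num ->
  z \is a fin_num -> t \is a fin_num ->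
  ((c%:E * x + z) + (c%:E * y + t) = c%:E * (x + y) + (z + t))%E.
Proof.
move: x y z t => [x| |] [y| |] [z| |] [t| |]// _ _ _ _.
by rewrite -?(EFinB, EFinM, EFinD); apply: (congr1 EFin); lra.
Qed.

Lemma fine_mulB (k : R) x y : x \is a fin_num -> y \is a fin_num ->
  fine (k%:E * x - k%:E * y)%E = k * fine (x - y)%E.
Proof. by move: x y => [x| |] [y| |]// _ _ /=; rewrite mulrBr. Qed.

End FinNum.

Section SignedMeasure.
Context {R : realType} (T : \bar R).
Hypothesis T0 : (0 < T)%E.
Implicit Types (u : smeasure (R := R)) (f g : \bar R -> R) (A : set (\bar R)).
Local Notation jp u := (jordan_pos (hahnP u)).
Local Notation jn u := (jordan_neg (hahnP u)).

Lemma measurable_times : measurable (times T).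
Proof.
rewrite (_ : times T = [set` `[0%E, T]]); first exact: emeasurable_itv.
by apply/seteqP; split => t /=; rewrite in_itv.
Qed.
Local Notation mT := measurable_times.

Definition bounded_measurable f :=
  measurable_fun (times T) f /\ exists M, forall t, times T t -> `|f t| <= M.

Lemma bm_integrable (mu : {finite_measure set (\bar R) -> \bar R}) f :
  bounded_measurable f -> mu.-integrable (times T) (EFin \o f).
Proof.
move=> [mf [M HM]]; apply: measurable_bounded_integrable => //.
- exact: mT.
- by rewrite -ge0_fin_numE// fin_num_measure//; exact: mT.
- exists M; split; first exact: num_real.
  by move=> x Mx t tT /=; rewrite (le_trans (HM t tT))// ltW.
Qed.

Lemma bmD f g : bounded_measurable f -> bounded_measurable g ->
  bounded_measurable (fun t => f t + g t).
Proof.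
move=> [mf [M HM]] [mg [N HN]]; split; first exact: measurable_funD.
by exists (M + N) => t tT; rewrite (le_trans (ler_normD _ _))// lerD ?HM ?HN.
Qed.

Lemma bmZ (c : R) f : bounded_measurable f -> bounded_measurable (fun t => c * f t).
Proof.
move=> [mf [M HM]]; split; first exact: measurable_funM.
by exists (`|c| * M) => t tT; rewrite normrM ler_wpM2l// HM.
Qed.

Lemma bm_indic A : measurable A -> bounded_measurable (\1_A : \bar R -> R).
Proof.
move=> mA; split; first exact: measurable_indic.
by exists 1 => t _; rewrite indicE; case: (_ \in _); rewrite ?normr1 ?normr0.
Qed.

Lemma jordan_posI u A : measurable A ->
  jp u A = u (A `&` (projT1 (cid (hahn_ex u))).1).
Proof. by move=> mA; rewrite jordan_posE cjordan_posE /crestr0 mem_set. Qed.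

Lemma jordan_negI u A : measurable A ->
  jn u A = (- u (A `&` (projT1 (cid (hahn_ex u))).2))%E.
Proof. by move=> mA; rewrite jordan_negE cjordan_negE /crestr0 mem_set. Qed.

Lemma hahn_pos_measurable u : measurable (projT1 (cid (hahn_ex u))).1.
Proof. by have [[]] := hahnP u. Qed.

Lemma hahn_neg_measurable u : measurable (projT1 (cid (hahn_ex u))).2.
Proof. by have [_ []] := hahnP u. Qed.

Lemma jordanE u A : measurable A -> u A = (jp u A - jn u A)%E.
Proof. by move=> mA; rewrite (jordan_decomp (hahnP u) mA) /cadd/= cscaleN1. Qed.

Lemma tvE u : (tv_norm u)%:E = (jp u setT + jn u setT)%E.
Proof.
by rewrite /tv_norm /charge_variation fineK// fin_numD !fin_num_measure.
Qed.

Lemma tv_ge0 u : 0 <= tv_norm u.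
Proof. by rewrite -lee_fin tvE adde_ge0. Qed.

Lemma tv_ge u A : measurable A -> (`|u A| <= (tv_norm u)%:E)%E.
Proof.
move=> mA; rewrite tvE; apply: le_trans (abse_charge_variation (hahnP u) mA) _.
by rewrite /charge_variation/= leeD// le_measure// inE.
Qed.

Lemma charge_fin_num u A : measurable A -> u A \is a fin_num.
Proof. by move=> mA; exact: fin_num_measure. Qed.

(** Evaluate the two measures on the sets of a Hahn decomposition. *)
Lemma tv_le u (a b : {finite_measure set (\bar R) -> \bar R}) :
  (forall A, measurable A -> u A = (a A - b A)%E) ->
  ((tv_norm u)%:E <= a setT + b setT)%E.
Proof.
move=> uab; rewrite tvE leeD//.
- have mP := hahn_pos_measurable u.
  rewrite jordan_posI// setTI uab//.
  rewrite (@le_trans _ _ (a (projT1 (cid (hahn_ex u))).1))//.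
    by rewrite leeBlDr ?fin_num_measure// leeDl.
  by rewrite le_measure// inE.
- have mN := hahn_neg_measurable u.
  rewrite jordan_negI// setTI uab// oppeB; last first.
    by rewrite fin_num_adde_defr// fin_num_measure.
  rewrite (@le_trans _ _ (b (projT1 (cid (hahn_ex u))).2))//.
    by rewrite addeC leeBlDr ?fin_num_measure// leeDl.
  by rewrite le_measure// inE.
Qed.

(** Two decompositions of a signed measure into positive ones have the same crosswise
sums, hence the integral does not depend on the Jordan decomposition that defines it. *)
Lemma sintegral_diff u (a b : {finite_measure set (\bar R) -> \bar R}) f :
  (forall A, measurable A -> u A = (a A - b A)%E) -> bounded_measurable f ->
  sintegral T u f = \int[a]_(t in times T) f t - \int[b]_(t in times T) f t.
Proof.
move=> uab bf.
have E : (\int[madd (jp u) b]_(t in times T) (EFin \o f) t =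
          \int[madd (jn u) a]_(t in times T) (EFin \o f) t)%E.
  apply: eq_measure_integral => A mA AT.
  have := uab A mA; rewrite jordanE// => /fin_swap H.
  by rewrite /= !maddE; apply: H; exact: fin_num_measure.
move: E; rewrite !integral_madd//; try exact: bm_integrable; try exact: mT.
rewrite /sintegral /Rintegral => E.
have F (mu : {finite_measure set (\bar R) -> \bar R}) :
    (\int[mu]_(t in times T) (EFin \o f) t)%E \is a fin_num.
  by apply: integrable_fin_num; [exact: mT|exact: bm_integrable].
move: E => /(fin_swap' (F (jp u)) (F b) (F (jn u)) (F a)) E.
by have := congr1 fine E; rewrite (fineB (F (jp u)) (F (jn u))) (fineB (F a) (F b)).
Qed.

Lemma le_Rint (mu : {finite_measure set (\bar R) -> \bar R}) f (M : R) :
  bounded_measurable f -> 0 <= M -> (forall t, times T t -> `|f t| <= M) ->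
  `|\int[mu]_(t in times T) f t| <= M * fine (mu setT).
Proof.
move=> bf M0 HM.
rewrite (le_trans (le_normr_Rintegral mT (bm_integrable mu bf)))//.
have bc : bounded_measurable (fun=> M).
  by split; [exact: measurable_cst|exists `|M|].
have bn : bounded_measurable (fun t => `|f t|).
  case: bf => mf [N HN]; split; first exact: measurableT_comp.
  by exists N => t tT; rewrite normr_id HN.
apply: (@le_trans _ _ (\int[mu]_(t in times T) M)).
  by apply: le_Rintegral => //; [exact: mT|exact: bm_integrable|exact: bm_integrable].
rewrite Rintegral_cst//; last exact: mT.
rewrite ler_wpM2l// fine_le ?fin_num_measure//; first exact: mT.
by rewrite le_measure// inE//; exact: mT.
Qed.

Lemma sintegral_le u f (M : R) : bounded_measurable f -> 0 <= M ->
  (forall t, times T t -> `|f t| <= M) -> `|sintegral T u f| <= M * tv_norm u.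
Proof.
move=> bf M0 HM; rewrite /sintegral (le_trans (ler_normB _ _))//.
have -> : tv_norm u = fine (jp u setT) + fine (jn u setT).
  by rewrite /tv_norm /charge_variation fineD// fin_num_measure.
by rewrite mulrDr lerD// le_Rint.
Qed.

Lemma sintegralD u f g : bounded_measurable f -> bounded_measurable g ->
  sintegral T u (fun t => f t + g t) = sintegral T u f + sintegral T u g.
Proof.
move=> bf bg; rewrite /sintegral !RintegralD; try exact: bm_integrable; try exact: mT.
by lra.
Qed.

Lemma sintegralZ u f (c : R) : bounded_measurable f ->
  sintegral T u (fun t => c * f t) = c * sintegral T u f.
Proof.
move=> bf; rewrite /sintegral !RintegralZl; try exact: bm_integrable; try exact: mT.
by rewrite mulrBr.
Qed.

Lemma sintegral_sum u (I : Type) (r : seq I) (c : I -> R) (F : I -> \bar R -> R) :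
  (forall i, bounded_measurable (F i)) ->
  sintegral T u (fun t => \sum_(i <- r) c i * F i t) =
  \sum_(i <- r) c i * sintegral T u (F i).
Proof.
move=> bF.
suff [] : bounded_measurable (fun t => \sum_(i <- r) c i * F i t) /\
   sintegral T u (fun t => \sum_(i <- r) c i * F i t) =
  \sum_(i <- r) c i * sintegral T u (F i) by [].
elim: r => [|i r [IH1 IH2]].
  have -> : (fun t => \sum_(i <- [::]) c i * F i t) = fun=> 0.
    by apply/funext => t; rewrite big_nil.
  rewrite big_nil; split.
    by split; [exact: measurable_cst|exists 0 => t _; rewrite normr0].
  by rewrite /sintegral !Rintegral_cst ?mul0r ?subr0//; exact: mT.
have -> : (fun t => \sum_(i <- i :: r) c i * F i t) =
    fun t => c i * F i t + \sum_(i <- r) c i * F i t.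
  by apply/funext => t; rewrite big_cons.
split; first by apply: bmD => //; exact: bmZ.
by rewrite big_cons sintegralD// ?IH2 ?sintegralZ//; exact: bmZ.
Qed.

Lemma sintegral_indic u A : Mspace T u -> measurable A ->
  sintegral T u \1_A = fine (u A).
Proof.
move=> Mu mA.
have E (mu : {finite_measure set (\bar R) -> \bar R}) :
    \int[mu]_(t in times T) \1_A t = fine (mu (A `&` times T)).
  by rewrite /Rintegral integral_indic//; exact: mT.
have mAT : measurable (A `&` times T) by apply: measurableI => //; exact: mT.
have mAC : measurable (A `\` times T) by apply: measurableD => //; exact: mT.
rewrite /sintegral !E -fineB ?fin_num_measure// -jordanE//.
congr fine; rewrite -[in RHS](setUIDK A (times T)) chargeU//.
  by rewrite [X in (_ + X)%E]Mu ?adde0//; apply/seteqP; split => // t [[]].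
by apply/seteqP; split => // t [[_ ?] []].
Qed.

Lemma eq_sintegral u f g : (forall t, times T t -> f t = g t) ->
  sintegral T u f = sintegral T u g.
Proof.
by move=> fg; rewrite /sintegral; congr (_ - _); apply: eq_Rintegral => t /set_mem/fg.
Qed.

Lemma sintegral_dct u (F : nat -> \bar R -> R) f (M : R) :
  (forall n, bounded_measurable (F n)) -> 
  (forall n t, times T t -> `|F n t| <= M) ->
  (forall t, times T t -> F n t @[n --> \oo] --> f t) ->
  bounded_measurable f /\ sintegral T u (F n) @[n --> \oo] --> sintegral T u f.
Proof.
move=> bF HM cF.
have bf : bounded_measurable f.
  split; first by apply: (@measurable_fun_cvg _ _ _ _ F) => // n; case: (bF n).
  exists M => t tT; apply: (@cvg_seq_le _ (fun n => `|F n t|)).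
    exact: cvg_norm (cF t tT).
  by move=> n; exact: HM.
split => //.
have M0 : 0 <= M by rewrite (le_trans (normr_ge0 _) (HM 0 _ (times0 T0))).
have C (mu : {finite_measure set (\bar R) -> \bar R}) :
    \int[mu]_(t in times T) F n t @[n --> \oo] --> \int[mu]_(t in times T) f t.
  have bc : bounded_measurable (fun=> M).
    by split; [exact: measurable_cst|exists `|M|].
  apply: fine_cvg.
  rewrite fineK; last first.
    by apply: integrable_fin_num; [exact: mT|exact: bm_integrable].
  apply: (@dominated_cvg _ _ _ mu (times T) mT (fun n t => (F n t)%:E) _ (fun=> M%:E)) => //.
  - by move=> n; apply/measurable_EFinP; case: (bF n).
  - by move=> t tT; apply: cvg_EFin; [exact: nearW|exact: cF].
  - exact: (bm_integrable mu bc).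
by rewrite /sintegral; exact: (cvgB (C (jp u)) (C (jn u))).
Qed.

(** Positive and negative parts are exchanged when the coefficient is negative.  The
decomposition gives linearity in the measure of the integral as well as
subadditivity of the total variation. *)
Lemma smeasure_lin_diff (c : R) u u' :
  exists a b : {finite_measure set (\bar R) -> \bar R},
  [/\ forall A, measurable A -> cadd (cscale c u) u' A = (a A - b A)%E,
      (a setT + b setT = `|c|%:E * (tv_norm u)%:E + (tv_norm u')%:E)%E &
      forall f, bounded_measurable f ->
      \int[a]_(t in times T) f t - \int[b]_(t in times T) f t =
      c * sintegral T u f + sintegral T u' f].
Proof.
have sc (m : {finite_measure set (\bar R) -> \bar R}) (k : {nonneg R}) f :
    bounded_measurable f ->
    \int[mmul k m]_(t in times T) f t = k%:num * \int[m]_(t in times T) f t.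
  move=> bf; rewrite /Rintegral.
  have F : (\int[m]_(t in times T) (f t)%:E)%E \is a fin_num.
    by apply: integrable_fin_num; [exact: mT|exact: bm_integrable].
  rewrite [in LHS]integralE [in RHS]integralE.
  have [mf _] := bf.
  rewrite !ge0_integral_mmul//; try exact: mT;
    try by [apply: measurable_funepos; exact/measurable_EFinP|
            apply: measurable_funeneg; exact/measurable_EFinP].
  have ip := integrable_pos_fin_num mT (bm_integrable m bf).
  have ine := integrable_neg_fin_num mT (bm_integrable m bf).
  exact: fine_mulB.
have ad (m m' : {finite_measure set (\bar R) -> \bar R}) f : bounded_measurable f ->
    \int[madd m m']_(t in times T) f t =
    \int[m]_(t in times T) f t + \int[m']_(t in times T) f t.
  move=> bf; rewrite /Rintegral integral_madd; try exact: bm_integrable; try exact: mT.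
  by rewrite fineD//; apply: integrable_fin_num; try exact: bm_integrable; exact: mT.
have fn (m : {finite_measure set (\bar R) -> \bar R}) A : measurable A -> m A \is a fin_num.
  by move=> mA; rewrite fin_num_measure.
pose k : {nonneg R} := NngNum (normr_ge0 c).
have [c0|c0] := leP 0 c.
- exists (madd (mmul k (jp u)) (jp u')), (madd (mmul k (jn u)) (jn u')).
  split.
  + move=> A mA; rewrite /cadd /= /cscale !maddE !mmulE /= ger0_norm//.
    by rewrite (jordanE u mA) (jordanE u' mA) fin_lin//; exact: fin_num_measure.
  + rewrite /= !maddE !mmulE /= !tvE.
    by rewrite fin_linD//; exact: fin_num_measure.
  + by move=> f bf; rewrite !ad// !sc// /= ger0_norm// /sintegral; lra.
- exists (madd (mmul k (jn u)) (jp u')), (madd (mmul k (jp u)) (jn u')).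
  split.
  + move=> A mA; rewrite /cadd /= /cscale !maddE !mmulE /= ltr0_norm//.
    by rewrite (jordanE u mA) (jordanE u' mA) fin_linN//; exact: fin_num_measure.
  + rewrite /= !maddE !mmulE /= !tvE.
    by rewrite fin_linD ?[(jn u _ + _)%E]addeC//; exact: fin_num_measure.
  + by move=> f bf; rewrite !ad// !sc// /= ltr0_norm// /sintegral; lra.
Qed.

Lemma sintegral_lin (c : R) u u' f : bounded_measurable f ->
  sintegral T (cadd (cscale c u) u' : smeasure) f = c * sintegral T u f + sintegral T u' f.
Proof.
move=> bf; have [a [b [ab _ E]]] := smeasure_lin_diff c u u'.
by rewrite (sintegral_diff ab bf) E.
Qed.

Lemma tv_lin (c : R) u u' :
  tv_norm (cadd (cscale c u) u' : smeasure) <= `|c| * tv_norm u + tv_norm u'.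
Proof.
have [a [b [ab E _]]] := smeasure_lin_diff c u u'.
by rewrite -lee_fin EFinD EFinM -E; exact: tv_le.
Qed.

Lemma smeasure_linE (c : R) u u' A :
  (cadd (cscale c u) u' : smeasure) A = (c%:E * u A + u' A)%E.
Proof. by []. Qed.

Lemma Mspace_lin (c : R) u u' : Mspace T u -> Mspace T u' ->
  Mspace T (cadd (cscale c u) u' : smeasure).
Proof.
by move=> Mu Mu' A mA AT; rewrite smeasure_linE (Mu A)// (Mu' A)// mule0 adde0.
Qed.

Lemma Mtilde_lin (c : R) u u' : Mtilde T u -> Mtilde T u' ->
  Mtilde T (cadd (cscale c u) u' : smeasure).
Proof.
move=> [Mu u0 [C cC HC]] [Mu' u'0 [C' cC' HC']]; split.
- exact: Mspace_lin.
- by rewrite smeasure_linE u0 u'0 mule0 adde0.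
- exists (C `|` C'); first by rewrite -bigcup2E; apply: bigcup_countable => // -[|[|i]] _ //=.
  move=> A mA; rewrite setIUr => /seteqP[H _].
  rewrite smeasure_linE (HC A mA) ?(HC' A mA) ?mule0 ?adde0//.
    by apply/seteqP; split => // t At; apply: (H t); right.
  by apply/seteqP; split => // t At; apply: (H t); left.
Qed.

(** The measures that integrate left limits do not charge 0; the value 0 there makes the
function of left limits measurable and bounded on all of [0, T]. *)
Definition left_path f t : R := if t == 0%E then 0 else left_lim f t.

Lemma measurable_grid_cell (a b : \bar R) : measurable [set t | (a <= t < b)%E].
Proof.
rewrite (_ : [set t | _] = [set` `[a, b[]); first exact: emeasurable_itv.
by apply/seteqP; split => t /=; rewrite in_itv.
Qed.

Lemma measurable_grid_cell_left (a b : \bar R) : measurable [set t | (a < t <= b)%E].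
Proof.
rewrite (_ : [set t | _] = [set` `]a, b]]); first exact: emeasurable_itv.
by apply/seteqP; split => t /=; rewrite in_itv.
Qed.

Lemma left_approx_indic n f : left_approx T n f =
  fun t => \sum_(i <- index_enum 'I_(2 ^ n)) f (grid T n i) *
     \1_[set t | (grid T n i < t <= grid T n i.+1)%E] t.
Proof.
apply/funext => t; rewrite /left_approx.
by apply: eq_bigr => k _; rewrite indicE mem_setb.
Qed.

Lemma bm_sum (I : Type) (r : seq I) (c : I -> R) (F : I -> \bar R -> R) :
  (forall i, bounded_measurable (F i)) ->
  bounded_measurable (fun t => \sum_(i <- r) c i * F i t).
Proof.
move=> bF; elim: r => [|i r IH].
  have -> : (fun t => \sum_(i <- [::]) c i * F i t) = fun=> 0.
    by apply/funext => t; rewrite big_nil.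
  by split; [exact: measurable_cst|exists 0 => t _; rewrite normr0].
have -> : (fun t => \sum_(i <- i :: r) c i * F i t) =
    fun t => c i * F i t + \sum_(i <- r) c i * F i t.
  by apply/funext => t; rewrite big_cons.
by apply: bmD => //; exact: bmZ.
Qed.

Lemma measurable_cell n k : measurable (cell T n k).
Proof. exact: measurable_grid_cell. Qed.

Lemma bm_cellfun n a b : bounded_measurable (cellfun T n a b).
Proof.
apply: bmD.
  apply: (@bm_sum 'I_(2 ^ n) _ a (fun k => \1_(cell T n k))) => k.
  by apply: bm_indic; exact: measurable_cell.
by apply: bmZ; apply: bm_indic; exact: emeasurable_set1.
Qed.

Lemma bm_left_approx n f : bounded_measurable (left_approx T n f).
Proof.
rewrite left_approx_indic.
by apply: bm_sum => k; apply: bm_indic; exact: measurable_grid_cell_left.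
Qed.

Lemma sintegral_cellfun u n a b : Mspace T u ->
  sintegral T u (cellfun T n a b) =
  \sum_(k < 2 ^ n) a k * fine (u (cell T n k)) + b * fine (u [set T]).
Proof.
move=> Mu; rewrite /cellfun sintegralD; last 2 first.
- apply: (@bm_sum 'I_(2 ^ n) _ a (fun k => \1_(cell T n k))) => k.
  by apply: bm_indic; exact: measurable_cell.
- by apply: bmZ; apply: bm_indic; exact: emeasurable_set1.
rewrite (@sintegral_sum _ 'I_(2 ^ n) _ a (fun k => \1_(cell T n k))); last first.
  by move=> k; apply: bm_indic; exact: measurable_cell.
rewrite sintegralZ; last by apply: bm_indic; exact: emeasurable_set1.
rewrite (sintegral_indic Mu (emeasurable_set1 T)).
by congr (_ + _); apply: eq_bigr => k _; rewrite (sintegral_indic Mu (measurable_cell n k)).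
Qed.

Lemma sintegral_left_approx u n f : Mspace T u ->
  sintegral T u (left_approx T n f) =
  \sum_(k < 2 ^ n) f (grid T n k) *
     fine (u [set t | (grid T n k < t <= grid T n k.+1)%E]).
Proof.
move=> Mu; rewrite left_approx_indic sintegral_sum; last first.
  by move=> k; apply: bm_indic; exact: measurable_grid_cell_left.
apply: eq_bigr => k _; rewrite sintegral_indic//.
exact: measurable_grid_cell_left.
Qed.

Lemma sintegral_right_cvg u f : cadlag T f -> bounded_measurable f /\
  sintegral T u (right_approx T n f) @[n --> \oo] --> sintegral T u f.
Proof.
move=> cf; have [M HM] := cadlag_bounded T0 cf.
apply: (@sintegral_dct _ _ _ M).
- by move=> n; exact: bm_cellfun.
- by move=> n t tT; exact: right_approx_le.
- by move=> t tT; exact: right_approx_cvg.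
Qed.

Lemma bm_cadlag f : cadlag T f -> bounded_measurable f.
Proof. by move=> cf; have [] := sintegral_right_cvg (czero : smeasure) cf. Qed.

Lemma left_approx0 n f : left_approx T n f 0%E = 0.
Proof.
rewrite /left_approx big1// => k _; rewrite ltNge.
by have /andP[-> _] := grid_times T0 n k; rewrite mulr0.
Qed.

Lemma sintegral_left_path_cvg u f : cadlag T f -> bounded_measurable (left_path f) /\
  sintegral T u (left_approx T n f) @[n --> \oo] --> sintegral T u (left_path f).
Proof.
move=> cf; have [M HM] := cadlag_bounded T0 cf.
apply: (@sintegral_dct _ _ _ M).
- by move=> n; exact: bm_left_approx.
- move=> n t tT; apply: left_approx_le => //.
  by rewrite (le_trans (normr_ge0 _) (HM _ (times0 T0))).
- move=> t /andP[t0 tT]; rewrite /left_path.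
  have [->|t1] := eqVneq t 0%E.
    by under eq_fun do rewrite left_approx0; exact: cvg_cst.
  by apply: left_approx_cvg => //; rewrite tT andbT lt_def t1.
Qed.

Lemma bm_left_path f : cadlag T f -> bounded_measurable (left_path f).
Proof. by move=> cf; have [] := sintegral_left_path_cvg (czero : smeasure) cf. Qed.

Lemma sintegral_left u f : cadlag T f -> Mtilde T u ->
  sintegral T u (left_lim f) = sintegral T u (left_path f).
Proof.
move=> cf [Mu u0 _]; have m1 : measurable [set (0%E : \bar R)] by exact: emeasurable_set1.
rewrite (@eq_sintegral _ _ (fun t => left_path f t + left_lim f 0%E * \1_[set 0%E] t)).
  rewrite sintegralD; [|exact: bm_left_path|by apply: bmZ; exact: bm_indic].
  by rewrite sintegralZ ?sintegral_indic ?u0 ?mulr0 ?addr0//; exact: bm_indic.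
move=> t _; rewrite /left_path indicE in_set1.
by have [->|_] := eqVneq t 0%E; rewrite ?mulr1 ?add0r// mulr0 addr0.
Qed.

Lemma left_path_le f t (M : R) : cadlag T f -> 0 <= M ->
  (forall s, times T s -> `|f s| <= M) -> times T t -> `|left_path f t| <= M.
Proof.
move=> cf M0 HM /andP[t0 tT]; rewrite /left_path.
have [_|t1] := eqVneq t 0%E; first by rewrite normr0.
by apply: left_lim_le HM _ => //; rewrite tT andbT lt_def t1.
Qed.

End SignedMeasure.

(** * Measures with a given distribution function *)

Section OrderSets.
Context {R : realType} d (X : measurableType d).

Lemma measurable_ltr_set (f g : X -> R) : measurable_fun setT f ->
  measurable_fun setT g -> measurable [set x | f x < g x].
Proof.
move=> mf mg; have := measurable_fun_ltr mf mg => /(_ measurableT [set true]).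
by rewrite setTI; apply.
Qed.

Lemma measurable_ler_set (f g : X -> R) : measurable_fun setT f ->
  measurable_fun setT g -> measurable [set x | f x <= g x].
Proof.
move=> mf mg; have := measurable_fun_ler mf mg => /(_ measurableT [set true]).
by rewrite setTI; apply.
Qed.

Lemma measurable_lte_set (f g : X -> \bar R) : measurable_fun setT f ->
  measurable_fun setT g -> measurable [set x | (f x < g x)%E].
Proof. by move=> mf mg; have := emeasurable_fun_lt measurableT mf mg; rewrite setTI. Qed.

Lemma measurable_lee_set (f g : X -> \bar R) : measurable_fun setT f ->
  measurable_fun setT g -> measurable [set x | (f x <= g x)%E].
Proof. by move=> mf mg; have := emeasurable_fun_le measurableT mf mg; rewrite setTI. Qed.

Lemma measurable_preimageT d' (Y : measurableType d') (f : X -> Y) (A : set Y) :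
  measurable_fun setT f -> measurable A -> measurable (f @^-1` A).
Proof. by move=> mf mA; rewrite -[X in measurable X]setTI; exact: mf. Qed.

End OrderSets.

Section Quantile.
Context {R : realType} (T : \bar R).
Hypothesis T0 : (0 < T)%E.
Implicit Types (t : \bar R) (x : R).

(** Generalised inverse of a function of which only the values on the grid are used. *)
Definition quantile (N : \bar R -> R) (x : R) : \bar R :=
  ereal_inf (T |` [set d | exists n k, d = grid T n k /\ x < N d]).

Lemma quantile_lt N x t : (quantile N x < t)%E <->
  (T < t)%E \/ exists n k, (grid T n k < t)%E /\ x < N (grid T n k).
Proof.
split.
- move=> /ereal_inf_lt[_ [->|[n [k [-> xN]]]] dt]; first by left.
  by right; exists n, k.
- move=> [Tt|[n [k [dt xN]]]]; apply: le_lt_trans (_ : _ <= _)%E _; try eassumption.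
    by apply: ereal_inf_lbound; left.
  by apply: ereal_inf_lbound; right; exists n, k.
Qed.

Lemma quantile_times N x : times T (quantile N x).
Proof.
apply/andP; split; last by apply: ereal_inf_lbound; left.
apply: le_ereal_inf_tmp => _ [->|[n [k [-> _]]]]; first exact: ltW.
by case/andP: (grid_times T0 n k).
Qed.

Lemma quantile_le N x y : x <= y -> (quantile N x <= quantile N y)%E.
Proof.
move=> xy; apply: ereal_inf_le_tmp => _ [->|[n [k [-> yN]]]]; first by left.
by right; exists n, k; split => //; exact: le_lt_trans yN.
Qed.

Lemma measurable_quantile d (X : measurableType d) (N : X -> \bar R -> R) (g : X -> R) :
  (forall n k, measurable_fun setT (fun w => N w (grid T n k))) ->
  measurable_fun setT g -> measurable_fun setT (fun w => quantile (N w) (g w)).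
Proof.
move=> mN mg; apply: (measurability _ (ErealGenInftyO.measurableE R)) => _ /= -[_ [r ->] <-].
rewrite setTI (_ : _ @^-1` _ = [set w | (T < r%:E)%E] `|`
    \bigcup_n \bigcup_k [set w | (grid T n k < r%:E)%E /\ g w < N w (grid T n k)]).
  apply: measurableU.
    have [Tr|Tr] := boolP (T < r%:E)%E.
      by rewrite (_ : [set _ | _] = setT)//; apply/seteqP; split.
    by rewrite (_ : [set _ | _] = set0)//; apply/seteqP; split.
  apply: bigcup_measurable => n _; apply: bigcup_measurable => k _.
  have [gr|gr] := boolP (grid T n k < r%:E)%E.
    rewrite (_ : [set _ | _] = [set w | g w < N w (grid T n k)]).
      exact: measurable_ltr_set.
    by apply/seteqP; split => w /= => [[]//|].
  by rewrite (_ : [set _ | _] = set0)//; apply/seteqP; split => // w [].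
apply/seteqP; split => w /=; rewrite in_itv/=.
  move=> /quantile_lt[|[n [k [? ?]]]]; first by left.
  by right; exists n => //; exists k.
move=> H; apply/quantile_lt; case: H => [|[n _ [k _ [? ?]]]]; first by left.
by right; exists n, k.
Qed.

Section Measure.
Variables (N : \bar R -> R) (M : R).

Let mq : measurable_fun setT (quantile N).
Proof.
by apply: (@measurable_quantile _ _ (fun=> N) id).
Qed.

(** The measure of total mass [M] with distribution function [N], as the image of Lebesgue
measure on [0, M[ under the quantile function.  It depends on countably many values of
[N], and so is measurable in a parameter on which these depend measurably. *)
Definition qmeasure (A : set (\bar R)) : \bar R :=
  lebesgue_measure ([set` `[0, M[] `&` quantile N @^-1` A).

Let mI : measurable ([set` `[0, M[] : set R).
Proof. exact: measurable_itv. Qed.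

Let mqA A : measurable A -> measurable ([set` `[0, M[] `&` quantile N @^-1` A).
Proof. by move=> mA; apply: measurableI => //; exact: measurable_preimageT. Qed.

Let qmeasure0 : qmeasure set0 = 0%E.
Proof. by rewrite /qmeasure preimage_set0 setI0 measure0. Qed.

Let qmeasure_ge0 A : (0 <= qmeasure A)%E.
Proof. exact: measure_ge0. Qed.

Let qmeasure_sigma_additive : semi_sigma_additive qmeasure.
Proof.
move=> F mF tF mUF; rewrite /qmeasure preimage_bigcup setI_bigcupr.
apply: measure_semi_sigma_additive.
- by move=> n; exact: mqA.
- apply/trivIsetP => i j _ _ ij; move/trivIsetP : tF => /(_ i j I I ij) H.
  apply/seteqP; split => // x [[_ Fi] [_ Fj]].
  by have : (F i `&` F j) (quantile N x) by []; rewrite H.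
- by rewrite -setI_bigcupr -preimage_bigcup; exact: mqA.
Qed.

HB.instance Definition _ := isMeasure.Build _ _ _ qmeasure
  qmeasure0 qmeasure_ge0 qmeasure_sigma_additive.

Let le_leb (A B : set R) : measurable A -> measurable B -> A `<=` B ->
  (lebesgue_measure A <= lebesgue_measure B)%E.
Proof. by move=> mA mB AB; apply: le_measure; rewrite ?inE. Qed.

Let qmeasure_fin : fin_num_fun qmeasure.
Proof.
move=> A mA; rewrite ge0_fin_numE//.
apply: (@le_lt_trans _ _ (lebesgue_measure ([set` `[0, M[] : set R))).
  by apply: le_leb => //; exact: mqA.
by rewrite lebesgue_measure_itv/=; case: ifPn => // _; rewrite -EFinB ltry.
Qed.

HB.instance Definition _ := @Measure_isFinite.Build _ _ _ qmeasure qmeasure_fin.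

Lemma qmeasureT : 0 <= M -> qmeasure setT = M%:E.
Proof.
move=> M0; rewrite /qmeasure preimage_setT setIT lebesgue_measure_itv/= lte_fin.
have [_|M0'] := ltP 0 M; first by rewrite oppr0 adde0.
by congr EFin; apply/eqP; rewrite eq_le M0.
Qed.

Lemma qmeasure_times A : A `&` times T = set0 -> qmeasure A = 0%E.
Proof.
move=> AT; rewrite /qmeasure (_ : _ `&` _ = set0) ?measure0//.
apply/seteqP; split => // x [_ /= Ax]; have : (A `&` times T) (quantile N x).
  by split => //; exact: quantile_times.
by rewrite AT.
Qed.

Let itvE (c : R) : 0 <= c -> lebesgue_measure ([set` `[0, c[] : set R) = c%:E.
Proof.
move=> c0; rewrite lebesgue_measure_itv/= lte_fin.
have [_|c0'] := ltP 0 c; first by rewrite oppr0 adde0.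
by congr EFin; apply/eqP; rewrite eq_le c0.
Qed.

Lemma qmeasure_lt_ge n k t : 0 <= N (grid T n k) <= M -> (grid T n k < t)%E ->
  ((N (grid T n k))%:E <= qmeasure [set s | (s < t)%E])%E.
Proof.
move=> /andP[N0 NM] gt; rewrite -itvE//; apply: le_leb; first exact: measurable_itv.
  apply: mqA; rewrite (_ : [set s | _] = [set` `]-oo, t[]); first exact: emeasurable_itv.
  by apply/seteqP; split => s /=; rewrite in_itv.
move=> x /=; rewrite !in_itv/= => /andP[-> xN]; rewrite (lt_le_trans xN NM).
by split => //; apply/quantile_lt; right; exists n, k.
Qed.

Lemma qmeasure_lt_le c t : 0 <= c -> (t <= T)%E ->
  (forall n k, (grid T n k < t)%E -> N (grid T n k) <= c) ->
  (qmeasure [set s | (s < t)%E] <= c%:E)%E.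
Proof.
move=> c0 tT H; rewrite -itvE//; apply: le_leb; last 2 first.
- exact: measurable_itv.
- move=> x [] /=; rewrite !in_itv/= => /andP[-> _].
  move=> /quantile_lt[|[n [k [gt xN]]]]; first by rewrite ltNge tT.
  exact: lt_le_trans xN (H _ _ gt).
apply: mqA; rewrite (_ : [set s | _] = [set` `]-oo, t[]); first exact: emeasurable_itv.
by apply/seteqP; split => s /=; rewrite in_itv.
Qed.

Lemma qmeasure_le_ge c t : 0 <= c <= M -> (0 <= t < T)%E ->
  (forall n k, (t < grid T n k)%E -> c <= N (grid T n k)) ->
  (c%:E <= qmeasure [set s | (s <= t)%E])%E.
Proof.
move=> /andP[c0 cM] /andP[t0 tT] H; rewrite -itvE//; apply: le_leb.
- exact: measurable_itv.
- apply: mqA; rewrite (_ : [set s | _] = [set` `]-oo, t]]); first exact: emeasurable_itv.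
  by apply/seteqP; split => s /=; rewrite in_itv.
- move=> x /=; rewrite !in_itv/= => /andP[-> xc]; rewrite (lt_le_trans xc cM).
  split => //=; rewrite leNgt; apply/negP => tq.
  have /andP[_ qT] := quantile_times N x.
  have [n [k /andP[tg gq]]] := grid_dense T0 t0 tq qT.
  suff : (quantile N x < quantile N x)%E by rewrite ltxx.
  by apply/quantile_lt; right; exists n, k; split=> //; exact: lt_le_trans xc (H _ _ tg).
Qed.

(** A set of positive Lebesgue measure contains two points, hence surrounds a rational. *)
Lemma qmeasure_atom t : (0 < qmeasure [set t])%E ->
  exists r : rat, quantile N (ratr r) = t.
Proof.
move=> qt; pose E := [set` `[0, M[] `&` quantile N @^-1` [set t].
have [x [Ex]] : exists x, E x /\ exists y, E y /\ x < y.
  apply: contrapT => H; move: qt; rewrite /qmeasure -/E.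
  suff : exists z, E `<=` [set z].
    move=> [z Ez]; apply/negP; rewrite -leNgt -(lebesgue_measure_set1 z).
    by apply: le_leb => //; exact: mqA.
  have [[z Ez]|nE] := pselect (exists z, E z); last first.
    by exists 0 => z Ez; exfalso; apply: nE; exists z.
  exists z => y Ey /=; apply: contrapT => yz.
  have [yz'|zy|//] := ltgtP y z.
    by apply: H; exists y; split => //; exists z.
  by apply: H; exists z; split => //; exists y.
move=> [y [Ey xy]]; have [r] := rat_in_itvoo xy; rewrite in_itv/= => /andP[xr ry].
exists r; apply/eqP; rewrite eq_le; have [_ /= Ex2] := Ex; have [_ /= Ey2] := Ey.
apply/andP; split.
  by rewrite -Ey2 quantile_le// ltW.
by rewrite -Ex2 quantile_le// ltW.
Qed.

End Measure.

Lemma qmeasure_lt_cvg (N : \bar R -> R) (M : R) t :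
  (forall n k m l, (grid T n k <= grid T m l)%E -> N (grid T n k) <= N (grid T m l)) ->
  (forall n k, 0 <= N (grid T n k) <= M) -> (0 < t <= T)%E ->
  N (lgrid T n t) @[n --> \oo] --> fine (qmeasure N M [set s | (s < t)%E]).
Proof.
move=> Nnd NM /[dup] tT /andP[t0 t1].
have mt : measurable [set s | (s < t)%E].
  rewrite (_ : [set s | _] = [set` `]-oo, t[]); first exact: emeasurable_itv.
  by apply/seteqP; split => s /=; rewrite in_itv.
set q := qmeasure N M _; have qE : q = (fine q)%:E.
  by rewrite fineK// /q; apply: fin_num_measure.
have lub n k : (grid T n k < t)%E -> N (grid T n k) <= fine q.
  by move=> gt; rewrite -lee_fin -qE qmeasure_lt_ge.
have lgP n : exists2 k, (grid T n k < t)%E & lgrid T n t = grid T n k.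
  have [k kn kt] := grid_cell_leftP T0 n tT; exists k; first by case/andP: kt.
  exact: lgridE.
apply/cvgrPdist_lt => e e0.
have [n0 [k0 [gt gN]]] : exists n k, (grid T n k < t)%E /\ fine q - e < N (grid T n k).
  apply: contrapT => H.
  have H' n k : (grid T n k < t)%E -> N (grid T n k) <= fine q - e.
    by move=> gt; rewrite leNgt; apply/negP => gN; apply: H; exists n, k.
  have qe : 0 <= fine q - e.
    have := H' 0%N 0%N; rewrite grid0// => /(_ t0); apply: le_trans.
    by rewrite -(grid0 T0 0); case/andP: (NM 0%N 0%N).
  have := qmeasure_lt_le M qe t1 H'.
  by rewrite -/q qE lee_fin lerBrDr gerDl leNgt e0.
have := lgrid_near T0 gt tT; apply: filterS => n gl.
have [k kt kE] := lgP n; rewrite kE in gl *.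
have N1 := lub n k kt; have N2 := Nnd n0 k0 n k (ltW gl).
by rewrite ger0_norm ?subr_ge0//; lra.
Qed.

(** The measure is the length of a section of a measurable set of the product space. *)
Lemma measurable_qmeasure d (X : measurableType d) (N : X -> \bar R -> R) (M : X -> R) A :
  (forall n k, measurable_fun setT (fun w => N w (grid T n k))) ->
  measurable_fun setT M -> measurable A ->
  measurable_fun setT (fun w => qmeasure (N w) (M w) A).
Proof.
move=> mN mM mA.
pose B := [set z : X * R | (0 <= z.2 < M z.1) /\ A (quantile (N z.1) z.2)].
rewrite (_ : (fun w => _) = lebesgue_measure \o xsection B).
  apply: measurable_fun_xsection.
  have m1 : measurable_fun setT (fun z : X * R => quantile (N z.1) z.2).
    apply: (@measurable_quantile _ _ (fun z : X * R => N z.1) snd) => //.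
    by move=> n k; exact: (measurableT_comp (mN n k)).
  rewrite (_ : B = ([set z | 0 <= z.2] `&` [set z | z.2 < M z.1]) `&`
     (fun z : X * R => quantile (N z.1) z.2) @^-1` A).
    apply: measurableI; last by exact: measurable_preimageT.
    apply: measurableI.
      by apply: measurable_ler_set => //; exact: measurable_cst.
    apply: measurable_ltr_set => //; exact: (measurableT_comp mM).
  apply/seteqP; split => z /=; rewrite /B /=.
    by move=> [/andP[? ?] ?].
  by move=> [[-> ->] ?].
apply/funext => w; rewrite /qmeasure /=; congr lebesgue_measure.
by apply/seteqP; split => x /=; rewrite /xsection /= in_itv/= ?in_setE.
Qed.

End Quantile.

(** * Jordan decomposition along the grid *)

Section TotalVariation.
Context {R : realType} (T : \bar R).
Hypothesis T0 : (0 < T)%E.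
Implicit Types (u : smeasure (R := R)) (t : \bar R) (n k : nat).

Local Notation c u n k := (fine (u (cell T n k))).

Lemma cell_split n k : (k < 2 ^ n)%N ->
  cell T n k = cell T n.+1 (2 * k) `|` cell T n.+1 (2 * k).+1.
Proof.
move=> kn; have k2 : (2 * k).+2 = (2 * k.+1)%N by rewrite mulnS addnC addn2.
have g1 : (grid T n k <= grid T n.+1 (2 * k).+1)%E.
  by rewrite -(gridS T0) le_grid.
have g2 : (grid T n.+1 (2 * k).+1 <= grid T n k.+1)%E.
  by rewrite -(gridS T0 n k.+1) -k2 le_grid.
apply/seteqP; split => t; rewrite /cell /= k2 !(gridS T0).
  move=> /andP[kt tk]; have [tk'|tk'] := ltP t (grid T n.+1 (2 * k).+1).
    by left; rewrite kt.
  by right.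
move=> [/andP[kt tk]|/andP[kt tk]]; apply/andP; split => //.
- exact: lt_le_trans tk g2.
- exact: le_trans g1 kt.
Qed.

Lemma cell_splitE u n k : (k < 2 ^ n)%N ->
  c u n k = c u n.+1 (2 * k) + c u n.+1 (2 * k).+1.
Proof.
move=> kn; rewrite cell_split// chargeU; try exact: measurable_cell.
  by rewrite fineD//; apply: fin_num_measure; exact: measurable_cell.
apply/seteqP; split => // t [/andP[_ t1] /andP[t2 _]].
by have := lt_le_trans t1 t2; rewrite ltxx.
Qed.

Definition cell_sum (s : R -> R) u n t : R :=
  \sum_(k < 2 ^ n) (grid T n k.+1 <= t)%E%:R * s (c u n k).

Lemma big_ord_double (F : nat -> R) m :
  \sum_(k < 2 * m) F k = \sum_(k < m) (F (2 * k)%N + F (2 * k).+1).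
Proof.
elim: m => [|m IH]; first by rewrite muln0 !big_ord0.
by rewrite mulnS addnC addn2 !big_ord_recr/= IH addrA.
Qed.

Lemma cell_sum_nd (s : R -> R) u t : (forall x, 0 <= s x) ->
  (forall x y, s (x + y) <= s x + s y) -> nondecreasing_seq (cell_sum s u ^~ t).
Proof.
move=> s0 sD; apply/nondecreasing_seqP => n; rewrite /cell_sum expnS.
rewrite (big_ord_double (fun k => (grid T n.+1 k.+1 <= t)%E%:R * s (c u n.+1 k))).
apply: ler_sum => k _; have k2 : (2 * k).+2 = (2 * k.+1)%N by rewrite mulnS addnC addn2.
have kn : (k < 2 ^ n)%N by [].
have g2 : (grid T n.+1 (2 * k).+1 <= grid T n k.+1)%E.
  by rewrite -(gridS T0 n k.+1) -k2 le_grid.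
rewrite k2 (gridS T0); have [kt|_] := leP (grid T n k.+1) t; last first.
  by rewrite !mul0r addr0 mulr_ge0.
by rewrite (le_trans g2 kt) !mul1r cell_splitE.
Qed.

Lemma cell_sum_ge0 (s : R -> R) u n t : (forall x, 0 <= s x) -> 0 <= cell_sum s u n t.
Proof. by move=> s0; apply: sumr_ge0 => k _; rewrite mulr_ge0. Qed.

Lemma cell_sum_homo (s : R -> R) u n t t' : (forall x, 0 <= s x) ->
  (t <= t')%E -> cell_sum s u n t <= cell_sum s u n t'.
Proof.
move=> s0 tt'; apply: ler_sum => k _; apply: ler_wpM2r => //.
by have [kt|_] := leP (grid T n k.+1) t; [rewrite (le_trans kt tt')|].
Qed.

Definition posp (x : R) := Num.max x 0.
Definition negp (x : R) := Num.max (- x) 0.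

Lemma posp_ge0 x : 0 <= posp x. Proof. by rewrite le_max lexx orbT. Qed.
Lemma negp_ge0 x : 0 <= negp x. Proof. by rewrite le_max lexx orbT. Qed.
Lemma pospB x : posp x - negp x = x.
Proof. by rewrite /posp /negp; case: (leP x 0); case: (leP (- x) 0); lra. Qed.
Lemma pospD x : posp x + negp x = `|x|.
Proof.
rewrite /posp /negp; have [x0|x0] := leP x 0.
  by rewrite ler0_norm// add0r; apply/max_idPl; lra.
by rewrite gtr0_norm// (_ : Num.max (- x) 0 = 0) ?addr0//; apply/max_idPr; lra.
Qed.
Lemma posp_sub x y : posp (x + y) <= posp x + posp y.
Proof.
rewrite /posp ge_max addr_ge0 ?posp_ge0 ?andbT//.
by rewrite lerD// le_max lexx.
Qed.
Lemma negp_sub x y : negp (x + y) <= negp x + negp y.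
Proof. by rewrite /negp opprD; exact: posp_sub. Qed.

(** The positive and the negative variation before t, as suprema over refinements of the
grid.  Hahn decompositions are chosen separately for each measure; these functions
are measurable in it. *)
Definition npos u t := sup (range (cell_sum posp u ^~ t)).
Definition nneg u t := sup (range (cell_sum negp u ^~ t)).

Definition tvar u n : R := \sum_(k < 2 ^ n) `|c u n k| + `|fine (u [set T])|.

(** Integrate the step function of the signs of the masses of the cells. *)
Lemma tvar_le u n : Mspace T u -> tvar u n <= tv_norm u.
Proof.
move=> Mu.
pose f := cellfun T n (fun k => Num.sg (c u n k)) (Num.sg (fine (u [set T]))).
have sg1 (x : R) : `|Num.sg x| <= 1 by rewrite normr_sg; case: (x != 0).
have H : `|sintegral T u f| <= 1 * tv_norm u.
  apply: sintegral_le => //; first exact: bm_cellfun.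
  by move=> t tT; apply: cellfun_le.
move: H; rewrite mul1r => /(le_trans (ler_norm _)); apply: le_trans.
rewrite /f sintegral_cellfun// /tvar -normrEsg.
by rewrite lerD2r ler_sum// => k _; rewrite -normrEsg.
Qed.

Lemma cell_sum_tvar u n t : Mspace T u ->
  cell_sum posp u n t + cell_sum negp u n t <= tvar u n.
Proof.
move=> Mu; rewrite -big_split/= /tvar.
rewrite -[leLHS]addr0 lerD// ler_sum// => k _; rewrite -mulrDr pospD.
by case: (_ <= _)%E; rewrite ?mul1r// mul0r.
Qed.

Lemma npos_ub u t : Mspace T u -> has_ubound (range (cell_sum posp u ^~ t)).
Proof.
move=> Mu; exists (tv_norm u) => _ [n _ <-]; apply: le_trans (tvar_le n Mu).
apply: le_trans (cell_sum_tvar n t Mu); rewrite lerDl.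
exact: cell_sum_ge0 negp_ge0.
Qed.

Lemma nneg_ub u t : Mspace T u -> has_ubound (range (cell_sum negp u ^~ t)).
Proof.
move=> Mu; exists (tv_norm u) => _ [n _ <-]; apply: le_trans (tvar_le n Mu).
apply: le_trans (cell_sum_tvar n t Mu); rewrite lerDr.
exact: cell_sum_ge0 posp_ge0.
Qed.

Lemma npos_cvg u t : Mspace T u -> cell_sum posp u n t @[n --> \oo] --> npos u t.
Proof.
move=> Mu; apply: nondecreasing_cvgn; last exact: npos_ub.
exact: cell_sum_nd posp_ge0 posp_sub.
Qed.

Lemma nneg_cvg u t : Mspace T u -> cell_sum negp u n t @[n --> \oo] --> nneg u t.
Proof.
move=> Mu; apply: nondecreasing_cvgn; last exact: nneg_ub.
exact: cell_sum_nd negp_ge0 negp_sub.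
Qed.

Lemma npos_homo u t t' : Mspace T u -> (t <= t')%E -> npos u t <= npos u t'.
Proof.
move=> Mu tt'; apply: (cvg_seq_le (@npos_cvg u t Mu)) => n.
apply: (le_trans (cell_sum_homo u n posp_ge0 tt')).
by apply: ub_le_sup; [exact: npos_ub|exists n].
Qed.

Lemma nneg_homo u t t' : Mspace T u -> (t <= t')%E -> nneg u t <= nneg u t'.
Proof.
move=> Mu tt'; apply: (cvg_seq_le (@nneg_cvg u t Mu)) => n.
apply: (le_trans (cell_sum_homo u n negp_ge0 tt')).
by apply: ub_le_sup; [exact: nneg_ub|exists n].
Qed.

Lemma npos_ge0 u t : Mspace T u -> 0 <= npos u t.
Proof.
move=> Mu; apply: (@le_trans _ _ (cell_sum posp u 0 t)); first exact: cell_sum_ge0 posp_ge0.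
by apply: ub_le_sup; [exact: npos_ub|exists 0%N].
Qed.

Lemma nneg_ge0 u t : Mspace T u -> 0 <= nneg u t.
Proof.
move=> Mu; apply: (@le_trans _ _ (cell_sum negp u 0 t)); first exact: cell_sum_ge0 negp_ge0.
by apply: ub_le_sup; [exact: nneg_ub|exists 0%N].
Qed.

Lemma measurable_ray t : measurable [set s : \bar R | (s < t)%E].
Proof.
rewrite (_ : [set s | _] = [set` `]-oo, t[]); first exact: emeasurable_itv.
by apply/seteqP; split => s /=; rewrite in_itv.
Qed.

Lemma cell_sum_sub u n m l : Mspace T u -> (m <= n)%N ->
  cell_sum posp u n (grid T m l) - cell_sum negp u n (grid T m l) =
  fine (u [set s | (s < grid T m l)%E]).
Proof.
move=> Mu mn; have {l} [l ->] : exists j, grid T m l = grid T n j.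
  by exists (2 ^ (n - m) * l)%N; exact: grid_refine.
rewrite -(sintegral_indic Mu (measurable_ray _)).
rewrite -sumrB.
transitivity (sintegral T u
    (cellfun T n (fun k => (grid T n k.+1 <= grid T n l)%E%:R) 0)).
  rewrite sintegral_cellfun// mul0r addr0; apply: eq_bigr => k _.
  by rewrite -mulrBr pospB.
apply: eq_sintegral => t /(times_cellP T0 n)[->|[k kn kt]].
  rewrite cellfunT// indicE mem_setb ltNge.
  by have /andP[_ ->] := grid_times T0 n l.
rewrite (cellfunE T0 _ _ kn kt) indicE mem_setb; congr (_%:R); congr nat_of_bool.
move: kt => /andP[kt tk]; apply/idP/idP => [|tl]; first exact: lt_le_trans.
apply: le_grid => //; rewrite ltnNge; apply/negP => lk.
by have := lt_le_trans tl (le_trans (le_grid T0 n lk) kt); rewrite ltxx.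
Qed.

Lemma npos_sub u m l : Mspace T u ->
  npos u (grid T m l) - nneg u (grid T m l) = fine (u [set s | (s < grid T m l)%E]).
Proof.
move=> Mu; apply: (@cvg_seq_uniq _ (fun n => cell_sum posp u n (grid T m l) -
  cell_sum negp u n (grid T m l))).
  by apply: cvgB; [exact: npos_cvg|exact: nneg_cvg].
by apply: cvg_near_cst; exists m => // n /= mn; rewrite cell_sum_sub.
Qed.

Definition mpos u := npos u T + posp (fine (u [set T])).
Definition mneg u := nneg u T + negp (fine (u [set T])).

Lemma fine_measure_ext u A B : Mspace T u -> measurable A -> measurable B ->
  A `&` times T = B `&` times T -> u A = u B.
Proof.
move=> Mu mA mB AB; rewrite -[LHS]fineK ?fin_num_measure//.
rewrite -[RHS]fineK ?fin_num_measure// -!(sintegral_indic Mu)//; congr EFin.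
apply: eq_sintegral => t tT; rewrite !indicE; congr (_%:R); congr nat_of_bool.
apply/idP/idP => /set_mem H; apply/mem_set.
  by have [] : (B `&` times T) t by rewrite -AB.
by have [] : (A `&` times T) t by rewrite AB.
Qed.

Lemma qmeasure_ext (N : \bar R -> R) M A B : measurable A -> measurable B ->
  A `&` times T = B `&` times T -> qmeasure T N M A = qmeasure T N M B.
Proof.
move=> mA mB AB; rewrite /qmeasure; congr lebesgue_measure; apply/seteqP.
split => x [xM /= xA]; split => //=.
  have : (B `&` times T) (quantile T N x) by rewrite -AB; split => //; exact: quantile_times.
  by case.
have : (A `&` times T) (quantile T N x) by rewrite AB; split => //; exact: quantile_times.
by case.
Qed.

Lemma mposB u : Mspace T u -> (u setT = (mpos u)%:E - (mneg u)%:E)%E.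
Proof.
move=> Mu; rewrite -EFinB /mpos /mneg.
rewrite (_ : _ - _ = fine (u [set s | (s < T)%E]) + fine (u [set T])).
  have mr := measurable_ray T; have m1 := emeasurable_set1 T.
  rewrite -fineD ?fin_num_measure// -chargeU//; last first.
    by apply/seteqP; split => // s [/= sT sT']; rewrite sT' ltxx in sT.
  rewrite fineK ?fin_num_measure//; last exact: measurableU.
  apply: fine_measure_ext => //; first exact: measurableU.
  apply/seteqP; split => s [] //= _ sT; split => //.
  by case/andP: sT => _; rewrite le_eqVlt => /predU1P[->|]; [right|left].
have := npos_sub 0 1 Mu; rewrite grid_last// => <-.
by have := pospB (fine (u [set T])); lra.
Qed.

Let G : set (set (\bar R)) := [set A | A = setT \/ exists r : R, A = [set` `]-oo, r%:E[]].

Let mG : @measurable _ (\bar R) = <<s G >>.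
Proof.
apply/seteqP; split.
  rewrite {1}/measurable /= ErealGenInftyO.measurableE.
  apply: sub_sigma_algebra2 => A [r ->]; by right; exists r.
apply: smallest_sub; first exact: sigma_algebra_measurable.
by move=> A [->|[r ->]]; [exact: measurableT|exact: emeasurable_itv].
Qed.

Let GI : setI_closed G.
Proof.
move=> A B [->|[r ->]] [->|[s ->]]; rewrite ?setTI ?setIT; [by left|by right; exists s|by right; exists r|].
right; exists (Num.min r s); apply/seteqP; split => x /=; rewrite !in_itv/=.
  by move=> [xr xs]; rewrite EFin_min lt_min xr.
by rewrite EFin_min lt_min => /andP[].
Qed.

(** The sums along the grid converge to the variations from the left, which gives the
equality on half-lines; these generate the Borel sets and are stable under
intersection. *)
Lemma jordan_qmeasure u A : Mspace T u -> measurable A ->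
  u A = (qmeasure T (npos u) (mpos u) A - qmeasure T (nneg u) (mneg u) A)%E.
Proof.
move=> Mu mA.
pose al : {finite_measure set (\bar R) -> \bar R} := qmeasure T (npos u) (mpos u).
pose be : {finite_measure set (\bar R) -> \bar R} := qmeasure T (nneg u) (mneg u).
have P0 : 0 <= mpos u by rewrite addr_ge0 ?npos_ge0 ?posp_ge0.
have N0 : 0 <= mneg u by rewrite addr_ge0 ?nneg_ge0 ?negp_ge0.
have nP n k : 0 <= npos u (grid T n k) <= mpos u.
  rewrite npos_ge0//= (@le_trans _ _ (npos u T))//.
    by apply: npos_homo => //; case/andP: (grid_times T0 n k).
  by rewrite lerDl posp_ge0.
have nN n k : 0 <= nneg u (grid T n k) <= mneg u.
  rewrite nneg_ge0//= (@le_trans _ _ (nneg u T))//.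
    by apply: nneg_homo => //; case/andP: (grid_times T0 n k).
  by rewrite lerDl negp_ge0.
have HT : u setT = (al setT - be setT)%E.
  by rewrite mposB// /al /be /= !qmeasureT.
have H0 t : (0 < t <= T)%E ->
    u [set s | (s < t)%E] = (al [set s | (s < t)%E] - be [set s | (s < t)%E])%E.
  move=> tT; have mr := measurable_ray.
  have al1 : al [set s | (s < t)%E] \is a fin_num by rewrite fin_num_measure.
  have be1 : be [set s | (s < t)%E] \is a fin_num by rewrite fin_num_measure.
  rewrite -(fineK (charge_fin_num u (mr t))) -(fineK al1) -(fineK be1) -EFinB.
  congr EFin.
  have Cp : npos u (lgrid T n t) @[n --> \oo] --> fine (al [set s | (s < t)%E]).
    by apply: qmeasure_lt_cvg => // n k m l; exact: npos_homo.
  have Cn : nneg u (lgrid T n t) @[n --> \oo] --> fine (be [set s | (s < t)%E]).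
    by apply: qmeasure_lt_cvg => // n k m l; exact: nneg_homo.
  have Cd : npos u (lgrid T n t) - nneg u (lgrid T n t) @[n --> \oo] -->
      fine (al [set s | (s < t)%E]) - fine (be [set s | (s < t)%E]) by exact: (cvgB Cp Cn).
  apply: (fun C => cvg_seq_uniq C Cd).
  rewrite (_ : (fun _ => _) = fun n => sintegral T u \1_[set s | (s < lgrid T n t)%E]).
    rewrite -(sintegral_indic Mu)//.
    apply: (@sintegral_dct _ _ T0 u _ _ 1 _ _ _).2.
    - by move=> n; exact: bm_indic.
    - by move=> n s _; rewrite indicE; case: (_ \in _); rewrite ?normr1 ?normr0.
    - move=> s _; rewrite indicE mem_setb; have [st|ts] := ltP s t.
        apply: cvg_near_cst.
        have := lgrid_near T0 st tT; apply: filterS => n sl.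
        by rewrite indicE mem_setb sl.
      rewrite (_ : (fun _ => _) = fun=> 0); first exact: cvg_cst.
      apply/funext => n; rewrite indicE mem_setb ltNge (le_trans _ ts)//.
      by rewrite ltW//; case/andP: (lgrid_lt T0 n tT).
  apply/funext => n; have [k kn kt] := grid_cell_leftP T0 n tT.
  by rewrite (lgridE T0 kn kt) (sintegral_indic Mu)// -npos_sub.
have HG B : G B -> u B = (al B - be B)%E.
  move=> [->//|[r ->]].
  rewrite (_ : [set` _] = [set s | (s < r%:E)%E]); last first.
    by apply/seteqP; split => s /=; rewrite in_itv.
  have mr := measurable_ray r%:E.
  have [r0|r0] := leP r%:E 0%E.
    have E : [set s | (s < r%:E)%E] `&` times T = set0 `&` times T.
      rewrite set0I; apply/seteqP; split => // s [/= sr /andP[s0 _]].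
      by have := lt_le_trans sr (le_trans r0 s0); rewrite ltxx.
    rewrite (fine_measure_ext Mu mr measurable0 E) /al /be /=.
    by rewrite !(qmeasure_ext _ _ mr measurable0 E) charge0 !measure0 sube0.
  have [rT|Tr] := leP r%:E T; first by apply: H0; rewrite r0.
  have E : [set s | (s < r%:E)%E] `&` times T = setT `&` times T.
    rewrite setTI; apply/seteqP; split => [s []//|s /[dup] sT /andP[_ sT']].
    by split => //=; exact: le_lt_trans Tr.
  rewrite (fine_measure_ext Mu mr measurableT E) HT /al /be /=.
  by rewrite !(qmeasure_ext _ _ mr measurableT E).
have mB B : G B -> measurable B by rewrite mG; exact: sub_sigma_algebra.
have bc : \bigcup_(k in [set: nat]) [set: \bar R] = setT by rewrite bigcup_const//; exists 0%N.
pose m1 : {finite_measure set (\bar R) -> \bar R} := madd (jordan_pos (hahnP u)) be.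
pose m2 : {finite_measure set (\bar R) -> \bar R} := madd (jordan_neg (hahnP u)) al.
have m12 B : G B -> m1 B = m2 B.
  move=> GB; have mB' := mB B GB; rewrite /m1 /m2 /= !maddE.
  apply: fin_swap; rewrite ?fin_num_measure//.
  by rewrite -jordanE ?HG.
have m1oo (k : nat) : (m1 setT < +oo)%E by rewrite ltey_eq fin_num_measure.
have E := @measure_unique _ _ (\bar R) G (fun=> setT) mG GI
  (fun=> or_introl erefl) bc m1 m2 m12 m1oo A mA.
rewrite jordanE//; move: E; rewrite /m1 /m2 /= !maddE.
by apply: fin_swap'; exact: fin_num_measure.
Qed.

(** One inequality is the minimality of the Jordan decomposition ([tv_le]), the other one
follows from [tvar_le]. *)
Lemma tv_mpos u : Mspace T u -> tv_norm u = mpos u + mneg u.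
Proof.
move=> Mu; apply/eqP; rewrite eq_le; apply/andP; split.
  have P0 : 0 <= mpos u by rewrite addr_ge0 ?npos_ge0 ?posp_ge0.
  have N0 : 0 <= mneg u by rewrite addr_ge0 ?nneg_ge0 ?negp_ge0.
  have := @tv_le _ u (qmeasure T (npos u) (mpos u)) (qmeasure T (nneg u) (mneg u)).
  rewrite /= !qmeasureT// -EFinD lee_fin; apply => A mA.
  exact: jordan_qmeasure.
rewrite /mpos /mneg addrACA pospD -lerBrDr.
apply: (@cvg_seq_le _ (fun n => cell_sum posp u n T + cell_sum negp u n T)).
  by apply: cvgD; [exact: npos_cvg|exact: nneg_cvg].
move=> n.
rewrite lerBrDr; apply: le_trans (tvar_le n Mu); rewrite lerD2r -big_split/=.
by apply: ler_sum => k _; rewrite -mulrDr pospD; case: (_ <= _)%E; rewrite ?mul1r// mul0r.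
Qed.

Lemma tvar_cvg u : Mspace T u -> tvar u n @[n --> \oo] --> tv_norm u.
Proof.
move=> Mu; rewrite tv_mpos// /mpos /mneg addrACA pospD.
apply: cvgD; last exact: cvg_cst.
rewrite (_ : (fun _ => _) = fun n => cell_sum posp u n T + cell_sum negp u n T).
  by apply: cvgD; [exact: npos_cvg|exact: nneg_cvg].
apply/funext => n; rewrite -big_split/=; apply: eq_bigr => k _.
by rewrite -mulrDr pospD; have /andP[_ ->] := grid_times T0 n k.+1; rewrite mul1r.
Qed.

End TotalVariation.

(** * Measurability of integrals of random paths *)

Section RandomPaths.
Context {R : realType} {d : measure_display} {Omega : measurableType d}.
Variable T : \bar R.
Hypothesis T0 : (0 < T)%E.
Implicit Types (y z : Omega -> \bar R -> R) (s : Omega -> \bar R)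
  (u : Omega -> smeasure (R := R)) (xi : Omega -> R) (v : @rmpair R d Omega).

Lemma measurable_OT : measurable ([set: Omega] `*` times T).
Proof. by apply: measurableX => //; exact: measurable_times. Qed.

Lemma process_eval y s : cadlag_process T y -> measurable_fun setT s ->
  (forall w, times T (s w)) -> measurable_fun setT (fun w => y w (s w)).
Proof.
move=> [_ my] ms sT.
have mp : measurable_fun setT (fun w => (w, s w)) by exact: measurable_fun_pair.
have sub : (fun w => (w, s w)) @` setT `<=` [set: Omega] `*` times T.
  by move=> _ [w _ <-]; split => //=.
exact: (measurable_comp measurable_OT sub my mp).
Qed.

Lemma process_at y t : cadlag_process T y -> times T t ->
  measurable_fun setT (fun w => y w t).
Proof. by move=> cy tT; apply: process_eval => //; exact: measurable_cst. Qed.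

Lemma cadlag_processD y z : cadlag_process T y -> cadlag_process T z ->
  cadlag_process T (fun w t => y w t + z w t).
Proof.
move=> [cy my] [cz mz]; split; first by move=> w; exact: cadlagD.
exact: measurable_funD.
Qed.

Lemma cadlag_processM y z : cadlag_process T y -> cadlag_process T z ->
  cadlag_process T (fun w t => y w t * z w t).
Proof.
move=> [cy my] [cz mz]; split; first by move=> w; exact: cadlagM.
exact: measurable_funM.
Qed.

Lemma cadlag_process_rv xi : measurable_fun setT xi ->
  cadlag_process T (fun w _ => xi w).
Proof.
move=> mxi; split; first by move=> w; exact: cadlag_cst.
by apply: measurable_funTS; exact: (measurableT_comp mxi).
Qed.

Lemma cadlag_processZ xi y : measurable_fun setT xi -> cadlag_process T y ->
  cadlag_process T (fun w t => xi w * y w t).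
Proof. by move=> mxi; apply: cadlag_processM; exact: cadlag_process_rv. Qed.

Lemma cadlag_process_norm y : cadlag_process T y ->
  cadlag_process T (fun w t => `|y w t|).
Proof.
move=> [cy my]; split; first by move=> w; exact: cadlag_norm.
exact: measurableT_comp.
Qed.

Lemma cadlag_process_min y z : cadlag_process T y -> cadlag_process T z ->
  cadlag_process T (fun w t => Num.min (y w t) (z w t)).
Proof.
move=> cy cz.
have -> : (fun w t => Num.min (y w t) (z w t)) = fun w t =>
    2^-1 * ((y w t + z w t) + (-1) * `|y w t + (-1) * z w t|).
  apply/funext => w; apply/funext => t; rewrite !mulN1r.
  have [yz|yz] := leP (y w t) (z w t).
    by rewrite ler0_norm ?subr_le0//; field.
  by rewrite gtr0_norm ?subr_gt0//; field.
have C c : measurable_fun [set: Omega] (fun=> c : R) by exact: measurable_cst.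
apply: (cadlag_processZ (C _)); apply: cadlag_processD; first exact: cadlag_processD.
apply: (cadlag_processZ (C _)); apply: cadlag_process_norm.
by apply: cadlag_processD => //; exact: (cadlag_processZ (C _)).
Qed.

Lemma cadlag_process_step s : measurable_fun setT s ->
  cadlag_process T (fun w => step (s w)).
Proof.
move=> ms; split; first by move=> w; exact: cadlag_step.
apply: measurable_funTS; rewrite /step.
rewrite (_ : (fun _ => _) = \1_[set z : Omega * \bar R | (s z.1 <= z.2)%E]).
  apply: measurable_indic; apply: measurable_lee_set => //.
  exact: (measurableT_comp ms).
by apply/funext => z; rewrite indicE mem_setb.
Qed.

Lemma measurable_proc_norm y : cadlag_process T y ->
  measurable_fun setT (proc_norm T y).
Proof.
move=> cy; have [cy' _] := cy.
apply: (measurability _ (RGenOInfty.measurableE R)) => _ /= -[_ [r ->] <-].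
rewrite setTI (_ : _ @^-1` _ =
    \bigcup_n \bigcup_k [set w | r < `|y w (grid T n k)|]).
  apply: bigcup_measurable => n _; apply: bigcup_measurable => k _.
  apply: measurable_ltr_set; first exact: measurable_cst.
  apply: measurableT_comp => //; apply: process_at => //; exact: grid_times.
apply/seteqP; split => w /=; rewrite in_itv/= andbT.
  move=> rn; apply: contrapT => H; move: rn; rewrite ltNge => /negP; apply.
  apply: path_norm_grid => // n k; rewrite leNgt; apply/negP => rk.
  by apply: H; exists n => //; exists k.
move=> [n _ [k _ /= rk]]; apply: lt_le_trans rk _.
by apply: le_path_norm => //; exact: grid_times.
Qed.

Lemma random_measure_fine u A : random_measure u -> measurable A ->
  measurable_fun setT (fun w => fine (u w A)).
Proof. by move=> mu mA; apply: measurableT_comp => //; exact: mu. Qed.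

Lemma measurable_sum (I : Type) (r : seq I) (F : I -> Omega -> R) :
  (forall i, measurable_fun setT (F i)) ->
  measurable_fun setT (fun w => \sum_(i <- r) F i w).
Proof. by move=> mF; exact: measurable_sum. Qed.

(** The integral is a limit of finite sums of products of values of the path and masses of
cells ([sintegral_right_cvg]). *)
Lemma measurable_sintegral y u : cadlag_process T y -> random_measure u ->
  (forall w, Mspace T (u w)) ->
  measurable_fun setT (fun w => sintegral T (u w) (y w)).
Proof.
move=> cy mu Mu; have [cy' _] := cy.
apply: (@measurable_fun_cvg _ _ _ _
  (fun n w => sintegral T (u w) (right_approx T n (y w)))); last first.
  by move=> w _; have [] := sintegral_right_cvg T0 (u w) (cy' w).
move=> n; under eq_fun do rewrite sintegral_cellfun//.
apply: measurable_funD.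
  apply: measurable_sum => k; apply: measurable_funM.
    by apply: process_at => //; exact: grid_times.
  by apply: random_measure_fine => //; exact: measurable_cell.
apply: measurable_funM.
  by apply: process_at => //; exact: timesT.
by apply: random_measure_fine => //; exact: emeasurable_set1.
Qed.

Lemma measurable_sintegral_left_path y u : cadlag_process T y -> random_measure u ->
  (forall w, Mspace T (u w)) ->
  measurable_fun setT (fun w => sintegral T (u w) (left_path (y w))).
Proof.
move=> cy mu Mu; have [cy' _] := cy.
apply: (@measurable_fun_cvg _ _ _ _
  (fun n w => sintegral T (u w) (left_approx T n (y w)))); last first.
  by move=> w _; have [] := sintegral_left_path_cvg T0 (u w) (cy' w).
move=> n; under eq_fun do rewrite sintegral_left_approx//.
apply: measurable_sum => k; apply: measurable_funM.
  by apply: process_at => //; exact: grid_times.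
by apply: random_measure_fine => //; exact: measurable_grid_cell_left.
Qed.

Lemma measurable_tv u : random_measure u -> (forall w, Mspace T (u w)) ->
  measurable_fun setT (fun w => tv_norm (u w)).
Proof.
move=> mu Mu; apply: (@measurable_fun_cvg _ _ _ _ (fun n w => tvar T (u w) n)); last first.
  by move=> w _; exact: tvar_cvg.
move=> n; apply: measurable_funD.
  apply: measurable_sum => k; apply: measurableT_comp => //.
  by apply: random_measure_fine => //; exact: measurable_cell.
apply: measurableT_comp => //.
by apply: random_measure_fine => //; exact: emeasurable_set1.
Qed.

Lemma random_measure_lin (c : R) u u' : random_measure u -> random_measure u' ->
  random_measure (fun w => cadd (cscale c (u w)) (u' w) : smeasure).
Proof.
move=> mu mu' A mA; rewrite /cadd /= /cscale.
apply: emeasurable_funD; last exact: mu'.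
by apply: emeasurable_funM; [exact: measurable_cst|exact: mu].
Qed.

Definition admissible_pair (v : rmpair) :=
  [/\ random_measure v.1, random_measure v.2 &
      forall w : Omega, Mspace T (v.1 w) /\ Mtilde T (v.2 w)].

Lemma admissible_pair_lin (c : R) v v' : admissible_pair v -> admissible_pair v' ->
  admissible_pair (pair_lin c v v').
Proof.
move=> [v1 v2 vM] [v'1 v'2 v'M]; split; [exact: random_measure_lin|exact: random_measure_lin|].
move=> w; have [? ?] := vM w; have [? ?] := v'M w.
by split; [exact: Mspace_lin|exact: Mtilde_lin].
Qed.

Lemma path_pairingE y (v : rmpair) (w : Omega) : cadlag T (y w) -> Mtilde T (v.2 w) ->
  path_pairing T y v w =
  sintegral T (v.1 w) (y w) + sintegral T (v.2 w) (left_path (y w)).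
Proof. by move=> cy Mv; rewrite /path_pairing sintegral_left. Qed.

Lemma measurable_path_pairing y v : cadlag_process T y -> admissible_pair v ->
  measurable_fun setT (path_pairing T y v).
Proof.
move=> cy [v1 v2 vM]; have [cy' _] := cy.
rewrite (_ : path_pairing T y v = fun w =>
    sintegral T (v.1 w) (y w) + sintegral T (v.2 w) (left_path (y w))); last first.
  by apply/funext => w; rewrite path_pairingE//; case: (vM w).
apply: measurable_funD.
  by apply: measurable_sintegral => // w; case: (vM w).
by apply: measurable_sintegral_left_path => // w; case: (vM w) => _ [].
Qed.

Lemma measurable_pair_norm v : admissible_pair v -> measurable_fun setT (pair_norm v).
Proof.
move=> [v1 v2 vM]; apply: measurable_funD; apply: measurable_tv => // w.
  by case: (vM w).
by case: (vM w) => _ [].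
Qed.

Lemma path_pairing_le y v (w : Omega) (c : R) : cadlag T (y w) -> Mtilde T (v.2 w) ->
  (forall t, times T t -> `|y w t| <= c) ->
  `|path_pairing T y v w| <= c * pair_norm v w.
Proof.
move=> cy Mv yc; have c0 : 0 <= c by rewrite (le_trans (normr_ge0 _) (yc _ (times0 T0))).
rewrite path_pairingE// (le_trans (ler_normD _ _))// mulrDr lerD//.
  by apply: sintegral_le => //; exact: bm_cadlag.
apply: sintegral_le => //; first exact: bm_left_path.
by move=> t tT; apply: (left_path_le cy c0 yc tT).
Qed.

Lemma path_pairing_le_norm y v (w : Omega) : cadlag T (y w) -> Mtilde T (v.2 w) ->
  `|path_pairing T y v w| <= proc_norm T y w * pair_norm v w.
Proof.
by move=> cy Mv; apply: path_pairing_le => // t tT; exact: le_path_norm.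
Qed.

Lemma left_path_lin (a : R) (f g : \bar R -> R) t : cadlag T f -> cadlag T g -> times T t ->
  left_path (fun r => a * f r + g r) t = a * left_path f t + left_path g t.
Proof.
move=> cf cg /andP[t0 tT]; rewrite /left_path; have [_|t1] := eqVneq t 0%E.
  by rewrite mulr0 addr0.
have tT' : (0 < t <= T)%E by rewrite tT andbT lt_def t1.
by rewrite (left_limD (cadlagZ a cf) cg tT') (left_limZ a cf tT').
Qed.

Lemma path_pairing_linl (a : R) y z v (w : Omega) : cadlag T (y w) -> cadlag T (z w) ->
  Mtilde T (v.2 w) ->
  path_pairing T (a *: y + z) v w = a * path_pairing T y v w + path_pairing T z v w.
Proof.
move=> cy cz Mv.
have E : (a *: y + z) w = fun t => a * y w t + z w t by [].
rewrite !path_pairingE//; last by rewrite E; apply: cadlagD => //; exact: cadlagZ.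
have by1 := bm_cadlag T0 cy; have bz1 := bm_cadlag T0 cz.
have by2 := bm_left_path T0 cy; have bz2 := bm_left_path T0 cz.
rewrite E sintegralD//; last exact: bmZ.
rewrite sintegralZ// (@eq_sintegral _ _ _ (left_path _)
  (fun t => a * left_path (y w) t + left_path (z w) t)); last first.
  by move=> t tT; rewrite left_path_lin.
rewrite sintegralD//; last exact: bmZ.
by rewrite sintegralZ//; lra.
Qed.

Lemma path_pairing_linr (a : R) y v v' (w : Omega) : cadlag T (y w) ->
  Mtilde T (v.2 w) -> Mtilde T (v'.2 w) ->
  path_pairing T y (pair_lin a v v') w =
  a * path_pairing T y v w + path_pairing T y v' w.
Proof.
move=> cy Mv Mv'; rewrite !path_pairingE//; last exact: Mtilde_lin.
have by1 := bm_cadlag T0 cy; have by2 := bm_left_path T0 cy.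
by rewrite /pair_lin /= !sintegral_lin//; lra.
Qed.

Lemma path_pairing_ext y z v (w : Omega) : cadlag T (y w) -> Mtilde T (v.2 w) ->
  (forall t, times T t -> y w t = z w t) ->
  path_pairing T y v w = path_pairing T z v w.
Proof.
move=> cy Mv yz; have cz := cadlag_ext yz cy.
rewrite !path_pairingE//; congr (_ + _); first exact: eq_sintegral.
apply: eq_sintegral => t /andP[t0 tT]; rewrite /left_path.
have [//|t1] := eqVneq t 0%E; apply: (left_lim_ext cy yz).
by rewrite tT andbT lt_def t1.
Qed.

Lemma pair_norm_ge0 v (w : Omega) : 0 <= pair_norm v w.
Proof. by rewrite addr_ge0 ?tv_ge0. Qed.

Lemma pair_norm_lin (a : R) v v' (w : Omega) :
  pair_norm (pair_lin a v v') w <= `|a| * pair_norm v w + pair_norm v' w.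
Proof.
rewrite /pair_norm mulrDr addrACA lerD//; exact: tv_lin.
Qed.

Lemma proc_norm_ge0 y (w : Omega) : 0 <= proc_norm T y w.
Proof. exact: path_norm_ge0. Qed.

Lemma proc_norm_le y (w : Omega) (c : R) : (forall t, times T t -> `|y w t| <= c) ->
  proc_norm T y w <= c.
Proof. exact: path_norm_le. Qed.

Lemma proc_norm_lin (a : R) y z (w : Omega) : cadlag T (y w) -> cadlag T (z w) ->
  proc_norm T (a *: y + z) w <= `|a| * proc_norm T y w + proc_norm T z w.
Proof.
move=> cy cz; apply: proc_norm_le => t tT; rewrite (le_trans (ler_normD _ _))//.
by rewrite normrM lerD ?ler_wpM2l ?le_path_norm.
Qed.

Lemma cadlag_process_lin (a : R) y z : cadlag_process T y -> cadlag_process T z ->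
  cadlag_process T (a *: y + z).
Proof.
move=> cy cz; apply: (@cadlag_processD (fun w t => a * y w t) z) => //.
by apply: (@cadlag_processZ (fun=> a)) => //; exact: measurable_cst.
Qed.

End RandomPaths.

(** * Solid spaces of random variables *)

Lemma finite_set_bound (J : Type) (F : set J) (N : J -> nat) :
  finite_set F -> exists M, forall i, F i -> (N i <= M)%N.
Proof.
move=> fF; have /finite_seqP[s sE] : finite_set (N @` F) by exact: finite_image.
exists (\max_(i <- s) i) => i Fi; apply: (@leq_bigmax_seq _ s predT id) => //.
have : (N @` F) (N i) by exists i.
by rewrite sE.
Qed.

Section RandomVariables.
Context {R : realType} {d : measure_display} {Omega : measurableType d}.
Variable P : probability Omega R.
Implicit Types (xi zeta : Omega -> R) (c : R).

Lemma L1P xi : L1 P xi <-> P.-integrable setT (EFin \o xi).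
Proof. exact: Lfun1_integrable. Qed.

Lemma L1_measurable xi : L1 P xi -> measurable_fun setT xi.
Proof. by move=> /L1P/measurable_int/measurable_EFinP. Qed.

Lemma ae_true (Q : Omega -> Prop) : (forall w, Q w) -> {ae P, forall w, Q w}.
Proof. by move=> H; apply: filterE. Qed.

Lemma LinfP xi : Linf P xi <-> measurable_fun setT xi /\
  exists M : R, {ae P, forall w, `|xi w| <= M}.
Proof.
have P1 : (0 < P setT)%E by rewrite probability_setT.
have E : 'N[P]_+oo[EFin \o xi]%E = ess_sup P (abse \o (EFin \o xi)).
  by rewrite unlock P1.
split.
- rewrite /Linf /= inE => /andP[]; rewrite !inE/= /finite_norm E => mxi xioo; split => //.
  set M := ess_sup _ _ in xioo; have aeM := ess_sup_ge P (abse \o (EFin \o xi)).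
  rewrite -/M in aeM.
  have M0 : (M != -oo)%E.
    apply/eqP => MN; rewrite MN in aeM.
    have : P setT = 0%E.
      apply/eqP; rewrite eq_le measure_ge0 andbT.
      case: aeM => N [mN N0 subN]; rewrite -N0 le_measure ?inE//.
      by move=> w _; apply: subN => /=; rewrite leeNy_eq.
    by rewrite probability_setT => /eqP; rewrite onee_eq0.
  exists (fine M); apply: filterS aeM => w /=.
  by rewrite -{1}(@fineK _ M) ?lee_fin// fin_numE M0 lt_eqF.
- move=> [mxi [M aeM]]; rewrite /Linf /= inE; apply/andP; rewrite !inE/=; split => //.
  rewrite /finite_norm E (le_lt_trans _ (ltry M))//; apply/ess_supP.
  by apply: filterS aeM => w /=; rewrite lee_fin.
Qed.

Lemma Ninf_le xi (M : R) : {ae P, forall w, `|xi w| <= M} ->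
  ('N[P]_+oo[EFin \o xi] <= M%:E)%E.
Proof.
have P1 : (0 < P setT)%E by rewrite probability_setT.
move=> aeM; rewrite unlock P1; apply/ess_supP.
by apply: filterS aeM => w /=; rewrite lee_fin.
Qed.

Lemma L1_le xi zeta : measurable_fun setT xi -> L1 P zeta ->
  {ae P, forall w, `|xi w| <= `|zeta w|} -> L1 P xi.
Proof.
move=> mxi /L1P/integrableP[mz iz] le; apply/L1P/integrableP; split.
  exact/measurable_EFinP.
apply: le_lt_trans iz; apply: ae_ge0_le_integral => //.
- by apply: measurableT_comp => //; exact/measurable_EFinP.
- exact: measurableT_comp.
- by apply: filterS le => w le _; rewrite lee_fin.
Qed.

Lemma L1_cst c : L1 P (fun=> c).
Proof.
apply/L1P/measurable_bounded_integrable => //; first by rewrite -ge0_fin_numE// fin_num_measure.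
by exists `|c|; split; [exact: num_real|move=> x cx w _ /=; exact: ltW].
Qed.

Lemma Linf_L1 xi : Linf P xi -> L1 P xi.
Proof.
move=> /LinfP[mxi [M aeM]]; apply: (L1_le mxi (L1_cst M)).
by apply: filterS aeM => w le; rewrite (le_trans le)// ler_norm.
Qed.

Definition bounded_rv xi := measurable_fun setT xi /\ exists M : R, forall w, `|xi w| <= M.

Lemma bounded_Linf xi : bounded_rv xi -> Linf P xi.
Proof. by move=> [mxi [M HM]]; apply/LinfP; split => //; exists M; exact: ae_true. Qed.

Lemma bounded_L1 xi : bounded_rv xi -> L1 P xi.
Proof. by move=> /bounded_Linf/Linf_L1. Qed.

Lemma bounded_indic A : measurable A -> bounded_rv (\1_A : Omega -> R).
Proof.
move=> mA; split; first exact: measurable_indic.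
by exists 1 => w; rewrite indicE; case: (_ \in _); rewrite ?normr1 ?normr0.
Qed.

Lemma L1_add xi zeta : L1 P xi -> L1 P zeta -> L1 P (fun w => xi w + zeta w).
Proof. by move=> /L1P xi1 /L1P z1; apply/L1P; exact: (integrableD measurableT xi1 z1). Qed.

Lemma L1Z c xi : L1 P xi -> L1 P (fun w => c * xi w).
Proof. by move=> /L1P xi1; apply/L1P; exact: (integrableZl measurableT c xi1). Qed.

Lemma L1_norm xi : L1 P xi -> L1 P (fun w => `|xi w|).
Proof. by move=> /L1P xi1; apply/L1P; exact: (integrable_abse xi1). Qed.

Section Admissible.
Variable p : (Omega -> R) -> \bar R.
Hypothesis ap : admissible P p.

Lemma adm_ge0 xi : L1 P xi -> (0 <= p xi)%E.
Proof.
move=> Lxi; have [c c0 H] := adm_bounds ap; have [H1 _] := H xi Lxi.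
by apply: le_trans H1; rewrite mule_ge0 ?Lnorm_ge0// lee_fin invr_ge0 ltW.
Qed.

Lemma adm_linf : exists2 c, 0 < c & forall xi M, measurable_fun setT xi ->
  {ae P, forall w, `|xi w| <= M} -> (p xi <= (c * M)%:E)%E.
Proof.
have [c c0 H] := adm_bounds ap; exists c => // xi M mxi aeM.
have Lxi : Linf P xi by apply/LinfP; split => //; exists M.
have [_ H2] := H xi (Linf_L1 Lxi); apply: (le_trans H2).
by rewrite EFinM lee_wpmul2l ?lee_fin ?(ltW c0)//; exact: Ninf_le.
Qed.

Lemma adm_L1 : exists2 c, 0 < c & forall xi, L1 P xi ->
  (\int[P]_w `|xi w|%:E <= c%:E * p xi)%E.
Proof.
have [c c0 H] := adm_bounds ap; exists c => // xi Lxi; have [H1 _] := H xi Lxi.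
move: H1; rewrite Lnorm1 => H1.
rewrite -[leLHS]mul1e -(mulfV (lt0r_neq0 c0)) EFinM -muleA.
by rewrite lee_wpmul2l ?lee_fin ?(ltW c0).
Qed.

Lemma adm_0 : p (fun=> 0) = 0%E.
Proof.
have [c c0 H] := adm_linf; apply/eqP; rewrite eq_le adm_ge0 ?andbT; last exact: L1_cst.
have := H (fun=> 0) 0 (measurable_cst _); rewrite mulr0; apply.
by apply: ae_true => w; rewrite normr0.
Qed.

Lemma adm_Linf_fin xi : Linf P xi -> (p xi < +oo)%E.
Proof.
move=> /LinfP[mxi [M aeM]]; have [c c0 H] := adm_linf.
exact: le_lt_trans (H _ _ mxi aeM) (ltry _).
Qed.

Lemma adm_le xi zeta : measurable_fun setT xi -> L1 P zeta ->
  {ae P, forall w, `|xi w| <= `|zeta w|} -> (p xi <= p zeta)%E.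
Proof. by move=> mxi Lz le; apply: (adm_solid ap) => //; exact: (L1_le mxi Lz le). Qed.

Lemma adm_eq xi zeta : L1 P xi -> L1 P zeta ->
  {ae P, forall w, `|xi w| = `|zeta w|} -> p xi = p zeta.
Proof.
move=> Lxi Lz eq; apply/eqP; rewrite eq_le; apply/andP; split.
  by apply: (adm_solid ap) => //; apply: filterS eq => w ->.
by apply: (adm_solid ap) => //; apply: filterS eq => w ->.
Qed.

Lemma admZ c xi : L1 P xi -> p (fun w => c * xi w) = (`|c|%:E * p xi)%E.
Proof.
move=> Lxi; have [->|c0] := eqVneq c 0.
  rewrite normr0 mul0e -adm_0; apply: adm_eq => //; [exact: L1Z|exact: L1_cst|].
  by apply: ae_true => w; rewrite mul0r.
rewrite -(adm_homog ap)// ?normr_gt0//; apply: adm_eq => //; [exact: L1Z|exact: L1Z|].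
by apply: ae_true => w; rewrite /= !normrM normr_id.
Qed.

Lemma admD xi zeta : L1 P xi -> L1 P zeta ->
  (p (fun w => xi w + zeta w)%R <= p xi + p zeta)%E.
Proof. exact: (adm_subadd ap). Qed.

Lemma adm_indic_cvg0 (A : nat -> set Omega) : (forall n, measurable (A n)) ->
  (forall n m, (n <= m)%N -> A m `<=` A n) -> \bigcap_n A n = set0 ->
  p (\1_(A n)) @[n --> \oo] --> 0%E.
Proof.
move=> mA nA A0; apply: (adm_cvg0 ap (xi := fun n => \1_(A n)) _ _).2.
  by move=> n; exact/bounded_Linf/bounded_indic.
apply: ae_true => w; split.
  move=> n m nm; rewrite !indicE; case: (boolP (w \in A m)) => //= wA.
  by rewrite mem_set//; apply: (nA _ _ nm); exact/set_mem.
apply: cvg_near_cst.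
have [N wN] : exists N, ~ A N w.
  apply: contrapT => H; have : (\bigcap_n A n) w.
    by move=> n _; apply: contrapT => nAn; apply: H; exists n.
  by rewrite A0.
by exists N => // n /= Nn; rewrite indicE memNset// => /(nA _ _ Nn).
Qed.

End Admissible.

Definition tail (n : nat) xi w : R := Num.max (`|xi w| - n%:R) 0.

Lemma tail_ge0 n xi w : 0 <= tail n xi w.
Proof. by rewrite le_max lexx orbT. Qed.

Lemma tail_le n xi w : tail n xi w <= `|xi w|.
Proof. by rewrite ge_max normr_ge0 andbT gerBl. Qed.

Lemma measurable_tail n xi : measurable_fun setT xi -> measurable_fun setT (tail n xi).
Proof.
move=> mxi; apply: measurable_maxr => //; apply: measurable_funB => //.
exact: measurableT_comp.
Qed.

Lemma L1_tail n xi : L1 P xi -> L1 P (tail n xi).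
Proof.
move=> Lxi; apply: (L1_le _ Lxi); first exact/measurable_tail/L1_measurable.
by apply: ae_true => w; rewrite ger0_norm ?tail_ge0// tail_le.
Qed.

Lemma tail_anti n m xi w : (n <= m)%N -> tail m xi w <= tail n xi w.
Proof.
move=> nm; rewrite ge_max tail_ge0 andbT le_max lerB//.
by rewrite ler_nat.
Qed.

Lemma tail_fin p n xi (e : R) : admissible P p -> L1 P xi -> (p (tail n xi) < e%:E)%E ->
  (p xi < +oo)%E.
Proof.
move=> ap Lxi pn.
apply: (@le_lt_trans _ _ (p (fun w => tail n xi w + n%:R)%R)).
  apply: (adm_le ap); first exact: L1_measurable.
    by apply: L1_add; [exact: L1_tail|exact: L1_cst].
  apply: ae_true => w; rewrite [leRHS]ger0_norm ?addr_ge0 ?tail_ge0//.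
  have : `|xi w| - n%:R <= tail n xi w by rewrite le_max lexx.
  by lra.
apply: (le_lt_trans (admD ap (L1_tail n Lxi) (L1_cst _))).
rewrite lte_add_pinfty//; first exact: lt_trans pn (ltry _).
apply: (adm_Linf_fin ap); apply: bounded_Linf; split; first exact: measurable_cst.
by exists n%:R => w; rewrite ger0_norm.
Qed.

Definition truncate (n : nat) xi w : R := Num.max (- n%:R) (Num.min (xi w) n%:R).

Lemma truncate_le n xi w : `|truncate n xi w| <= n%:R.
Proof.
rewrite ler_norml /truncate le_max lexx/= ge_max ge_min lexx orbT andbT.
by rewrite (@le_trans _ _ 0)// oppr_le0.
Qed.

Lemma truncateB n xi w : `|truncate n xi w - xi w| = tail n xi w.
Proof.
have n0 : 0 <= n%:R :> R by [].
rewrite /truncate /tail; have [h|h] := leP (xi w) n%:R.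
  have [h'|h'] := leP (- n%:R) (xi w).
    rewrite subrr normr0; apply/esym/max_idPr; rewrite subr_le0 ler_norml h'//.
  rewrite [in RHS]ltr0_norm; last by lra.
  rewrite ger0_norm; last by lra.
  by rewrite (max_idPl _); lra.
rewrite (max_idPr _); last by lra.
rewrite ltr0_norm; last by lra.
rewrite gtr0_norm; last by lra.
by rewrite (max_idPl _); lra.
Qed.

Lemma measurable_truncate n xi : measurable_fun setT xi ->
  measurable_fun setT (truncate n xi).
Proof. by move=> mxi; apply: measurable_maxr => //; exact: measurable_minr. Qed.

Variable PP : set ((Omega -> R) -> \bar R).
Hypothesis PP_admissible : forall p, PP p -> admissible P p.

(** Truncation is the best bounded approximation: if b is bounded by n, then |xi - b|
dominates the positive part of |xi| - n. *)
Lemma YspaceP xi : Yspace P PP xi <-> L1 P xi /\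
  forall p e, PP p -> 0 < e -> exists n, (p (tail n xi) < e%:E)%E.
Proof.
split.
- move=> [[Lxi dxi] cl]; split => // p e PPp e0; have ap := PP_admissible PPp.
  have [|b [Lb Ab]] := cl [set b | L1 P b /\ (p (b - xi)%R < e%:E)%E].
    exists [set p], e; split => //; first by move=> _ ->.
    by move=> y [Ly _] /(_ p erefl) H; split.
  case: Ab => Lb1 pb; have /LinfP[mb [M aeM]] := Lb.
  exists (Num.truncn M).+1; apply: le_lt_trans pb.
  have mxi := L1_measurable Lxi.
  apply: (adm_le ap).
  + exact: measurable_tail.
  + by have := L1_add Lb1 (L1Z (-1) Lxi); under eq_fun do rewrite mulN1r.
  + apply: filterS aeM => w bM; rewrite ger0_norm ?tail_ge0//.
    rewrite ge_max normr_ge0 andbT -[_%:R]opprK opprK /=.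
    have Mn : M < (Num.truncn M).+1%:R.
      have [M0|M0] := leP 0 M; first by case/andP: (truncn_itv M0).
      by rewrite (lt_le_trans M0).
    have := ler_normD (xi w - b w) (b w); rewrite subrK distrC => H.
    have -> : (b - xi) w = b w - xi w by [].
    by lra.
- move=> [Lxi H]; have mxi := L1_measurable Lxi; split.
    split => // p PPp; split => //; have ap := PP_admissible PPp.
    by have [n pn] := H p 1 PPp ltr01; exact: (tail_fin ap Lxi pn).
  move=> A [F [e [FP fF e0 HA]]].
  have [N HN] : exists N, forall p, PP p -> (p (tail (N p) xi) < e%:E)%E.
    suff /choice[N HN] : forall p, exists n, PP p -> (p (tail n xi) < e%:E)%E by exists N.
    move=> p; have [PPp|nP] := pselect (PP p); last by exists 0%N.
    by have [n pn] := H p e PPp e0; exists n.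
  have [M NM] := finite_set_bound N fF.
  have bt : bounded_rv (truncate M xi).
    by split; [exact: measurable_truncate|exists M%:R => w; exact: truncate_le].
  exists (truncate M xi); split; first exact: bounded_Linf.
  apply: HA.
    split; first exact: bounded_L1.
    move=> p PPp; split; first exact: bounded_L1.
    by apply: (adm_Linf_fin (PP_admissible PPp)); exact: bounded_Linf.
  move=> p Fp; have PPp := FP _ Fp; have ap := PP_admissible PPp.
  apply: le_lt_trans (HN p PPp); apply: (adm_le ap).
  + apply: (@measurable_funB _ _ _ _ (truncate M xi) xi) => //.
    exact: measurable_truncate.
  + exact: L1_tail.
  + apply: ae_true => w; rewrite [leRHS]ger0_norm ?tail_ge0//.
    by rewrite [X in `|X|]/(truncate M xi w - xi w) truncateB tail_anti// NM.
Qed.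

Lemma Yspace_L1 xi : Yspace P PP xi -> L1 P xi.
Proof. by move=> /YspaceP[]. Qed.

Lemma Yspace_fin xi p : Yspace P PP xi -> PP p -> (p xi < +oo)%E.
Proof. by move=> [[_ +] _] PPp => /(_ p PPp)[]. Qed.

Lemma Linf_Yspace xi : Linf P xi -> Yspace P PP xi.
Proof.
move=> Lxi; have /LinfP[mxi [M aeM]] := Lxi; apply/YspaceP; split; first exact: Linf_L1.
move=> p e PPp e0; have ap := PP_admissible PPp; exists (Num.truncn M).+1.
rewrite (@adm_eq _ ap _ (fun=> 0)) ?adm_0 ?lte_fin//.
- exact/L1_tail/Linf_L1.
- exact: L1_cst.
- apply: filterS aeM => w xM; rewrite normr0; apply/eqP; rewrite normr_eq0 /tail.
  apply/eqP/max_idPr; rewrite subr_le0 (le_trans xM)//.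
  have [M0|M0] := leP 0 M; first by case/andP: (truncn_itv M0) => _ /ltW.
  by rewrite (le_trans (ltW M0)).
Qed.

Lemma Yspace_solid xi zeta : measurable_fun setT xi -> Yspace P PP zeta ->
  {ae P, forall w, `|xi w| <= `|zeta w|} -> Yspace P PP xi.
Proof.
move=> mxi /YspaceP[Lz Hz] le; apply/YspaceP; split; first exact: (L1_le mxi Lz le).
move=> p e PPp e0; have [n pn] := Hz p e PPp e0; exists n.
apply: le_lt_trans pn; apply: (adm_le (PP_admissible PPp)).
- exact: measurable_tail.
- exact: L1_tail.
- apply: filterS le => w le; rewrite !ger0_norm ?tail_ge0//.
  by rewrite ge_max tail_ge0 andbT le_max lerB.
Qed.

Lemma YspaceD xi zeta : Yspace P PP xi -> Yspace P PP zeta ->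
  Yspace P PP (fun w => xi w + zeta w).
Proof.
move=> /YspaceP[Lx Hx] /YspaceP[Lz Hz]; apply/YspaceP; split; first exact: L1_add.
move=> p e PPp e0; have ap := PP_admissible PPp.
have e2 : 0 < e / 2 by rewrite divr_gt0.
have [n pn] := Hx p _ PPp e2; have [m pm] := Hz p _ PPp e2; exists (n + m)%N.
apply: (@le_lt_trans _ _ (p (fun w => tail n xi w + tail m zeta w)%R)).
  apply: (adm_le ap); first exact/measurable_tail/L1_measurable/L1_add.
    by apply: L1_add; exact: L1_tail.
  apply: ae_true => w; rewrite ger0_norm ?tail_ge0// ger0_norm ?addr_ge0 ?tail_ge0//.
  rewrite ge_max addr_ge0 ?tail_ge0// andbT natrD.
  have := ler_normD (xi w) (zeta w).
  have : `|xi w| - n%:R <= tail n xi w by rewrite le_max lexx.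
  have : `|zeta w| - m%:R <= tail m zeta w by rewrite le_max lexx.
  by lra.
apply: (le_lt_trans (admD ap (L1_tail n Lx) (L1_tail m Lz))).
by rewrite (splitr e) EFinD lteD.
Qed.

Lemma YspaceZ c xi : Yspace P PP xi -> Yspace P PP (fun w => c * xi w).
Proof.
move=> /YspaceP[Lx Hx]; apply/YspaceP; split; first exact: L1Z.
move=> p e PPp e0; have ap := PP_admissible PPp.
have c1 : 0 < `|c| + 1 by rewrite ltr_wpDl.
have [n pn] := Hx p (e / (`|c| + 1)) PPp (divr_gt0 e0 c1).
pose m := (Num.truncn (`|c| * n%:R)).+1; exists m.
apply: (@le_lt_trans _ _ (p (fun w => (`|c| + 1) * tail n xi w)%R)).
  apply: (adm_le ap); first exact/measurable_tail/L1_measurable/L1Z.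
    exact/L1Z/L1_tail.
  apply: ae_true => w; rewrite ger0_norm ?tail_ge0// ger0_norm; last first.
    by rewrite mulr_ge0 ?tail_ge0// ltW.
  rewrite ge_max mulr_ge0 ?tail_ge0 ?(ltW c1)// andbT normrM.
  have h1 : `|xi w| - n%:R <= tail n xi w by rewrite le_max lexx.
  have h2 : `|c| * n%:R < m%:R.
    by have /andP[] := @truncn_itv _ (`|c| * n%:R) (mulr_ge0 (normr_ge0 _) (ler0n _ _)).
  have h3 := tail_ge0 n xi w; have h4 := normr_ge0 c.
  have := ler_wpM2l h4 h1; lra.
rewrite (admZ ap) ?(gtr0_norm c1)//; last exact: L1_tail.
rewrite -[e](divfK (lt0r_neq0 c1)) mulrC EFinM.
by rewrite lte_pmul2l// lte_fin.
Qed.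

End RandomVariables.

(** * Completeness and dense subspaces *)

Lemma countable_enum (J : Type) (A : set J) : countable A -> A !=set0 ->
  exists f : nat -> J, (forall n, A (f n)) /\ forall x, A x -> exists n, f n = x.
Proof.
move=> /countable_injP[g gi] [a Aa].
have H n : exists x, A x /\ ((exists2 z, A z & g z = n) -> g x = n).
  have [[z Az zn]|nz] := pselect (exists2 z, A z & g z = n); first by exists z.
  by exists a.
have [f fP] := choice H; exists f; split; first by move=> n; case: (fP n).
move=> x Ax; exists (g x); have [Af /(_ (ex_intro2 _ _ x Ax erefl)) gf] := fP (g x).
by apply: gi => //; exact/mem_set.
Qed.

Lemma dominated_increments_cvg (R : realType) (x s : nat -> R) (S : R) :
  (forall n, `|x n.+1 - x n| <= s n.+1 - s n) -> s n @[n --> \oo] --> S ->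
  exists2 l, x n @[n --> \oo] --> l & forall n, `|l - x n| <= S - s n.
Proof.
move=> xs sS.
have snd : nondecreasing_seq s.
  by apply/nondecreasing_seqP => n; rewrite -subr_ge0 (le_trans _ (xs n)).
have s_le n : s n <= S.
  rewrite -(cvg_lim _ sS)//; apply: nondecreasing_cvgn_le => //.
  by apply/cvg_ex; exists S.
have xsD n k : `|x (n + k)%N - x n| <= s (n + k)%N - s n.
  elim: k => [|k IH]; first by rewrite addn0 !subrr normr0.
  rewrite addnS; have := xs (n + k)%N.
  have := ler_distD (x (n + k)%N) (x (n + k).+1) (x n); lra.
have xsM n m : (n <= m)%N -> `|x m - x n| <= s m - s n.
  by move=> nm; have := xsD n (m - n)%N; rewrite subnKC.
have [l xl] : exists l : R, x n @[n --> \oo] --> l.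
  have nd : nondecreasing_seq (fun n => x n + s n).
    apply/nondecreasing_seqP => n; have := xs n; rewrite ler_norml; lra.
  have ub : has_ubound (range (fun n => x n + s n)).
    exists (x 0%N + (S - s 0%N) + S) => _ [n _ <-].
    by have := xsM 0%N n (leq0n n); have := s_le n; rewrite ler_norml; lra.
  have C := nondecreasing_cvgn nd ub.
  exists (sup (range (fun n => x n + s n)) - S).
  rewrite (_ : (fun n => x n) = fun n => (x n + s n) - s n); first exact: cvgB.
  by apply/funext => n; rewrite addrK.
exists l => // n.
apply: (@cvg_seq_le _ (fun m => `|x (m + n)%N - x n|)).
  apply: cvg_norm; apply: cvgB; last exact: cvg_cst.
  by rewrite (cvg_shiftn n x).
move=> m; apply: le_trans (xsM n (m + n)%N (leq_addl _ _)) _.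
by rewrite lerD2r.
Qed.

Lemma filter_forall_lt (X : Type) (F : set_system X) (C : nat -> set X) N :
  Filter F -> (forall k, F (C k)) -> F [set z | forall k, (k < N)%N -> C k z].
Proof.
move=> FF FC; elim: N => [|N IH]; first by apply: filterE.
apply: filterS (filterI IH (FC N)) => z [H1 H2] k.
by rewrite ltnS leq_eqVlt => /predU1P[->//|]; exact: H1.
Qed.

Section Frechet.
Context {R : realType} {d : measure_display} {Omega : measurableType d}.
Variables (P : probability Omega R) (T : \bar R) (PP : set ((Omega -> R) -> \bar R)).
Hypothesis T0 : (0 < T)%E.
Hypothesis PP_admissible : forall p, PP p -> admissible P p.
Implicit Types (x y z : Omega -> \bar R -> R).

Lemma YDP y : YD P T PP y <-> cadlag_process T y /\ Yspace P PP (proc_norm T y).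
Proof.
split; first by move=> [[]].
move=> [cy Yy]; split => //; split => //; exact: (Yspace_L1 PP_admissible Yy).
Qed.

Lemma LinfD_YD y : LinfD P T y -> YD P T PP y.
Proof. by move=> [cy Ly]; apply/YDP; split => //; exact: Linf_Yspace. Qed.

Lemma proc_norm_abs y w : `|proc_norm T y w| = proc_norm T y w.
Proof. by rewrite ger0_norm// proc_norm_ge0. Qed.

Lemma proc_normN x y w : proc_norm T (x - y) w = proc_norm T (y - x) w.
Proof.
by apply: eq_path_norm => t _; rewrite [LHS]/(`|x w t - y w t|) distrC.
Qed.

Lemma cadlag_processB x y : cadlag_process T x -> cadlag_process T y ->
  cadlag_process T (x - y).
Proof.
move=> cx cy; have := cadlag_process_lin (-1) cy cx.
by congr cadlag_process; apply/funext => w; apply/funext => t;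
  rewrite [LHS]/(-1 * y w t + x w t) mulN1r addrC.
Qed.

Lemma YD_lin (a : R) x y : YD P T PP x -> YD P T PP y -> YD P T PP (a *: x + y).
Proof.
move=> /YDP[cx Yx] /YDP[cy Yy]; apply/YDP.
have cxy := cadlag_process_lin a cx cy; split => //.
apply: (Yspace_solid PP_admissible _ (YspaceD PP_admissible (YspaceZ PP_admissible `|a| Yx) Yy)).
  exact: measurable_proc_norm.
apply: ae_true => w; rewrite proc_norm_abs ger0_norm.
  by apply: proc_norm_lin => //; [case: cx|case: cy].
by rewrite addr_ge0 ?mulr_ge0 ?proc_norm_ge0.
Qed.

Lemma YDB x y : YD P T PP x -> YD P T PP y -> YD P T PP (x - y).
Proof.
move=> Yx Yy; have := YD_lin (-1) Yy Yx.
by rewrite scaleN1r addrC.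
Qed.

Lemma proc_norm_triangle x y z w : cadlag T (x w) -> cadlag T (y w) -> cadlag T (z w) ->
  proc_norm T (x - z) w <= proc_norm T (x - y) w + proc_norm T (y - z) w.
Proof.
move=> cx cy cz.
have c1 : cadlag T ((x - y) w).
  apply: (@cadlag_ext _ _ (fun t => x w t + (-1) * y w t)).
    by move=> t _; rewrite mulN1r.
  by apply: cadlagD => //; exact: cadlagZ.
have c2 : cadlag T ((y - z) w).
  apply: (@cadlag_ext _ _ (fun t => y w t + (-1) * z w t)).
    by move=> t _; rewrite mulN1r.
  by apply: cadlagD => //; exact: cadlagZ.
apply: (proc_norm_le T0) => t tT.
rewrite (le_trans (ler_distD (y w t) _ _))// lerD//.
  exact: (le_path_norm T0 c1 tT).
exact: (le_path_norm T0 c2 tT).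
Qed.

Section Seminorm.
Variable p : (Omega -> R) -> \bar R.
Hypothesis ap : admissible P p.
Local Notation q := (proc_seminorm T p).

Lemma qD x y : L1D P T x -> L1D P T y -> (q (x + y)%R <= q x + q y)%E.
Proof.
move=> [cx Lx] [cy Ly]; apply: le_trans (admD ap Lx Ly).
have cxy : cadlag_process T (x + y) by exact: cadlag_processD.
apply: (adm_le ap); [exact: measurable_proc_norm|exact: L1_add|].
apply: ae_true => w; rewrite proc_norm_abs ger0_norm ?addr_ge0 ?proc_norm_ge0//.
by apply: path_normD => //; [case: cx|case: cy].
Qed.

Lemma qB x y : q (x - y)%R = q (y - x)%R.
Proof. by rewrite /proc_seminorm; congr p; apply/funext => w; exact: proc_normN. Qed.

Lemma q_triangle x y z : cadlag_process T x -> cadlag_process T y -> cadlag_process T z ->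
  L1 P (proc_norm T (x - y)) -> L1 P (proc_norm T (y - z)) ->
  (q (x - z)%R <= q (x - y)%R + q (y - z)%R)%E.
Proof.
move=> cx cy cz L1xy L1yz; apply: le_trans (admD ap L1xy L1yz).
apply: (adm_le ap); [exact/measurable_proc_norm/cadlag_processB|exact: L1_add|].
apply: ae_true => w; rewrite proc_norm_abs ger0_norm ?addr_ge0 ?proc_norm_ge0//.
by apply: proc_norm_triangle; [case: cx|case: cy|case: cz].
Qed.

Lemma qZ (a : R) x : L1D P T x -> q (a *: x) = (`|a|%:E * q x)%E.
Proof.
move=> [[cx _] Lx]; rewrite /proc_seminorm -(normr_id a) -(admZ ap _ Lx).
by congr p; apply/funext => w; rewrite -path_normZ.
Qed.

End Seminorm.

Section Complete.
Variable pn : nat -> (Omega -> R) -> \bar R.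
Hypothesis PPpn : forall n, PP (pn n).
Local Notation thr n := ((1 / (2 ^ n.+1)%:R) : R).

Let thr_anti n m : (n <= m)%N -> thr m <= thr n.
Proof.
move=> nm; rewrite !div1r lef_pV2 ?posrE ?ltr0n ?expn_gt0// ler_nat.
by rewrite leq_exp2l.
Qed.

Variable x : nat -> Omega -> \bar R -> R.
Hypothesis Yx : forall n, YD P T PP (x n).
Hypothesis xC : forall i n m, (i <= n)%N -> (n <= m)%N ->
  (proc_seminorm T (pn i) (x m - x n)%R < (thr n)%:E)%E.

Let cx n : cadlag_process T (x n). Proof. by have /YDP[] := Yx n. Qed.
Let L1B n m : L1 P (proc_norm T (x n - x m)).
Proof. by have [[]] := YDB (Yx n) (Yx m). Qed.

Let D n w := proc_norm T (x n.+1 - x n) w.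
Let S w := (\sum_(0 <= k <oo) (D k w)%:E)%E.
Let s n w := \sum_(0 <= k < n) D k w.

Let mD n : measurable_fun setT (D n).
Proof. exact: (L1_measurable (L1B n.+1 n)). Qed.

Let D0 n w : 0 <= D n w. Proof. exact: proc_norm_ge0. Qed.

Let mS : measurable_fun setT S.
Proof.
apply: ge0_emeasurable_sum => [n w _ _|n _]; first by rewrite lee_fin.
exact/measurable_EFinP.
Qed.

Let S0 w : (0 <= S w)%E. Proof. by apply: nneseries_ge0 => n _ _; rewrite lee_fin. Qed.

Let S_integrable : P.-integrable setT S.
Proof.
apply/integrableP; split => //.
under eq_integral do rewrite gee0_abs//.
rewrite integral_nneseries//; first last.
- by move=> n w _; rewrite lee_fin.
- by move=> n; exact/measurable_EFinP.
have [c c0 Hc] := adm_L1 (PP_admissible (PPpn 0)).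
apply: (@le_lt_trans _ _ (\sum_(0 <= n <oo) (c / (2 ^ n.+1)%:R)%:E)%E).
  apply: lee_nneseries => [n _ _|n _]; first by apply: integral_ge0 => w _; rewrite lee_fin.
  have -> : (\int[P]_w (D n w)%:E = \int[P]_w `|proc_norm T (x n.+1 - x n) w|%:E)%E.
    by apply: eq_integral => w _; rewrite proc_norm_abs.
  apply: (le_trans (Hc _ (L1B n.+1 n))); rewrite EFinM lee_wpmul2l ?lee_fin ?(ltW c0)//.
  by rewrite -div1r ltW// xC.
have := @epsilon_trick R (fun=> 0%E) c xpredT (fun=> lexx _) (ltW c0).
rewrite (eq_eseriesr (fun n _ => add0e _)) (_ : (\sum_(0 <= i <oo) 0)%E = 0%E :> \bar R).
  by rewrite add0e => /le_lt_trans; apply; rewrite ltry.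
exact: eseries0.
Qed.

Let good := [set w | (S w < +oo)%E].

Let mgood : measurable good.
Proof. by apply: measurable_lte_set => //; exact: measurable_cst. Qed.

Let ae_good : {ae P, forall w, good w}.
Proof.
have := integrable_ae measurableT S_integrable.
by apply: filterS => w /(_ I); rewrite ge0_fin_numE.
Qed.

Let s_cvg w : good w -> s n w @[n --> \oo] --> fine (S w).
Proof.
move=> gw.
have : (\sum_(0 <= k < n) (D k w)%:E)%E @[n --> \oo] --> (fine (S w))%:E.
  rewrite fineK; last by rewrite ge0_fin_numE.
  by apply: is_cvg_nneseries => n _ _; rewrite lee_fin.
move=> /fine_cvgP[_]; rewrite (_ : fine \o _ = fun n => s n w)//.
by apply/funext => n /=; rewrite sumEFin.
Qed.

Let x_cvg w t : good w -> times T t ->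
  exists2 l, x n w t @[n --> \oo] --> l & forall n, `|l - x n w t| <= fine (S w) - s n w.
Proof.
move=> gw tT; apply: (@dominated_increments_cvg _ (fun n => x n w t) (fun n => s n w)).
  move=> n; rewrite /s big_nat_recr//= [leRHS]addrAC subrr add0r.
  have cB : cadlag T ((x n.+1 - x n) w) by have [+ _] := cadlag_processB (cx n.+1) (cx n).
  exact: (le_path_norm T0 cB tT).
exact: s_cvg.
Qed.

Let y w t : R := lim ((\1_good w * x n w t) @[n --> \oo]).

Let y_cvg w t : times T t -> \1_good w * x n w t @[n --> \oo] --> y w t.
Proof.
move=> tT; rewrite /y indicE; have [/set_mem gw|_] := boolP (w \in good); last first.
  by under eq_fun do rewrite mul0r; rewrite lim_cst//; exact: cvg_cst.
have [l xl _] := x_cvg gw tT; under eq_fun do rewrite mul1r.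
by rewrite (cvg_lim _ xl).
Qed.

Let yB w t n : good w -> times T t -> `|y w t - x n w t| <= fine (S w) - s n w.
Proof.
move=> gw tT; have [l xl H] := x_cvg gw tT.
rewrite (_ : y w t = l)//; apply: (@cvg_seq_uniq _ (fun n => \1_good w * x n w t)).
  exact: y_cvg.
by rewrite indicE mem_set//; under eq_fun do rewrite mul1r.
Qed.

Let s_le w n : good w -> s n w <= fine (S w).
Proof.
by move=> gw; rewrite -subr_ge0; exact: le_trans (normr_ge0 _) (yB n gw (times0 T0)).
Qed.

Let cy : cadlag_process T y.
Proof.
split.
  move=> w; have [gw|ngw] := pselect (good w); last first.
    apply: (@cadlag_ext _ _ (fun=> 0)); last exact: cadlag_cst.
    move=> t tT; apply: (@cvg_seq_uniq _ (fun n => \1_good w * x n w t)).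
      by rewrite indicE memNset//; under eq_fun do rewrite mul0r; exact: cvg_cst.
    exact: y_cvg.
  apply: cadlag_uniform_limit => e e0.
  have [N _ HN] := (cvgrPdist_lt _ _).1 (s_cvg gw) e e0.
  exists (x N w); first by have [+ _] := cx N.
  move=> t tT; apply: (le_trans (yB N gw tT)).
  by have := HN N (leqnn N); rewrite ltr_norml; lra.
apply: (@measurable_fun_cvg _ _ R _ (fun n (z : Omega * \bar R) => (\1_good z.1 * x n z.1 z.2 : R))).
  move=> n; apply: measurable_funM; last by have [_] := cx n.
  have m1 : measurable_fun setT (\1_good : Omega -> R) by exact: measurable_indic.
  by apply: measurable_funTS; exact: (measurableT_comp m1).
by move=> [w t] [_ /= tT]; exact: y_cvg.
Qed.

Let yx_le n w : good w -> proc_norm T (y - x n) w <= fine (S w) - s n w.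
Proof. by move=> gw; apply: (proc_norm_le T0) => t tT; exact: yB. Qed.

Let m_yx n : measurable_fun setT (proc_norm T (y - x n)).
Proof. exact/measurable_proc_norm/cadlag_processB. Qed.

Let yx_leS n : {ae P, forall w, ((proc_norm T (y - x n) w)%:E <= S w)%E}.
Proof.
apply: filterS ae_good => w gw; rewrite -(@fineK _ (S w)) ?ge0_fin_numE// lee_fin.
rewrite (le_trans (yx_le n gw))// lerBlDr lerDl.
by apply: sumr_ge0 => k _; exact: D0.
Qed.

Let L1_yx n : L1 P (proc_norm T (y - x n)).
Proof.
apply/L1P/integrableP; split; first exact/measurable_EFinP.
have /integrableP[_ iS] := S_integrable; apply: le_lt_trans iS.
apply: ae_ge0_le_integral => //.
- by apply: measurableT_comp => //; exact/measurable_EFinP.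
- exact: measurableT_comp.
- apply: filterS (yx_leS n) => w le _ /=.
  by rewrite proc_norm_abs (gee0_abs (S0 w)).
Qed.

Let yx_cvg0 : (\int[P]_w (proc_norm T (y - x n) w)%:E)%E @[n --> \oo] --> 0%E.
Proof.
pose f := fun (n : nat) w => (proc_norm T (y - x n) w)%:E.
have mf n : measurable_fun setT (f n) by exact/measurable_EFinP.
have mf0 : measurable_fun setT (cst 0%E : Omega -> \bar R) by exact: measurable_cst.
have f_f : {ae P, forall w, setT w -> f n w @[n --> \oo] --> cst 0%E w}.
  apply: filterS ae_good => w gw _; apply: cvg_EFin; first exact: nearW.
  have C : (fine (S w) - s n w) @[n --> \oo] --> 0.
    by rewrite -(subrr (fine (S w))); apply: cvgB; [exact: cvg_cst|exact: s_cvg].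
  apply: (squeeze_cvgr _ (cvg_cst 0) C).
  by apply: nearW => n; rewrite yx_le// andbT; exact: proc_norm_ge0.
have f_g : {ae P, forall w n, setT w -> (`|f n w| <= S w)%E}.
  apply: filterS ae_good => w gw n _; rewrite gee0_abs ?lee_fin ?proc_norm_ge0//.
  rewrite -(@fineK _ (S w)) ?ge0_fin_numE// lee_fin.
  rewrite (le_trans (yx_le n gw))// lerBlDr lerDl.
  by apply: sumr_ge0 => k _; exact: D0.
have [_ _] := dominated_convergence measurableT mf mf0 f_f S_integrable f_g.
by rewrite integral_cst// mul0e.
Qed.

Let qyx i n : (i <= n)%N -> (proc_seminorm T (pn i) (y - x n)%R <= (thr n)%:E)%E.
Proof.
move=> le_in; rewrite leNgt; apply/negP => lt.
have ap := PP_admissible (PPpn i).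
have [F [e [_ _ e0 H]]] := adm_lsc ap (L1_yx n) lt.
have [M _ HM] : \forall m \near \oo, (\int[P]_w (proc_norm T (y - x m) w)%:E < e%:E)%E.
  apply: (yx_cvg0 (t := [set r | (r < e%:E)%E])).
  apply: open_nbhs_nbhs; split; first exact: open_ereal_lt_ereal.
  by rewrite /= lte_fin.
pose m := maxn M n.
have := H (proc_norm T (x m - x n)) (L1B m n).
suff N1 : ('N[P]_1[EFin \o (proc_norm T (x m - x n) - proc_norm T (y - x n))%R] < e%:E)%E.
  move=> /(_ (fun _ _ => N1)); rewrite ltNge => /negP; apply.
  by apply/ltW/xC => //; exact: leq_maxr.
rewrite Lnorm1; apply: le_lt_trans (HM m (leq_maxl _ _)).
apply: ge0_le_integral => //.
- do 2 apply: measurableT_comp => //.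
  apply: measurable_funB; first exact: (L1_measurable (L1B m n)).
  exact: m_yx.
- exact/measurable_EFinP.
- move=> w _ /=; rewrite lee_fin.
  have c1 k : cadlag T (x k w) by have [+ _] := cx k.
  have c2 : cadlag T (y w) by have [+ _] := cy.
  have H1 := proc_norm_triangle (c1 m) c2 (c1 n).
  have H2 := proc_norm_triangle c2 (c1 m) (c1 n).
  rewrite [proc_norm T (x m - y) w]proc_normN in H1.
  suff : `|proc_norm T (x m - x n) w - proc_norm T (y - x n) w| <=
    proc_norm T (y - x m) w by [].
  by rewrite ler_norml; lra.
Qed.

Hypothesis pn_onto : forall p, PP p -> exists n, pn n = p.

Let thr_small (e : R) : 0 < e -> exists N, thr N < e.
Proof.
move=> e0; exists (Num.truncn e^-1); rewrite div1r -[ltRHS]invrK.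
rewrite ltf_pV2 ?posrE ?ltr0n ?expn_gt0 ?invr_gt0//.
have ei : 0 <= e^-1 by rewrite invr_ge0 ltW.
have /andP[_] := truncn_itv ei; move=> /lt_le_trans; apply.
by rewrite ler_nat ltnW// ltn_expl.
Qed.

Let Yy : YD P T PP y.
Proof.
apply/YDP; split => //; apply/(YspaceP PP_admissible).
have Lx n : L1 P (proc_norm T (x n)) by have [[]] := Yx n.
have tri n w : proc_norm T y w <= proc_norm T (x n) w + proc_norm T (y - x n) w.
  have c1 : cadlag T (x n w) by have [+ _] := cx n.
  have c2 : cadlag T ((y - x n) w) by have [+ _] := cadlag_processB cy (cx n).
  apply: (proc_norm_le T0) => t tT.
  have := ler_normD (x n w t) (y w t - x n w t).
  have := le_path_norm T0 c1 tT; have := le_path_norm T0 c2 tT.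
  have -> : (y - x n) w t = y w t - x n w t by [].
  by rewrite [x n w t + _]addrC subrK /proc_norm; lra.
split.
  apply: (L1_le (measurable_proc_norm T0 cy) (L1_add (Lx 0%N) (L1_yx 0%N))).
  apply: ae_true => w; rewrite proc_norm_abs ger0_norm ?addr_ge0 ?proc_norm_ge0//.
move=> p e PPp e0; have ap := PP_admissible PPp; have [i pi] := pn_onto PPp.
have e2 : 0 < e / 2 by rewrite divr_gt0.
have [N HN] := thr_small e2; pose n := maxn N i.
have /YDP[_ /(YspaceP PP_admissible)[_ H]] := Yx n.
have [k Hk] := H p _ PPp e2; exists k.
apply: (@le_lt_trans _ _ (p (fun w => tail k (proc_norm T (x n)) w + proc_norm T (y - x n) w)%R)).
  apply: (adm_le ap); first exact/measurable_tail/measurable_proc_norm.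
    by apply: L1_add => //; exact: L1_tail.
  apply: ae_true => w; rewrite ger0_norm ?tail_ge0// ger0_norm; last first.
    by rewrite addr_ge0 ?tail_ge0 ?proc_norm_ge0.
  rewrite ge_max addr_ge0 ?tail_ge0 ?proc_norm_ge0// andbT proc_norm_abs.
  have : proc_norm T (x n) w - k%:R <= tail k (proc_norm T (x n)) w.
    by rewrite /tail le_max proc_norm_abs lexx.
  by have := tri n w; lra.
apply: (le_lt_trans (admD ap (L1_tail k (Lx n)) (L1_yx n))).
rewrite (splitr e) EFinD; apply: lteD => //.
rewrite -pi; apply: (le_lt_trans (qyx (leq_maxr N i))).
by rewrite lte_fin; exact: le_lt_trans (thr_anti (leq_maxl N i)) HN.
Qed.

(** The increments of the sequence are summable in the mean, hence almost surely in the
supremum norm, and the limit path is a uniform limit.  The estimates for the limit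
follow from lower semicontinuity of the seminorms along this convergence. *)
Lemma YD_fast_cauchy_limit : exists2 z, YD P T PP z &
  forall i n, (i <= n)%N -> (proc_seminorm T (pn i) (z - x n)%R <= (thr n)%:E)%E.
Proof. by exists y. Qed.

End Complete.

(** Choose points of the filter in sets that are small for the first n seminorms; they form
a fast Cauchy sequence, and the filter converges to its limit. *)
Lemma YD_complete (F : set_system (Omega -> \bar R -> R)) : countable PP -> PP !=set0 ->
  ProperFilter F -> F (YD P T PP) -> seminorm_cauchy PP (proc_seminorm T) F ->
  exists2 x, YD P T PP x & seminorm_nbhs PP (proc_seminorm T) (YD P T PP) x `<=` F.
Proof.
move=> cPP nPP FF FE FC.
have [pn [PPpn pn_onto]] := countable_enum cPP nPP.
pose thr n : R := 1 / (2 ^ n.+1)%:R.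
have thr0 n : 0 < thr n by rewrite /thr div1r invr_gt0 ltr0n expn_gt0.
have HB i n : exists A, F A /\ forall x y, A x -> A y ->
    (proc_seminorm T (pn i) (x - y)%R < (thr n)%:E)%E.
  by have [A FA HA] := FC (pn i) (thr n) (PPpn i) (thr0 n); exists A.
have /choice[B HB'] : forall ij : nat * nat, exists A, F A /\ forall x y, A x -> A y ->
    (proc_seminorm T (pn ij.1) (x - y)%R < (thr ij.2)%:E)%E by move=> ij; exact: HB.
(* only finitely many conditions are imposed at each stage *)
pose A n := YD P T PP `&` [set z | forall i, (i < n.+1)%N ->
  [set z | forall j, (j < n.+1)%N -> B (i, j) z] z].
have FA n : F (A n).
  apply: filterI => //; apply: filter_forall_lt => i; apply: filter_forall_lt => j.
  by have [] := HB' (i, j).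
have AB n m i : (i <= n)%N -> (n <= m)%N -> A m `<=` B (i, n).
  move=> le_in nm z [_]; apply; rewrite ltnS//.
  exact: leq_trans le_in nm.
have /choice[x xA] : forall n, exists x, A n x by move=> n; exact: filter_ex (FA n).
have Yx n : YD P T PP (x n) by have [] := xA n.
have Aq i n m z z' : (i <= n)%N -> (n <= m)%N -> A m z -> A n z' ->
    (proc_seminorm T (pn i) (z - z')%R < (thr n)%:E)%E.
  move=> le_in nm zA zA'; have [_ H] := HB' (i, n).
  by apply: H; [exact: AB nm _ zA|exact: AB (leqnn n) _ zA'].
have [//|y Yy Hy] := @YD_fast_cauchy_limit pn PPpn x Yx _ pn_onto.
  by move=> i n m le_in nm; apply: Aq nm _ _.
exists y => // N [J [e [JP fJ e0 HN]]].
have /choice[ix Hix] : forall p, exists i, PP p -> pn i = p.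
  move=> p; have [PPp|nP] := pselect (PP p); last by exists 0%N.
  by have [i pi] := pn_onto _ PPp; exists i.
have [M HM] := finite_set_bound ix fJ.
have [K HK] : exists K, thr K < e / 2.
  have e2 : 0 < e / 2 by rewrite divr_gt0.
  exists (Num.truncn (e / 2)^-1); rewrite /thr div1r -[ltRHS]invrK.
  rewrite ltf_pV2 ?posrE ?ltr0n ?expn_gt0 ?invr_gt0//.
  have ei : 0 <= (e / 2)^-1 by rewrite invr_ge0 ltW.
  have /andP[_] := truncn_itv ei; move=> /lt_le_trans; apply.
  by rewrite ler_nat ltnW// ltn_expl.
pose n := maxn M K.
have thrn : thr n < e / 2.
  apply: le_lt_trans HK; rewrite /thr !div1r lef_pV2 ?posrE ?ltr0n ?expn_gt0//.
  by rewrite ler_nat leq_exp2l// ltnS leq_maxr.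
apply: filterS (FA n) => z zA; have [Yz _] := zA.
apply: HN => // p Jp; have PPp := JP _ Jp; have ap := PP_admissible PPp.
have Mi : (ix p <= n)%N by rewrite (leq_trans (HM _ Jp))// leq_maxl.
have [cz _] := (YDP _).1 Yz; have [cxn _] := (YDP _).1 (Yx n).
have [cy _] := (YDP _).1 Yy.
have [[_ L1] _] := YDB Yz (Yx n); have [[_ L2] _] := YDB (Yx n) Yy.
apply: (le_lt_trans (q_triangle ap cz cxn cy L1 L2)).
rewrite (splitr e) EFinD; apply: lteD.
  rewrite -(Hix p PPp); apply: (lt_trans (Aq _ _ _ _ _ Mi (leqnn n) zA (xA n))).
  by rewrite lte_fin.
rewrite qB -(Hix p PPp); apply: (le_lt_trans (Hy _ _ Mi)).
by rewrite lte_fin.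
Qed.

Lemma YD_frechet : countable PP -> PP !=set0 ->
  frechet_mod PP (proc_seminorm T) (YD P T PP) (proc_null P T).
Proof.
move=> cPP nPP; split => //.
- apply/YDP; split; first exact/cadlag_process_rv/measurable_cst.
  apply: (Linf_Yspace PP_admissible); apply/LinfP; split.
    exact/measurable_proc_norm/cadlag_process_rv/measurable_cst.
  exists 0; apply: ae_true => w; rewrite proc_norm_abs.
  by apply: (proc_norm_le T0) => t _; rewrite normr0.
- by move=> a x y; exact: YD_lin.
- move=> p x PPp /YDP[cx Yx]; apply/andP; split.
    exact: (adm_ge0 (PP_admissible PPp) (Yspace_L1 PP_admissible Yx)).
  exact: Yspace_fin Yx PPp.
- by move=> p x y PPp [Lx _] [Ly _]; exact: qD (PP_admissible PPp) _ _ Lx Ly.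
- by move=> p a x PPp [Lx _]; exact: qZ (PP_admissible PPp) a _ Lx.
- move=> x [[cx Lx] _]; have [cx' _] := cx; split.
    move=> H; have [p PPp] := nPP; have ap := PP_admissible PPp.
    have [c c0 Hc] := adm_L1 ap.
    have := Hc _ Lx; rewrite [p _]H// mule0 => I0.
    have mx : measurable_fun setT (EFin \o proc_norm T x).
      exact/measurable_EFinP/measurable_proc_norm.
    have E0 : (\int[P]_w `|(EFin \o proc_norm T x) w| = 0)%E.
      by apply/eqP; rewrite eq_le integral_ge0// andbT; exact: I0.
    have := (ae_eq_integral_abs P measurableT mx).1 E0.
    apply: filterS => w /(_ I)[xw] t tT; apply/eqP; rewrite -normr_le0 -xw.
    exact: (le_path_norm T0 (cx' w) tT).
  move=> xN p PPp; have ap := PP_admissible PPp.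
  rewrite /proc_seminorm -(adm_0 ap); apply: (adm_eq ap) => //; first exact: L1_cst.
  apply: filterS xN => w xw; rewrite normr0 proc_norm_abs.
  apply/le_anti/andP; split; last exact: proc_norm_ge0.
  by apply: (proc_norm_le T0) => t tT; rewrite xw// normr0.
- by move=> F FF FE FC; exact: YD_complete.
Qed.

Definition clip (n : nat) y w t : R := truncate n (y w) t.

Lemma clip_process n y : cadlag_process T y -> cadlag_process T (clip n y).
Proof.
move=> cy; have C c : cadlag_process T (fun (_ : Omega) _ => c : R).
  exact/cadlag_process_rv/measurable_cst.
have N z : cadlag_process T z -> cadlag_process T (fun w t => (-1) * z w t).
  by apply: (@cadlag_processZ _ _ _ _ (fun=> -1)); exact: measurable_cst.
have := N _ (cadlag_process_min (C n%:R) (N _ (cadlag_process_min cy (C n%:R)))).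
congr cadlag_process; apply/funext => w; apply/funext => t.
by rewrite /clip /truncate !mulN1r oppr_min opprK.
Qed.

Lemma clip_le n y w t : `|clip n y w t| <= n%:R.
Proof. exact: truncate_le. Qed.

Lemma clipB n y w : cadlag T (y w) ->
  proc_norm T (clip n y - y) w <= tail n (proc_norm T y) w.
Proof.
move=> cy; apply: (proc_norm_le T0) => t tT; have yt := le_path_norm T0 cy tT.
have -> : (clip n y - y) w t = clip n y w t - y w t by [].
rewrite truncateB /tail proc_norm_abs ge_max !le_max lexx orbT andbT.
by rewrite lerB.
Qed.

Definition bounded_process y := cadlag_process T y /\
  exists M : R, forall w t, times T t -> `|y w t| <= M.

Lemma bounded_process_norm y : bounded_process y -> bounded_rv (proc_norm T y).
Proof.
move=> [cy [M HM]]; split; first exact: measurable_proc_norm.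
exists M => w; rewrite proc_norm_abs; apply: (proc_norm_le T0) => t tT; exact: HM.
Qed.

Lemma bounded_LinfD y : bounded_process y -> LinfD P T y.
Proof.
by move=> by_; split; [case: by_|exact/bounded_Linf/bounded_process_norm].
Qed.

Lemma bounded_YD y : bounded_process y -> YD P T PP y.
Proof. by move=> by_; exact/LinfD_YD/bounded_LinfD. Qed.

Lemma clip_bounded n y : cadlag_process T y -> bounded_process (clip n y).
Proof.
move=> cy; split; first exact: clip_process.
by exists n%:R => w t tT; exact: clip_le.
Qed.

Lemma bounded_process_dense y N : YD P T PP y ->
  seminorm_nbhs PP (proc_seminorm T) (YD P T PP) y N ->
  exists n, N (clip n y).
Proof.
move=> Yy [J [e [JP fJ e0 HN]]].
have [cy /(YspaceP PP_admissible)[Ly Hy]] := (YDP _).1 Yy.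
have /choice[nx Hnx] : forall p, exists n, PP p -> (p (tail n (proc_norm T y)) < e%:E)%E.
  move=> p; have [PPp|nP] := pselect (PP p); last by exists 0%N.
  by have [n Hn] := Hy p e PPp e0; exists n.
have [M HM] := finite_set_bound nx fJ.
exists M; apply: HN; first exact/bounded_YD/clip_bounded.
move=> p Jp; have PPp := JP _ Jp; have ap := PP_admissible PPp.
apply: le_lt_trans (Hnx p PPp); apply: (adm_le ap).
- exact/measurable_proc_norm/cadlag_processB/cy/clip_process.
- exact: L1_tail.
- apply: ae_true => w; rewrite proc_norm_abs ger0_norm ?tail_ge0//.
  apply: (le_trans (clipB _ _)); first by case: cy.
  exact: tail_anti (HM _ Jp).
Qed.

Lemma LinfD_dense : seminorm_dense PP (proc_seminorm T) (YD P T PP) (LinfD P T).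
Proof.
split; first exact: LinfD_YD.
move=> y Yy; split => // N /(bounded_process_dense Yy)[n Nn].
exists (clip n y); split => //; apply: bounded_LinfD; apply: clip_bounded.
by case: Yy => -[].
Qed.

End Frechet.

(** * Atoms, and modifications of a path before given times *)

Section Atoms.
Context {R : realType} (T : \bar R).
Hypothesis T0 : (0 < T)%E.
Implicit Types (u : smeasure (R := R)) (D : set (\bar R)) (t : \bar R).

Lemma countable_emeasurable D : countable D -> measurable D.
Proof. by apply: countable_measurable => t; exact: emeasurable_set1. Qed.

Lemma countable_charge_ge0 u D : countable D ->
  (forall t, D t -> (0 <= u [set t])%E) -> (0 <= u D)%E.
Proof.
move=> cD uD; have /countable_injP[g gi] := cD.
pose F n := [set t | D t /\ g t = n].
have F1 n : F n = set0 \/ exists2 t, D t & F n = [set t].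
  have [[t [Dt gt]]|nF] := pselect (exists t, F n t); last first.
    by left; apply/seteqP; split => // t Ft; apply: nF; exists t.
  right; exists t => //; apply/seteqP; split => [s [Ds gs]|s -> //].
  by apply: gi; rewrite ?gs//; exact/mem_set.
have mF n : measurable (F n).
  by have [->|[t _ ->]] := F1 n; [exact: measurable0|exact: emeasurable_set1].
have tF : trivIset setT F by move=> i j _ _ [t [[_ <-] [_ <-]]].
have DF : \bigcup_n F n = D.
  by apply/seteqP; split => [t [n _ []]//|t Dt]; exists (g t).
have mD : measurable (\bigcup_n F n) by rewrite DF; exact: countable_emeasurable.
have C := @charge_semi_sigma_additive _ _ _ u F mF tF mD; rewrite DF in C.
rewrite -(cvg_lim _ C)//; apply: lime_ge; first by apply/cvg_ex; exists (u D).
apply: nearW => n; apply: sume_ge0 => i _.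
by have [->|[t Dt ->]] := F1 i; rewrite ?charge0//; exact: uD.
Qed.

Lemma countable_charge_le0 u D : countable D ->
  (forall t, D t -> (u [set t] <= 0)%E) -> (u D <= 0)%E.
Proof.
move=> cD uD; have mD := countable_emeasurable cD.
have := @countable_charge_ge0 (copp u : smeasure) D cD.
rewrite /copp /= oppe_ge0; apply => t Dt.
by rewrite oppe_ge0 uD.
Qed.

Definition pos_atoms u : set (\bar R) := [set t | (0 < u [set t])%E].
Definition neg_atoms u : set (\bar R) := [set t | (u [set t] < 0)%E].

Lemma atoms_countable u : Mtilde T u -> countable (pos_atoms u `|` neg_atoms u).
Proof.
move=> [_ _ [C cC HC]]; apply: sub_countable cC; apply: subset_card_le.
move=> t ut; apply: contrapT => nCt.
have : u [set t] = 0%E.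
  apply: HC; first exact: emeasurable_set1.
  by apply/seteqP; split => // s [-> ].
by case: ut; rewrite /pos_atoms /neg_atoms /= => + ut0; rewrite ut0 ltxx.
Qed.

Lemma pos_atoms_measurable u : Mtilde T u -> measurable (pos_atoms u).
Proof.
move=> Mu; apply: countable_emeasurable; apply: sub_countable (atoms_countable Mu).
by apply: subset_card_le => t; left.
Qed.

Lemma neg_atoms_measurable u : Mtilde T u -> measurable (neg_atoms u).
Proof.
move=> Mu; apply: countable_emeasurable; apply: sub_countable (atoms_countable Mu).
by apply: subset_card_le => t; right.
Qed.

Definition atom_sign u t : R := Num.sg (fine (u [set t])).

Lemma atom_signE u : atom_sign u =
  fun t => \1_(pos_atoms u) t + (-1) * \1_(neg_atoms u) t.
Proof.
apply/funext => t; rewrite /atom_sign /pos_atoms /neg_atoms !indicE !mem_setb.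
have := charge_fin_num u (emeasurable_set1 t).
case: (u [set t]) => [r| |]//= _; rewrite ?lte_fin.
have [r0|r0|->] := ltgtP r 0; first by rewrite ltr0_sg// add0r mulr1.
  by rewrite gtr0_sg// mulr0 addr0.
by rewrite sgr0 mulr0 addr0.
Qed.

Lemma bm_atom_sign u : Mtilde T u -> bounded_measurable T (atom_sign u).
Proof.
move=> Mu; rewrite atom_signE; apply: bmD.
  exact/bm_indic/pos_atoms_measurable.
exact/bmZ/bm_indic/neg_atoms_measurable.
Qed.

(** A purely atomic measure is carried by its atoms, where it has constant sign. *)
Lemma sintegral_atom_sign u : Mtilde T u -> tv_norm u = sintegral T u (atom_sign u).
Proof.
move=> Mu; have [Ms _ [C cC HC]] := Mu.
have mA := pos_atoms_measurable Mu; have mB := neg_atoms_measurable Mu.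
have mC := countable_emeasurable cC.
have bs := bm_atom_sign Mu; apply/eqP; rewrite eq_le; apply/andP; split; last first.
  have := @sintegral_le _ T u (atom_sign u) 1 bs ler01.
  rewrite mul1r => H; apply: le_trans (ler_norm _) (H _) => t _.
  by rewrite normr_sg; case: (_ != 0).
rewrite atom_signE sintegralD; first last.
- exact/bmZ/bm_indic.
- exact/bm_indic.
rewrite sintegralZ ?sintegral_indic//; last exact/bm_indic.
set P := (projT1 (cid (hahn_ex u))).1; set N := (projT1 (cid (hahn_ex u))).2.
have mP : measurable P := hahn_pos_measurable u.
have mN : measurable N := hahn_neg_measurable u.
have -> : tv_norm u = fine (u P) - fine (u N).
  rewrite /tv_norm /charge_variation fineD ?fin_num_measure//.
  by rewrite jordan_posI// jordan_negI// !setTI fineN.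
have sumE A B : measurable A -> measurable B -> u A = (u (A `&` B) + u (A `\` B))%E.
  move=> mA' mB'; rewrite -chargeU; [by rewrite setUIDK|exact: measurableI|exact: measurableD|].
  by apply/seteqP; split => // t [[_ ?] []].
have C0 A : measurable A -> u (A `\` C) = 0%E.
  move=> mA'; apply: HC; first exact: measurableD.
  by apply/seteqP; split => // t [[]].
have subC (D : set (\bar R)) : D `<=` C -> countable D.
  by move=> DC; apply: sub_countable cC; exact: subset_card_le.
have fn A : measurable A -> u A \is a fin_num by move=> ?; exact: fin_num_measure.
have AC : pos_atoms u `<=` C.
  move=> t; rewrite /pos_atoms /= => ut; apply: contrapT => nCt; move: ut.
  have sC : [set t] `&` C = set0 by apply/seteqP; split => // s [-> ].
  by rewrite (HC _ (emeasurable_set1 t) sC) ltxx.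
have BC : neg_atoms u `<=` C.
  move=> t; rewrite /neg_atoms /= => ut; apply: contrapT => nCt; move: ut.
  have sC : [set t] `&` C = set0 by apply/seteqP; split => // s [-> ].
  by rewrite (HC _ (emeasurable_set1 t) sC) ltxx.
have mPC : measurable (P `&` C) by exact: measurableI.
have mNC : measurable (N `&` C) by exact: measurableI.
have H1 : (u P <= u (pos_atoms u))%E.
  rewrite (sumE _ _ mP mC) C0// adde0 (sumE _ _ mPC mA) (sumE _ _ mA mPC).
  rewrite [pos_atoms u `&` _]setIC leeD2l//.
  apply: (@le_trans _ _ 0%E).
    apply: countable_charge_le0; first by apply: subC => t [[]].
    by move=> t [_]; rewrite /pos_atoms /= => /negP; rewrite -leNgt.
  apply: countable_charge_ge0; first by apply: subC => t [/AC].
  by move=> t [/ltW].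
have H2 : (u (neg_atoms u) <= u N)%E.
  rewrite (sumE _ _ mN mC) C0// adde0 (sumE _ _ mNC mB) (sumE _ _ mB mNC).
  rewrite [neg_atoms u `&` _]setIC leeD2l//.
  apply: (@le_trans _ _ 0%E).
    apply: countable_charge_le0; first by apply: subC => t [/BC].
    by move=> t [/ltW].
  apply: countable_charge_ge0; first by apply: subC => t [[]].
  by move=> t [_]; rewrite /neg_atoms /= => /negP; rewrite -leNgt.
have := fine_le (fn _ mP) (fn _ mA) H1; have := fine_le (fn _ mB) (fn _ mN) H2.
by lra.
Qed.

Lemma sintegral_off_atoms u (f : \bar R -> R) : Mtilde T u -> bounded_measurable T f ->
  (forall t, u [set t] != 0%E -> f t = 0) -> sintegral T u f = 0.
Proof.
move=> Mu bf f0; have bs := bm_atom_sign Mu; have [_ [M HM]] := bf.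
pose c := Num.max M 1; have c0 : 0 < c by rewrite lt_max ltr01 orbT.
have fc t : times T t -> `|c^-1 * f t| <= 1.
  move=> tT; rewrite normrM ger0_norm ?invr_ge0 ?(ltW c0)//.
  by rewrite ler_pdivrMl// mulr1 (le_trans (HM _ tT))// le_max lexx.
have H (a : R) : `|a| <= 1 -> sintegral T u (atom_sign u) + a * (c^-1 * sintegral T u f)
    <= sintegral T u (atom_sign u).
  move=> a1; rewrite -[leRHS](sintegral_atom_sign Mu) -[leRHS]mul1r.
  rewrite -!sintegralZ//; last exact: bmZ.
  rewrite -sintegralD//; last exact/bmZ/bmZ.
  apply: (le_trans (ler_norm _)); apply: sintegral_le => //.
    by apply: bmD => //; exact/bmZ/bmZ.
  move=> t tT; have [ut0|ut0] := eqVneq (u [set t]) 0%E.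
    by rewrite /atom_sign ut0 sgr0 add0r normrM mulr_ile1// fc.
  by rewrite f0// !mulr0 addr0 normr_sg; case: (_ != 0).
have H1 := H 1 _; have H2 := H (-1) _; rewrite normrN normr1 in H1 H2.
have := H1 (lexx _); have := H2 (lexx _).
have ci : 0 < c^-1 by rewrite invr_gt0.
have E : c^-1 * sintegral T u f = 0 -> sintegral T u f = 0.
  by move=> /eqP; rewrite mulf_eq0 gt_eqF//= => /eqP.
by move=> h1 h2; apply: E; lra.
Qed.

Lemma jordan_atom u t : Mspace T u -> u [set t] != 0%E ->
  (0 < qmeasure T (npos T u) (mpos T u) [set t])%E \/
  (0 < qmeasure T (nneg T u) (mneg T u) [set t])%E.
Proof.
move=> Mu; rewrite (jordan_qmeasure T0 Mu (emeasurable_set1 t)) => ut.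
apply: contrapT => /not_orP[/negP + /negP]; rewrite -!leNgt => h1 h2.
have E1 : qmeasure T (npos T u) (mpos T u) [set t] = 0%E.
  by apply/eqP; rewrite eq_le h1 measure_ge0.
have E2 : qmeasure T (nneg T u) (mneg T u) [set t] = 0%E.
  by apply/eqP; rewrite eq_le h2 measure_ge0.
by move: ut; rewrite E1 E2 sube0 eqxx.
Qed.

End Atoms.

Section Override.
Context {R : realType} (T : \bar R).
Hypothesis T0 : (0 < T)%E.
Implicit Types (s t : \bar R) (f : \bar R -> R).

(** Indicator of the interval [r, s[, where r is the last grid point before s.  As the grid
is refined it tends to 0 at every time, whereas its left limit at s is always 1: this
separates a path from its left limits. *)
Definition before n s t : R := step (lgrid T n s) t - step s t.

Lemma lgrid_le n s : (0 <= s)%E -> (lgrid T n s <= s)%E.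
Proof. by move=> s0; apply: bigmax_le => // k /ltW. Qed.

Lemma before_01 n s t : (0 <= s)%E -> before n s t = 0 \/ before n s t = 1.
Proof.
move=> s0; have ls := lgrid_le n s0; rewrite /before /step.
have [lt|tl] := leP (lgrid T n s) t; have [st|ts] := leP s t; rewrite ?subrr ?subr0; auto.
by have := le_lt_trans (le_trans ls st) tl; rewrite ltxx.
Qed.

Lemma cadlag_before n s : cadlag T (before n s).
Proof.
apply: (@cadlag_ext _ _ (fun t => step (lgrid T n s) t + (-1) * step s t)).
  by move=> t _; rewrite mulN1r.
by apply: cadlagD; [exact: cadlag_step|apply: cadlagZ; exact: cadlag_step].
Qed.

Lemma before_near s t : times T s -> times T t -> \forall n \near \oo, before n s t = 0.
Proof.
move=> /andP[s0 sT] /andP[t0 tT]; have [st|ts] := leP s t.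
  apply: nearW => n; rewrite /before /step st.
  by rewrite (le_trans (lgrid_le n s0) st) subrr.
have := @lgrid_near _ _ T0 t s ts; rewrite sT (le_lt_trans t0 ts) => /(_ isT).
apply: filterS => n tl; rewrite /before /step.
by rewrite !leNgt tl ts subrr.
Qed.

Lemma left_lim_before n s t : (0 < t <= T)%E ->
  left_lim (before n s) t = (lgrid T n s < t)%E%:R - (s < t)%E%:R.
Proof.
move=> /[dup] tT /andP[t0 _].
transitivity (left_lim (fun r => step (lgrid T n s) r + (-1) * step s r) t).
  by congr left_lim; apply/funext => r; rewrite mulN1r.
rewrite (left_limD (cadlag_step T _) (cadlagZ (-1) (cadlag_step T s)) tT).
by rewrite (left_limZ _ (cadlag_step T s) tT) !left_lim_step// mulN1r.
Qed.

Lemma left_lim_before_near s t : times T s -> (0 < t <= T)%E ->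
  \forall n \near \oo, left_lim (before n s) t = (t == s)%:R.
Proof.
move=> /andP[s0 sT] /[dup] tT /andP[t0 t1].
have [st|ts|<-] := ltgtP t s.
- have := @lgrid_near _ _ T0 t s st; rewrite sT (lt_trans t0 st) => /(_ isT).
  apply: filterS => n tl; rewrite left_lim_before//.
  by rewrite !ltNge (ltW tl) (ltW st) subrr.
- apply: nearW => n; rewrite left_lim_before// ts.
  by rewrite (le_lt_trans (lgrid_le n s0) ts) subrr.
- apply: nearW => n; rewrite left_lim_before// ltxx subr0.
  by have /andP[_ ->] := lgrid_lt T0 n tT.
Qed.

(** Insert the value [g j] on a short interval before the time [s j].  In the limit of fine
grids only the left limits at these times change, to those given by [override_left]. *)
Fixpoint override n (s : nat -> \bar R) (g : nat -> R) f k t : R :=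
  if k is k'.+1 then
    override n s g f k' t + before n (s k') t * (g k' - override n s g f k' t)
  else f t.

Fixpoint override_left (s : nat -> \bar R) (g : nat -> R) (l : \bar R -> R) k t : R :=
  if k is k'.+1 then if t == s k' then g k' else override_left s g l k' t else l t.

Variables (s : nat -> \bar R) (g : nat -> R).
Hypothesis sT : forall k, times T (s k).
Hypothesis g1 : forall k, `|g k| <= 1.

Lemma cadlag_override n f k : cadlag T f -> cadlag T (override n s g f k).
Proof.
move=> cf; elim: k => [//|k IH] /=.
apply: (cadlagD IH); apply: cadlagM; first exact: cadlag_before.
apply: (@cadlag_ext _ _ (fun t => g k + (-1) * override n s g f k t)).
  by move=> t _; rewrite mulN1r.
by apply: cadlagD; [exact: cadlag_cst|exact: cadlagZ].
Qed.

Lemma override_le1 n f k t : (forall r, times T r -> `|f r| <= 1) -> times T t ->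
  `|override n s g f k t| <= 1.
Proof.
move=> f1 tT; elim: k => [|k IH] /=; first exact: f1.
have s0 : (0 <= s k)%E by case/andP: (sT k).
have [->|->] := before_01 n t s0; first by rewrite mul0r addr0.
by rewrite mul1r addrC subrK.
Qed.

Lemma override_near f k t : times T t -> \forall n \near \oo, override n s g f k t = f t.
Proof.
move=> tT; elim: k => [|k IH] /=; first exact: nearW.
apply: filterS2 IH (before_near (sT k) tT) => n -> ->.
by rewrite mul0r addr0.
Qed.

Lemma left_override_near f k t : cadlag T f -> (0 < t <= T)%E ->
  \forall n \near \oo, left_lim (override n s g f k) t = override_left s g (left_lim f) k t.
Proof.
move=> cf tT; elim: k => [|k IH] /=; first exact: nearW.
apply: filterS2 IH (left_lim_before_near (sT k) tT) => n IH b.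
have co := cadlag_override n k cf.
have cd : cadlag T (fun r => g k + (-1) * override n s g f k r).
  by apply: cadlagD; [exact: cadlag_cst|exact: cadlagZ].
transitivity (left_lim (fun r => override n s g f k r +
    before n (s k) r * (g k + (-1) * override n s g f k r)) t).
  by congr left_lim; apply/funext => r /=; rewrite mulN1r.
rewrite (left_limD co (cadlagM (cadlag_before n (s k)) cd) tT).
rewrite (left_limM (cadlag_before n (s k)) cd tT).
rewrite (left_limD (cadlag_cst T (g k)) (cadlagZ (-1) co) tT).
rewrite (left_limZ (-1) co tT) (left_lim_cst (g k)); last by case/andP: tT.
rewrite b IH; case: (t == s k); last by rewrite mul0r addr0.
by rewrite mul1r mulN1r addrC subrK.
Qed.

End Override.

(** * A process of signs *)

Section AtomTimes.
Context {R : realType} {d : measure_display} {Omega : measurableType d}.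
Variable T : \bar R.
Hypothesis T0 : (0 < T)%E.
Implicit Types (u : Omega -> smeasure (R := R)) (xi : Omega -> R).

Lemma measurable_sg xi : measurable_fun setT xi -> measurable_fun setT (fun w => Num.sg (xi w)).
Proof.
move=> mxi.
rewrite (_ : (fun w => _) = fun w => \1_[set w | 0 < xi w] w - \1_[set w | xi w < 0] w).
  apply: measurable_funB; apply: measurable_indic; apply: measurable_ltr_set => //;
    exact: measurable_cst.
apply/funext => w; rewrite !indicE !mem_setb.
have [x0|x0|->] := ltgtP (xi w) 0; first by rewrite ltr0_sg// sub0r.
  by rewrite gtr0_sg// subr0.
by rewrite sgr0 subr0.
Qed.

Lemma measurable_npos u t : random_measure u -> (forall w, Mspace T (u w)) ->
  measurable_fun setT (fun w => npos T (u w) t) /\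
  measurable_fun setT (fun w => nneg T (u w) t).
Proof.
move=> mu Mu.
have H (s : R -> R) : (forall f : Omega -> R, measurable_fun setT f ->
    measurable_fun setT (fun w => s (f w))) ->
    forall n, measurable_fun setT (fun w => cell_sum T s (u w) n t).
  move=> ms n; apply: measurable_sum => k; apply: measurable_funM => //.
  by apply: ms; apply: random_measure_fine => //; exact: measurable_cell.
split; [apply: (@measurable_fun_cvg _ _ _ _ (fun n w => cell_sum T posp (u w) n t))|
        apply: (@measurable_fun_cvg _ _ _ _ (fun n w => cell_sum T negp (u w) n t))].
- by apply: H => f mf; exact: measurable_maxr.
- by move=> w _; exact: npos_cvg.
- by apply: H => f mf; apply: measurable_maxr => //; exact: measurableT_comp.
- by move=> w _; exact: nneg_cvg.
Qed.

(** Quantiles at rational levels of the two parts of the measure: a measurable enumeration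
of times that contains all the atoms, by [qmeasure_atom]. *)
Definition atom_time u (j : nat) (w : Omega) : \bar R :=
  if @unpickle (bool * rat)%type j is Some br then
    quantile T (if br.1 then npos T (u w) else nneg T (u w)) (ratr br.2)
  else 0%E.

Lemma atom_time_times u j w : times T (atom_time u j w).
Proof.
by rewrite /atom_time; case: unpickle => [br|]; [exact: quantile_times|exact: times0].
Qed.

Lemma measurable_atom_time u j : random_measure u -> (forall w, Mspace T (u w)) ->
  measurable_fun setT (atom_time u j).
Proof.
move=> mu Mu; rewrite /atom_time; case: unpickle => [[b r]|]; last exact: measurable_cst.
by case: b; apply: measurable_quantile => // n k;
  have [] := measurable_npos (grid T n k) mu Mu.
Qed.

Lemma atom_time_onto u w t : Mspace T (u w) -> u w [set t] != 0%E ->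
  exists j, atom_time u j w = t.
Proof.
move=> Mu /(jordan_atom T0 Mu)[] /qmeasure_atom[r rt].
  by exists (pickle (true, r)); rewrite /atom_time pickleK.
by exists (pickle (false, r)); rewrite /atom_time pickleK.
Qed.

Lemma left_path_step s t : times T s -> times T t -> left_path (step s) t = (s < t)%E%:R :> R.
Proof.
move=> /andP[s0 _] /andP[t0 _]; rewrite /left_path; have [->|t1] := eqVneq t 0%E.
  by rewrite ltNge s0.
by rewrite left_lim_step// lt_def t1.
Qed.

Lemma sintegral_step_jump (m : smeasure) s : Mspace T m -> times T s ->
  sintegral T m (step s) - sintegral T m (left_path (step s)) = fine (m [set s]).
Proof.
move=> Mm sT; rewrite -(sintegral_indic Mm (emeasurable_set1 s)).
have cs : cadlag T (step s : \bar R -> R) by exact: cadlag_step.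
rewrite -[X in _ - X]mul1r -mulNr -sintegralZ; last exact: bm_left_path.
rewrite -sintegralD; [|exact: bm_cadlag|exact/bmZ/bm_left_path].
apply: eq_sintegral => t tT; rewrite left_path_step// /step indicE in_set1.
by case: (ltgtP s t) => _ /=; lra.
Qed.

Lemma measurable_mass_at u (s : Omega -> \bar R) : random_measure u ->
  (forall w, Mspace T (u w)) -> measurable_fun setT s -> (forall w, times T (s w)) ->
  measurable_fun setT (fun w => fine (u w [set s w])).
Proof.
move=> mu Mu ms sT.
rewrite (_ : (fun w => _) = fun w => sintegral T (u w) (step (s w)) -
   sintegral T (u w) (left_path (step (s w)))).
  have cs := @cadlag_process_step R d Omega T s ms.
  apply: measurable_funB.
    exact: (@measurable_sintegral _ _ _ T T0 (fun w => step (s w))).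
  exact: (@measurable_sintegral_left_path _ _ _ T T0 (fun w => step (s w))).
by apply/funext => w; rewrite sintegral_step_jump.
Qed.

Definition atom_rate u j w : R := atom_sign (u w) (atom_time u j w).

Lemma measurable_atom_rate u j : random_measure u -> (forall w, Mspace T (u w)) ->
  measurable_fun setT (atom_rate u j).
Proof.
move=> mu Mu; apply: measurable_sg; apply: measurable_mass_at => //.
  exact: measurable_atom_time.
by move=> w; exact: atom_time_times.
Qed.

Lemma sg_le1 (x : R) : `|Num.sg x| <= 1.
Proof. by rewrite normr_sg; case: (x != 0). Qed.

Lemma override_left_eq (s : nat -> \bar R) (g : nat -> R) (l : \bar R -> R) k i t c :
  (i < k)%N -> s i = t -> (forall j, s j = t -> g j = c) -> override_left s g l k t = c.
Proof.
elim: k => [//|k IH] ik si H /=; have [tk|tk] := eqVneq t (s k); first exact: H.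
apply: IH => //; move: ik; rewrite ltnS leq_eqVlt => /predU1P[ik|//].
by rewrite -ik si eqxx in tk.
Qed.

Variable v : @rmpair R d Omega.
Hypothesis av : admissible_pair T v.

Let base n w := cellfun T n (fun k => Num.sg (fine (v.1 w (cell T n k))))
  (Num.sg (fine (v.1 w [set T]))).

Let s w j := atom_time v.2 j w.
Let g w j := atom_rate v.2 j w.

(** Close to the signs of the two measures: to that of the first one on grid cells, and to
that of the second one just before its atoms. *)
Definition sign_process n m w : \bar R -> R := override T m (s w) (g w) (base n w) n.

Let Mv1 w : Mspace T (v.1 w). Proof. by have [_ _ /(_ w)[]] := av. Qed.
Let Mv2 w : Mtilde T (v.2 w). Proof. by have [_ _ /(_ w)[]] := av. Qed.
Let Ms2 w : Mspace T (v.2 w). Proof. by have [] := Mv2 w. Qed.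
Let rv1 : random_measure v.1. Proof. by have [] := av. Qed.
Let rv2 : random_measure v.2. Proof. by have [] := av. Qed.
Let sT w j : times T (s w j). Proof. exact: atom_time_times. Qed.
Let g1 w j : `|g w j| <= 1. Proof. exact: sg_le1. Qed.

Let base1 n w t : times T t -> `|base n w t| <= 1.
Proof. by apply: cellfun_le => // [k _|]; exact: sg_le1. Qed.

Let base_cadlag n w : cadlag T (base n w).
Proof. exact: cadlag_cellfun. Qed.

Let base_process n : cadlag_process T (base n).
Proof.
split; first by move=> w; exact: base_cadlag.
apply: measurable_funTS; rewrite /base /cellfun.
have mfst (f : Omega -> R) : measurable_fun setT f ->
    measurable_fun setT (fun z : Omega * \bar R => f z.1).
  by move=> mf; exact: (measurableT_comp mf).
have msnd (A : set (\bar R)) : measurable A ->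
    measurable_fun setT (fun z : Omega * \bar R => \1_A z.2 : R).
  move=> mA; have m1 : measurable_fun setT (\1_A : \bar R -> R) by exact: measurable_indic.
  exact: (measurableT_comp m1).
apply: measurable_funD.
  apply: (@measurable_sum _ _ _ _ _ (fun (k : 'I_(2 ^ n)) (z : Omega * \bar R) =>
    Num.sg (fine (v.1 z.1 (cell T n k))) * \1_(cell T n k) z.2)) => k.
  apply: measurable_funM; last by apply: msnd; exact: measurable_cell.
  apply: (mfst (fun w => Num.sg (fine (v.1 w (cell T n k))))).
  by apply: measurable_sg; apply: random_measure_fine => //; exact: measurable_cell.
apply: measurable_funM; last by apply: msnd; exact: emeasurable_set1.
apply: (mfst (fun w => Num.sg (fine (v.1 w [set T])))).
by apply: measurable_sg; apply: random_measure_fine => //; exact: emeasurable_set1.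
Qed.

Let measurable_lgrid m (f : Omega -> \bar R) : measurable_fun setT f ->
  measurable_fun setT (fun w => lgrid T m (f w)).
Proof.
move=> mf; apply: (measurability _ (ErealGenInftyO.measurableE R)) => _ /= -[_ [r ->] <-].
rewrite setTI (_ : _ @^-1` _ = [set w | (0 < r%:E)%E] `&`
    \bigcap_(k in [set k | (k < 2 ^ m)%N]) [set w | (grid T m k < f w)%E -> (grid T m k < r%:E)%E]).
  apply: measurableI.
    have [r0|r0] := boolP (0 < r%:E)%E.
      by rewrite (_ : [set _ | _] = setT)//; apply/seteqP; split.
    by rewrite (_ : [set _ | _] = set0)//; apply/seteqP; split.
  apply: bigcap_measurable; first by exists 0%N; rewrite /mkset expn_gt0.
  move=> k _; have [gr|gr] := boolP (grid T m k < r%:E)%E.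
    by rewrite (_ : [set _ | _] = setT)//; apply/seteqP; split.
  rewrite (_ : [set _ | _] = [set w | (f w <= grid T m k)%E]).
    by apply: measurable_lee_set => //; exact: measurable_cst.
  apply/seteqP; split => w /=; first by move=> H; rewrite leNgt; apply/negP => /H.
  by rewrite leNgt => /negP H /H.
apply/seteqP; split => w /=; rewrite in_itv/=.
  by move=> /bigmax_ltP[r0 H]; split => // k /= km kf; exact: (H (Ordinal km)).
by move=> [r0 H]; apply/bigmax_ltP; split => // k kf; apply: (H k) => //=.
Qed.

Lemma sign_process_cadlag n m : cadlag_process T (sign_process n m).
Proof.
rewrite /sign_process; elim: {2}n => [|j IH]; first exact: base_process.
have C := @cadlag_process_rv R d Omega T.
have N (y : Omega -> \bar R -> R) : cadlag_process T y -> cadlag_process T (fun w t => - y w t).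
  move=> cy; rewrite (_ : (fun _ _ => _) = fun w t => (-1) * y w t).
    by apply: (@cadlag_processZ _ _ _ _ (fun=> -1)) => //; exact: measurable_cst.
  by apply/funext => w; apply/funext => t; rewrite mulN1r.
have ms : measurable_fun setT (s ^~ j) by exact: measurable_atom_time.
rewrite /=; apply: cadlag_processD => //; apply: cadlag_processM.
  apply: cadlag_processD; last exact/N/cadlag_process_step.
  exact/cadlag_process_step/measurable_lgrid.
apply: cadlag_processD; last exact: N.
by apply: C; exact: measurable_atom_rate.
Qed.

Lemma sign_process_le1 n m w t : times T t -> `|sign_process n m w t| <= 1.
Proof. by move=> tT; apply: override_le1 => // r rT; exact: base1. Qed.

Let ol n w t : R :=
  if t == 0%E then 0 else override_left (s w) (g w) (left_lim (base n w)) n t.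

Let h n w := sintegral T (v.1 w) (base n w) + sintegral T (v.2 w) (ol n w).

Let ol_cvg n w : bounded_measurable T (ol n w) /\
  sintegral T (v.2 w) (left_path (sign_process n m w)) @[m --> \oo] -->
  sintegral T (v.2 w) (ol n w).
Proof.
have cS m : cadlag T (sign_process n m w) by case: (sign_process_cadlag n m).
apply: (@sintegral_dct _ T T0 _ _ _ 1).
- by move=> m; exact: bm_left_path.
- by move=> m t tT; apply: left_path_le => // r rT; exact: sign_process_le1.
- move=> t /andP[t0 tT]; rewrite /left_path /ol; have [_|t1] := eqVneq t 0%E.
    exact: cvg_cst.
  have tT' : (0 < t <= T)%E by rewrite tT andbT lt_def t1.
  by apply: cvg_near_cst; exact: left_override_near.
Qed.

Let sign_process_cvg n w : path_pairing T (sign_process n m) v w @[m --> \oo] --> h n w.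
Proof.
have cS m : cadlag T (sign_process n m w) by case: (sign_process_cadlag n m).
rewrite (_ : (fun m => _) = fun m => sintegral T (v.1 w) (sign_process n m w) +
    sintegral T (v.2 w) (left_path (sign_process n m w))); last first.
  by apply/funext => m; rewrite path_pairingE.
apply: cvgD; last by have [] := ol_cvg n w.
apply: (@sintegral_dct _ T T0 _ _ _ 1 _ _ _).2.
- by move=> m; exact: bm_cadlag.
- by move=> m t tT; exact: sign_process_le1.
- by move=> t tT; apply: cvg_near_cst; exact: override_near.
Qed.

Let sign_pairing_cvg w : h n w @[n --> \oo] --> pair_norm v w.
Proof.
apply: cvgD.
  rewrite (_ : (fun n => _) = tvar T (v.1 w)); first exact: tvar_cvg.
  apply/funext => n; rewrite /base sintegral_cellfun// /tvar -normrEsg.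
  by congr (_ + _); apply: eq_bigr => k _; rewrite -normrEsg.
set a := atom_sign (v.2 w).
have ba : bounded_measurable T a := bm_atom_sign (Mv2 w).
have bM (f f' : \bar R -> R) : bounded_measurable T f -> bounded_measurable T f' ->
    bounded_measurable T (fun t => f t * f' t).
  move=> [mf [M HM]] [mf' [M' HM']]; split; first exact: measurable_funM.
  by exists (M * M') => t tT; rewrite normrM ler_pM ?HM ?HM'.
have bo n : bounded_measurable T (ol n w) by have [] := ol_cvg n w.
have a1 t : `|a t| <= 1 by exact: sg_le1.
have ol1 n t : times T t -> `|ol n w t| <= 1.
  move=> /andP[t0 tT]; rewrite /ol; have [_|t1] := eqVneq t 0%E; first by rewrite normr0.
  have tT' : (0 < t <= T)%E by rewrite tT andbT lt_def t1.
  elim: {2}n => [|k IH] /=; last by case: ifP.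
  by apply: left_lim_le => // r rT; exact: base1.
rewrite (_ : (fun n => _) = fun n => sintegral T (v.2 w) (fun t => ol n w t * (a t * a t))).
  rewrite (sintegral_atom_sign (Mv2 w)).
  apply: (@sintegral_dct _ T T0 _ _ _ 1 _ _ _).2.
  - by move=> n; apply: (bM) => //; exact: bM.
  - move=> n t tT; rewrite normrM mulr_ile1 ?ol1// normrM mulr_ile1//.
  - move=> t tT; have [ut0|ut] := eqVneq (v.2 w [set t]) 0%E.
      rewrite -/a /a /atom_sign ut0 sgr0; under eq_fun do rewrite !mulr0.
      exact: cvg_cst.
    have [i it] := atom_time_onto (Ms2 w) ut.
    have t0 : t != 0%E.
      by apply/eqP => t0; move: ut; rewrite t0; have [_ -> _] := Mv2 w; rewrite eqxx.
    apply: cvg_near_cst; exists i.+1 => // n /= ni; rewrite /ol (negbTE t0).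
    rewrite (@override_left_eq _ _ _ _ i _ (a t))//; last first.
      by move=> j jt; rewrite /g /atom_rate -/(s w j) jt.
    have fu : v.2 w [set t] = (fine (v.2 w [set t]))%:E.
      by rewrite fineK//; apply: charge_fin_num; exact: emeasurable_set1.
    have : fine (v.2 w [set t]) != 0 by apply: contra_neq ut => ut; rewrite fu ut.
    by rewrite /a /atom_sign -expr2 sqr_sg => ->; rewrite mulr1.
apply/funext => n; apply/eqP; rewrite -subr_eq0; apply/eqP.
rewrite -[X in _ - X]mul1r -mulNr -sintegralZ; last by apply: (bM) => //; exact: bM.
rewrite -sintegralD//; last by apply/bmZ/bM => //; exact: bM.
apply: (sintegral_off_atoms (Mv2 w)).
  by apply: bmD => //; apply/bmZ/bM => //; exact: bM.
move=> t ut; have fu : v.2 w [set t] = (fine (v.2 w [set t]))%:E.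
  by rewrite fineK//; apply: charge_fin_num; exact: emeasurable_set1.
have ft : fine (v.2 w [set t]) != 0 by apply: contra_neq ut => ut; rewrite fu ut.
by rewrite /a /atom_sign -expr2 sqr_sg ft mulr1 mulN1r subrr.
Qed.

(** As m grows, the values inserted before the atoms become invisible to the first measure;
as n grows, the signs on the cells exhaust the variation of the first measure and the
enumeration exhausts the atoms of the second one. *)
Lemma sign_pairing_limits : exists l : nat -> Omega -> R,
  (forall n w, path_pairing T (sign_process n m) v w @[m --> \oo] --> l n w) /\
  forall w, l n w @[n --> \oo] --> pair_norm v w.
Proof. by exists h; split=> [n w|w]; [exact: sign_process_cvg|exact: sign_pairing_cvg]. Qed.

End AtomTimes.

(** * Expectations and polars *)

Section Expectation.
Context {R : realType} {d : measure_display} {Omega : measurableType d}.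
Variable P : probability Omega R.
Implicit Types (xi eta f g : Omega -> R).

Definition mean f : R := \int[P]_w f w.

Lemma meanE f : L1 P f -> 'E_P[f]%E = (mean f)%:E.
Proof.
by move=> /L1P fi; rewrite unlock /mean /Rintegral fineK//; exact: integrable_fin_num.
Qed.

Lemma mean_ge0 f : (forall w, 0 <= f w) -> 0 <= mean f.
Proof. by move=> f0; exact: Rintegral_ge0. Qed.

Lemma mean_lin (a : R) f g : L1 P f -> L1 P g ->
  mean (fun w => a * f w + g w) = a * mean f + mean g.
Proof.
move=> Lf Lg; rewrite /mean RintegralD//; [|exact/L1P/L1Z|exact/L1P].
by rewrite RintegralZl//; exact/L1P.
Qed.

Lemma mean_cst (c : R) : mean (fun=> c) = c.
Proof. by rewrite /mean Rintegral_cst//= probability_setT mulr1. Qed.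

Lemma mean_ae_le f g : L1 P f -> L1 P g -> {ae P, forall w, f w <= g w} -> mean f <= mean g.
Proof.
move=> Lf Lg fg; rewrite -subr_ge0.
have -> : mean g - mean f = mean (fun w => (-1) * f w + g w).
  by rewrite mean_lin// mulN1r addrC.
have L : L1 P (fun w => (-1) * f w + g w) by apply: L1_add => //; exact: L1Z.
apply: fine_ge0.
rewrite (@ae_eq_integral _ _ _ _ _ (fun w => `|(-1) * f w + g w|%:E))//.
- by apply: integral_ge0 => w _; rewrite lee_fin.
- by apply/measurable_EFinP; exact: L1_measurable L.
- by apply/measurable_EFinP/measurableT_comp => //; exact: L1_measurable L.
- apply: filterS fg => w fg _; rewrite mulN1r ger0_norm//.
  by rewrite addrC subr_ge0.
Qed.

Lemma mean_le f g : L1 P f -> L1 P g -> (forall w, f w <= g w) -> mean f <= mean g.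
Proof. by move=> Lf Lg fg; apply: mean_ae_le => //; exact: ae_true. Qed.

Lemma mean_ae_eq f g : L1 P f -> L1 P g -> {ae P, forall w, f w = g w} -> mean f = mean g.
Proof.
move=> Lf Lg fg; apply/eqP; rewrite eq_le; apply/andP; split; apply: mean_ae_le => //;
  by apply: filterS fg => w ->.
Qed.

Lemma mean_norm f : L1 P f -> `|mean f| <= mean (fun w => `|f w|).
Proof. by move=> /L1P Lf; exact: le_normr_Rintegral. Qed.

Lemma mean_eq0 f : L1 P f -> (forall w, 0 <= f w) -> mean f = 0 -> {ae P, forall w, f w = 0}.
Proof.
move=> Lf f0 mf; have : (\int[P]_w `|(f w)%:E| = 0)%E.
  rewrite -[RHS]/(0%:E) -mf /mean /Rintegral fineK; last exact/integrable_fin_num/L1P.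
  by apply: eq_integral => w _; rewrite gee0_abs// lee_fin.
have mf' : measurable_fun setT (EFin \o f) by apply/measurable_EFinP; exact: L1_measurable Lf.
move=> /(ae_eq_integral_abs P measurableT mf').1.
by apply: filterS => w /(_ I)/= [].
Qed.

Lemma mean_dct (F : nat -> Omega -> R) f g : (forall n, measurable_fun setT (F n)) ->
  L1 P g -> (forall n w, `|F n w| <= g w) -> (forall w, F n w @[n --> \oo] --> f w) ->
  [/\ measurable_fun setT f, L1 P f & mean (F n) @[n --> \oo] --> mean f].
Proof.
move=> mF Lg Fg Ff.
have mf : measurable_fun setT f.
  by apply: (measurable_fun_cvg mF) => w _; exact: Ff.
have [] := @dominated_convergence _ _ _ P setT measurableT (fun n => EFin \o F n)
  (EFin \o f) (EFin \o g).
- by move=> n; exact/measurable_EFinP.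
- exact/measurable_EFinP.
- by apply: ae_true => w _; apply: cvg_EFin; [exact: nearW|exact: Ff].
- exact/L1P.
- by apply: ae_true => w n _ /=; rewrite lee_fin.
move=> fi _ H; split=> //; first exact/L1P.
rewrite /mean /Rintegral; apply: fine_cvg.
by rewrite fineK//; exact: integrable_fin_num fi.
Qed.

Lemma L1_bounded_mul xi eta : bounded_rv xi -> L1 P eta -> L1 P (fun w => xi w * eta w).
Proof.
move=> [mxi [M HM]] Le; apply: (L1_le _ (L1Z (`|M|) Le)).
  by apply: measurable_funM => //; exact: L1_measurable Le.
by apply: ae_true => w; rewrite !normrM normr_id ler_wpM2r// (le_trans (HM w))// ler_norm.
Qed.

Lemma Linf_bounded xi : Linf P xi -> exists2 zeta, bounded_rv zeta &
  {ae P, forall w, xi w = zeta w}.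
Proof.
move=> /LinfP[mxi [M HM]]; have [n nM] : exists n : nat, M <= n%:R.
  exists (Num.truncn `|M|).+1; apply: (le_trans (ler_norm M)); apply/ltW.
  exact: truncnS_gt.
exists (truncate n xi).
  by split; [exact: measurable_truncate|exists n%:R => w; exact: truncate_le].
apply: filterS HM => w xiM; apply/esym/eqP; rewrite -subr_eq0 -normr_eq0 truncateB /tail.
by rewrite max_r// subr_le0 (le_trans xiM).
Qed.

End Expectation.

Section Polar.
Context {R : realType} {d : measure_display} {Omega : measurableType d}.
Variables (P : probability Omega R) (T : \bar R) (p : (Omega -> R) -> \bar R).
Hypothesis T0 : (0 < T)%E.
Hypothesis ap : admissible P p.
Implicit Types (xi eta : Omega -> R) (y : Omega -> \bar R -> R) (v : @rmpair R d Omega).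

Lemma polar_ge xi eta : bounded_rv xi -> (p xi <= 1)%E -> L1 P eta ->
  ((mean P (fun w => xi w * eta w))%:E <= polar P p eta)%E.
Proof.
move=> bxi xi1 Le; rewrite -meanE; last exact: L1_bounded_mul.
by apply: ereal_sup_ubound; exists xi => //; split=> //; exact: bounded_Linf.
Qed.

Lemma polar_ge0 eta : L1 P eta -> (0 <= polar P p eta)%E.
Proof.
move=> Le; have b0 : @bounded_rv R d Omega (fun=> 0).
  by split; [exact: measurable_cst|exists 0 => w; rewrite normr0].
have := polar_ge b0 _ Le; rewrite (adm_0 ap) => /(_ lee01).
rewrite (_ : (fun w => _) = fun=> 0); first by rewrite mean_cst.
by apply/funext => w; rewrite mul0r.
Qed.

Lemma polar_bounded xi eta : bounded_rv xi -> L1 P eta ->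
  ((mean P (fun w => xi w * eta w))%:E <= p xi * polar P p eta)%E.
Proof.
move=> bxi Le; have Lx := bounded_L1 P bxi.
have pfin : p xi \is a fin_num.
  by rewrite ge0_fin_numE ?(adm_ge0 ap)//; apply: (adm_Linf_fin ap); exact: bounded_Linf.
have := adm_ge0 ap Lx; rewrite le_eqVlt => /predU1P[p0|p0].
  rewrite -p0 mul0e lee_fin.
  have [c c0 /(_ _ Lx)] := adm_L1 ap; rewrite -p0 mule0 => H.
  have Ln := L1_norm Lx.
  have n0 : mean P (fun w => `|xi w|) = 0.
    by apply/eqP; rewrite eq_le mean_ge0// andbT -lee_fin /mean /Rintegral fineK//;
      exact/integrable_fin_num/L1P.
  have xi0 := mean_eq0 Ln (fun w => normr_ge0 (xi w)) n0.
  rewrite -[leRHS](mean_cst P 0); apply: mean_ae_le; [exact: L1_bounded_mul|exact: L1_cst|].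
  by apply: filterS xi0 => w /eqP; rewrite normr_eq0 => /eqP ->; rewrite mul0r.
have r0 : 0 < fine (p xi) by rewrite -lte_fin fineK.
rewrite -{1}(fineK pfin) muleC -lee_pdivrMr// muleC.
have -> : ((fine (p xi))^-1%:E * (mean P (fun w => xi w * eta w))%:E =
    (mean P (fun w => (fine (p xi))^-1 * xi w * eta w))%:E)%E.
  rewrite -EFinM; congr EFin.
  have Lm := L1_bounded_mul bxi Le.
  rewrite -[LHS]addr0 -[in LHS](mean_cst P 0) -mean_lin//; last exact: L1_cst.
  by congr mean; apply/funext => w; rewrite addr0 mulrA.
apply: polar_ge => //.
  split; first by apply: measurable_funM => //; case: bxi.
  case: bxi => _ [M HM]; exists (`|(fine (p xi))^-1| * M) => w.
  by rewrite normrM ler_wpM2l.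
rewrite (admZ ap)// ger0_norm; last by rewrite invr_ge0 ltW.
rewrite -[X in (_ * X)%E](fineK pfin) -EFinM.
by rewrite mulVf// gt_eqF.
Qed.

(** For bounded [xi] rescale to [p xi = 1], or use that [xi] vanishes almost surely when
[p xi = 0]; then let the level of truncation increase.  The convention that 0 times
[+oo] is 0 does no harm, since [p] and its polar vanish at null functions only. *)
Lemma polar_holder xi eta : L1 P xi -> L1 P eta -> (forall w, 0 <= xi w) ->
  (forall w, 0 <= eta w) -> (\int[P]_w (xi w * eta w)%:E <= p xi * polar P p eta)%E.
Proof.
move=> Lx Le x0 e0; have mx := L1_measurable Lx; have me := L1_measurable Le.
have tE n w : truncate n xi w = Num.min (xi w) n%:R.
  by rewrite /truncate max_r// le_min (le_trans _ (x0 w)) ?oppr_le0//= (le_trans _ (ler0n _ n))// oppr_le0.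
have t0 n w : 0 <= truncate n xi w by rewrite tE le_min x0 /=.
have br n : bounded_rv (truncate n xi).
  by split; [exact: measurable_truncate|exists n%:R => w; exact: truncate_le].
pose F n w : \bar R := (truncate n xi w * eta w)%:E.
have -> : (\int[P]_w (xi w * eta w)%:E = \int[P]_w (limn (F ^~ w)))%E.
  apply: eq_integral => w _; apply/esym/cvg_lim => //.
  apply: cvg_near_cst; exists (Num.truncn (xi w)).+1 => // n /= xn.
  rewrite /F tE min_l//; apply: (le_trans (ltW (truncnS_gt _))).
  by rewrite ler_nat.
rewrite monotone_convergence//.
- apply: lime_le.
    apply: ereal_nondecreasing_is_cvgn => m n mn; apply: ge0_le_integral => //.
    + by move=> w _; rewrite lee_fin mulr_ge0.
    + by apply/measurable_EFinP/measurable_funM => //; exact: measurable_truncate.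
    + by apply/measurable_EFinP/measurable_funM => //; exact: measurable_truncate.
    + by move=> w _; rewrite lee_fin ler_wpM2r// !tE le_min ge_min lexx/= ge_min ler_nat mn orbT.
  apply: nearW => n; apply: (@le_trans _ _ (p (truncate n xi) * polar P p eta)%E).
    apply: le_trans (polar_bounded (br n) Le).
    rewrite /mean /Rintegral fineK//; apply/integrable_fin_num => //.
    by apply/L1P; exact: L1_bounded_mul.
  apply: lee_wpmul2r; first exact: polar_ge0.
  apply: (adm_le ap) => //; first exact: measurable_truncate.
  by apply: ae_true => w; rewrite !ger0_norm// tE ge_min lexx.
- by move=> n; apply/measurable_EFinP/measurable_funM => //; exact: measurable_truncate.
- by move=> n w _; rewrite lee_fin mulr_ge0.
- move=> w _ m n mn; rewrite lee_fin ler_wpM2r// !tE le_min ge_min lexx/= ge_min.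
  by rewrite ler_nat mn orbT.
Qed.

Lemma L1M_admissible v : L1M P T v -> admissible_pair T v /\ L1 P (pair_norm v).
Proof. by move=> []. Qed.

Lemma abs_pairing_holder y v : L1D P T y -> L1M P T v ->
  (\int[P]_w `|path_pairing T y v w|%:E <=
    proc_seminorm T p y * polar P p (pair_norm v))%E.
Proof.
move=> [cy Ly] /L1M_admissible[av Lv].
have H := polar_holder Ly Lv (fun w => proc_norm_ge0 T0 y w) (fun w => pair_norm_ge0 v w).
have mp := measurable_path_pairing T0 cy av.
apply: le_trans H; apply: ge0_le_integral => //.
- by apply/measurable_EFinP/measurableT_comp.
- by apply/measurable_EFinP/measurable_funM; [exact: L1_measurable Ly|exact: L1_measurable Lv].
- move=> w _; rewrite lee_fin; apply: path_pairing_le_norm => //; first by have [] := cy.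
  by have [_ _ /(_ w)[]] := av.
Qed.

Lemma pairing_holder y v : L1D P T y -> L1M P T v ->
  ((proc_seminorm T p y * polar P p (pair_norm v) < +oo)%E ->
     P.-integrable [set: Omega] (EFin \o path_pairing T y v)) /\
  (pairing P T y v <= proc_seminorm T p y * polar P p (pair_norm v))%E.
Proof.
move=> Ly Mv; have le1 := abs_pairing_holder Ly Mv.
have [av Lv] := L1M_admissible Mv.
have mp : measurable_fun setT (EFin \o path_pairing T y v).
  by apply/measurable_EFinP/measurable_path_pairing => //; case: Ly.
split.
  by move=> fin; apply/integrableP; split=> //; exact: le_lt_trans le1 fin.
apply: le_trans le1; rewrite /pairing unlock.
by apply: le_trans (lee_abs _) _; exact: le_abse_integral.
Qed.

Lemma mean_pairing_le y v : L1D P T y -> L1M P T v -> L1 P (path_pairing T y v) ->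
  ((`|mean P (path_pairing T y v)|)%:E <= proc_seminorm T p y * polar P p (pair_norm v))%E.
Proof.
move=> Ly Mv Lp; apply: le_trans (abs_pairing_holder Ly Mv).
apply: (@le_trans _ _ (mean P (fun w => `|path_pairing T y v w|))%:E).
  by rewrite lee_fin; exact: mean_norm.
by rewrite /mean /Rintegral fineK//; exact/integrable_fin_num/L1P/L1_norm.
Qed.

Lemma bounded_pairing_L1 y v : bounded_process T y -> L1M P T v ->
  L1 P (path_pairing T y v).
Proof.
move=> [cy [M HM]] /L1M_admissible[av Lv].
apply: (L1_le _ (L1Z M Lv)); first exact: measurable_path_pairing.
apply: ae_true => w; apply: le_trans (ler_norm _).
apply: path_pairing_le => //; first by have [] := cy.
  by have [_ _ /(_ w)[]] := av.
exact: HM.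
Qed.

Lemma path_pairingZ xi y v (w : Omega) : cadlag T (y w) -> Mtilde T (v.2 w) ->
  path_pairing T (fun w t => xi w * y w t) v w = xi w * path_pairing T y v w.
Proof.
move=> cy Mt; have cz0 : cadlag T (fun=> 0 : R) by exact: cadlag_cst.
rewrite (@path_pairing_ext _ _ _ T T0 _ (xi w *: y + (fun _ _ => 0)) v w)//; first last.
- by move=> t _; rewrite -[LHS]addr0.
- exact: cadlagZ.
rewrite path_pairing_linl// -[RHS]addr0; congr (_ + _).
apply/eqP; rewrite -normr_le0; have := @path_pairing_le _ _ _ T T0 (fun _ _ => 0) v w 0 cz0 Mt.
by rewrite mul0r; apply => t _; rewrite normr0.
Qed.

(** The sign process multiplied by [xi]; both limits of [sign_pairing_limits] pass through
the expectation by dominated convergence. *)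
Lemma sign_process_norming xi v (e : R) : bounded_rv xi -> (forall w, 0 <= xi w) ->
  L1M P T v -> 0 < e -> exists2 z : Omega -> \bar R -> R,
    [/\ cadlag_process T z, bounded_process T z & forall w, proc_norm T z w <= xi w] &
    mean P (fun w => xi w * pair_norm v w) - e < mean P (path_pairing T z v).
Proof.
move=> bxi x0 /L1M_admissible[av Lv] e0; have [mxi [M HM]] := bxi.
pose z n m w t := xi w * sign_process T v n m w t.
have cs n m := sign_process_cadlag T0 av n m.
have csw n m w : cadlag T (sign_process T v n m w) by have [] := cs n m.
have Mt w : Mtilde T (v.2 w) by have [_ _ /(_ w)[]] := av.
have cz n m : cadlag_process T (z n m) by exact: cadlag_processZ.
have zle n m w : proc_norm T (z n m) w <= xi w.
  apply: proc_norm_le => // t tT; rewrite normrM ger0_norm// -[leRHS]mulr1.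
  by rewrite ler_wpM2l//; exact: sign_process_le1.
have bz n m : bounded_process T (z n m).
  split=> //; exists M => w t tT; apply: le_trans (HM w).
  rewrite normrM -[leRHS]mulr1; apply: ler_wpM2l => //; exact: sign_process_le1.
have ppz n m w : path_pairing T (z n m) v w = xi w * path_pairing T (sign_process T v n m) v w.
  by apply: path_pairingZ.
have [h [hm hn]] := sign_pairing_limits T0 av.
have Lg := L1_bounded_mul bxi Lv.
have bound n m w : `|path_pairing T (z n m) v w| <= xi w * pair_norm v w.
  apply: le_trans (path_pairing_le_norm _ _ _) _ => //; first by have [] := cz n m.
  by rewrite ler_wpM2r// pair_norm_ge0.
have mz n m := measurable_path_pairing T0 (cz n m) av.
have D1 n : [/\ measurable_fun setT (fun w => xi w * h n w), L1 P (fun w => xi w * h n w) &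
    mean P (path_pairing T (z n m) v) @[m --> \oo] --> mean P (fun w => xi w * h n w)].
  apply: (mean_dct (mz n) Lg (bound n)) => w; rewrite (_ : (fun m => _) = fun m => xi w * path_pairing T (sign_process T v n m) v w).
    by apply: cvgM; [exact: cvg_cst|exact: hm].
  by apply/funext => m; rewrite ppz.
have hbound n w : `|xi w * h n w| <= xi w * pair_norm v w.
  have : `|path_pairing T (z n m) v w| @[m --> \oo] --> `|xi w * h n w|.
    apply: cvg_norm.
    rewrite (_ : (fun m => _) = fun m => xi w * path_pairing T (sign_process T v n m) v w).
      by apply: cvgM; [exact: cvg_cst|exact: hm].
    by apply/funext => m; rewrite ppz.
  by move=> /cvg_seq_le; apply.
have [_ _ D2] : [/\ measurable_fun setT (fun w => xi w * pair_norm v w),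
    L1 P (fun w => xi w * pair_norm v w) &
    mean P (fun w => xi w * h n w) @[n --> \oo] --> mean P (fun w => xi w * pair_norm v w)].
  apply: (mean_dct (g := fun w => xi w * pair_norm v w)) => //.
    by move=> n; have [] := D1 n.
  by move=> w; apply: cvgM; [exact: cvg_cst|exact: hn].
have e2 : 0 < e / 2 by rewrite divr_gt0.
have [n _ /(_ n (leqnn n)) Hn] := cvgr_gt _ D2 (mean P (fun w => xi w * pair_norm v w) - e / 2) ltac:(lra).
have [_ _ D1n] := D1 n.
have [m _ /(_ m (leqnn m)) Hm] := cvgr_gt _ D1n (mean P (fun w => xi w * h n w) - e / 2) ltac:(lra).
exists (z n m); first by split.
by move: Hn Hm => /=; lra.
Qed.

(** An essentially bounded variable may be replaced by the absolute value of a bounded one: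
this increases the expectation and does not change [p]. *)
Lemma polar_le eta (C : \bar R) : L1 P eta -> (forall w, 0 <= eta w) ->
  (forall xi, bounded_rv xi -> (forall w, 0 <= xi w) -> (p xi <= 1)%E ->
    ((mean P (fun w => xi w * eta w))%:E <= C)%E) ->
  (polar P p eta <= C)%E.
Proof.
move=> Le e0 HC; apply: ge_ereal_sup => _ [xi [Lxi xi1] <-].
have [zeta [mz [M HM]] xiz] := Linf_bounded Lxi.
have b' : bounded_rv (fun w => `|zeta w|).
  by split; [exact: measurableT_comp|exists M => w; rewrite normr_id].
have bz : bounded_rv zeta by split=> //; exists M.
have Lz := L1_bounded_mul bz Le.
have -> : 'E_P[xi \* eta]%E = 'E_P[(fun w => zeta w * eta w)%R]%E.
  rewrite unlock; apply: ae_eq_integral => //.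
  - apply/measurable_EFinP/measurable_funM; first by have /LinfP[] := Lxi.
    exact: L1_measurable Le.
  - by apply/measurable_EFinP; exact: L1_measurable Lz.
  - by apply: filterS xiz => w /= ->.
rewrite meanE//; apply: le_trans (HC _ b' _ _) => //.
  rewrite lee_fin; apply: mean_le => //; first exact: L1_bounded_mul.
  by move=> w; rewrite ler_wpM2r// ler_norm.
apply: le_trans xi1; apply: (adm_le ap); [by case: b'|exact: Linf_L1|].
by apply: filterS xiz => w ->; rewrite normr_id.
Qed.

Lemma polar_norming v (Y : set (Omega -> \bar R -> R)) : L1M P T v ->
  LinfD P T `<=` Y -> Y `<=` L1D P T ->
  polar P p (pair_norm v) =
  ereal_sup [set pairing P T y v | y in [set y | Y y /\ (proc_seminorm T p y <= 1)%E]].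
Proof.
move=> Mv LY YL; have [av Lv] := L1M_admissible Mv; have pol0 := polar_ge0 Lv.
apply/eqP; rewrite eq_le; apply/andP; split; last first.
  apply: ge_ereal_sup => _ [y [/YL Ly y1] <-].
  apply: le_trans (pairing_holder Ly Mv).2 _; rewrite -[leRHS]mul1e.
  exact: lee_wpmul2r.
apply: polar_le => // [w|xi bxi xi0 xi1]; first exact: pair_norm_ge0.
apply/lee_addgt0Pr => e e0.
have Lx := L1_bounded_mul bxi Lv.
have [z [cz bdz zle] Hz] := sign_process_norming bxi xi0 Mv e0.
have Ld : LinfD P T z by exact: bounded_LinfD.
have z1 : (proc_seminorm T p z <= 1)%E.
  apply: le_trans xi1; apply: (adm_le ap); [exact: measurable_proc_norm|exact: bounded_L1|].
  by apply: ae_true => w; rewrite proc_norm_abs// ger0_norm.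
have : (pairing P T z v <= ereal_sup [set pairing P T y v |
    y in [set y | Y y /\ (proc_seminorm T p y <= 1)%E]])%E.
  by apply: ereal_sup_ubound; exists z => //; split=> //; exact: LY.
have Lp := bounded_pairing_L1 bdz Mv.
rewrite (meanE Lp : pairing P T z v = _) => H.
apply: (@le_trans _ _ ((mean P (path_pairing T z v))%:E + e%:E)%E); last by rewrite leeD2r.
by rewrite -EFinD lee_fin; move: Hz; lra.
Qed.

End Polar.

(** * The embedding into the dual space *)

Section DualEmbedding.
Context {R : realType} {d : measure_display} {Omega : measurableType d}.
Variables (P : probability Omega R) (T : \bar R) (PP : set ((Omega -> R) -> \bar R)).
Hypothesis T0 : (0 < T)%E.
Hypothesis PP_admissible : forall p, PP p -> admissible P p.
Implicit Types (xi eta : Omega -> R) (y z : Omega -> \bar R -> R) (v : @rmpair R d Omega).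

Let YP := YDP T PP_admissible.

Lemma sintegral_charge_ext (u u' : smeasure) (f : \bar R -> R) :
  (forall A, measurable A -> u A = u' A) -> bounded_measurable T f ->
  sintegral T u f = sintegral T u' f.
Proof.
move=> uu' bf; rewrite (@sintegral_diff _ _ u (jordan_pos (hahnP u')) (jordan_neg (hahnP u')))//.
by move=> A mA; rewrite uu'// -jordanE.
Qed.

Lemma L1M_lin (a : R) v v' : L1M P T v -> L1M P T v' -> L1M P T (pair_lin a v v').
Proof.
move=> /L1M_admissible[av Lv] /L1M_admissible[av' Lv'].
have [r1 r2 M] := admissible_pair_lin a av av'; split=> //.
apply: (L1_le (measurable_pair_norm T0 (admissible_pair_lin a av av')) (L1_add (L1Z (`|a|) Lv) Lv')).
apply: ae_true => w; rewrite ger0_norm ?pair_norm_ge0//.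
by apply: le_trans (ler_norm _); exact: pair_norm_lin.
Qed.

Lemma UM_product_fin y v : YD P T PP y -> UM P T PP v ->
  exists2 p, PP p & (proc_seminorm T p y * polar P p (pair_norm v) < +oo)%E.
Proof.
move=> /YP[cy Yy] [/L1M_admissible[av Lv] [p Pp [_ fin]]]; exists p => //.
have ap := PP_admissible Pp.
have q0 := adm_ge0 ap (Yspace_L1 PP_admissible Yy).
by apply: lte_mul_pinfty => //; rewrite ge0_fin_numE//; exact: (Yspace_fin Yy Pp).
Qed.

Lemma UM_pairing_L1 y v : YD P T PP y -> UM P T PP v -> L1 P (path_pairing T y v).
Proof.
move=> Yy Uv; apply/L1P; have [p Pp fin] := UM_product_fin Yy Uv.
by apply: (pairing_holder T0 (PP_admissible Pp) Yy.1 Uv.1).1.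
Qed.

Lemma UM_pairingE y v : YD P T PP y -> UM P T PP v ->
  pairing P T y v = (mean P (path_pairing T y v))%:E.
Proof. by move=> Yy Uv; exact: (meanE (UM_pairing_L1 Yy Uv)). Qed.

Lemma pairing_linr (a : R) y v v' : YD P T PP y -> UM P T PP v -> UM P T PP v' ->
  pairing P T y (pair_lin a v v') = (a%:E * pairing P T y v + pairing P T y v')%E.
Proof.
move=> Yy Uv Uv'; rewrite (UM_pairingE Yy Uv) (UM_pairingE Yy Uv').
have L := UM_pairing_L1 Yy Uv; have L' := UM_pairing_L1 Yy Uv'.
rewrite -EFinM -EFinD -mean_lin//.
have E : path_pairing T y (pair_lin a v v') =
    fun w => a * path_pairing T y v w + path_pairing T y v' w.
  have /YP[[cy _] _] := Yy.
  have [[av _] [av' _]] := (L1M_admissible Uv.1, L1M_admissible Uv'.1).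
  apply/funext => w; apply: path_pairing_linr => //.
    by have [_ _ /(_ w)[]] := av.
  by have [_ _ /(_ w)[]] := av'.
have L2 : L1 P (path_pairing T y (pair_lin a v v')).
  by rewrite E; apply: L1_add => //; exact: L1Z.
by rewrite (meanE L2 : pairing P T y (pair_lin a v v') = _) E.
Qed.

Lemma mean_pairing_linl (a : R) x y v : YD P T PP x -> YD P T PP y -> UM P T PP v ->
  mean P (path_pairing T (a *: x + y) v) =
  a * mean P (path_pairing T x v) + mean P (path_pairing T y v).
Proof.
move=> Yx Yy Uv; have L := UM_pairing_L1 Yx Uv; have L' := UM_pairing_L1 Yy Uv.
rewrite -mean_lin//; congr mean; apply/funext => w.
have [/YP[[cx _] _] /YP[[cy _] _]] := (Yx, Yy); have [av _] := L1M_admissible Uv.1.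
by apply: path_pairing_linl => //; have [_ _ /(_ w)[]] := av.
Qed.

Lemma pairing_topological_dual v : UM P T PP v ->
  topological_dual PP (proc_seminorm T) (YD P T PP) (fun y => fine (pairing P T y v)).
Proof.
move=> Uv; split=> [a x y Yx Yy|x Yx].
  by rewrite !UM_pairingE//; [exact: mean_pairing_linl|exact: YD_lin].
have [p Pp _] := UM_product_fin Yx Uv; have ap := PP_admissible Pp.
have [Mv [p' Pp' [_ fin]]] := Uv; have [av Lv] := L1M_admissible Mv.
have ap' := PP_admissible Pp'.
have pol0 := polar_ge0 ap' Lv.
have polE : polar P p' (pair_norm v) = (fine (polar P p' (pair_norm v)))%:E.
  by rewrite fineK// ge0_fin_numE.
set K := fine _ in polE; have K0 : 0 <= K by rewrite -lee_fin -polE.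
move=> N /nbhs_ballP[e /= e0 eN].
exists [set p'], (e / (K + 1)); split => //.
- by move=> _ ->.
- by rewrite divr_gt0// ltr_wpDl.
move=> y Yy /(_ p' erefl) Hy; apply: eN; rewrite /ball/= !UM_pairingE//=.
have Yyx : YD P T PP (y - x) by exact: YDB.
have -> : mean P (path_pairing T x v) - mean P (path_pairing T y v) =
    - mean P (path_pairing T (y - x) v).
  have -> : y - x = (-1) *: x + y by rewrite scaleN1r addrC.
  by rewrite mean_pairing_linl// mulN1r opprD opprK.
rewrite normrN.
have q0 : (0 <= proc_seminorm T p' (y - x)%R)%E by exact: (adm_ge0 ap' Yyx.1.2).
have fin' : (proc_seminorm T p' (y - x)%R * polar P p' (pair_norm v) < +oo)%E.
  rewrite polE lte_mul_pinfty// ?ltry// ge0_fin_numE//.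
  exact: lt_trans Hy (ltry _).
have le1 := mean_pairing_le T0 ap' Yyx.1 Mv (UM_pairing_L1 Yyx Uv).
rewrite -lte_fin; apply: le_lt_trans le1 _; rewrite polE.
apply: (@le_lt_trans _ _ ((e / (K + 1))%:E * K%:E)%E).
  by apply: lee_wpmul2r; [rewrite lee_fin|exact: ltW].
rewrite -EFinM lte_fin mulrAC -ltr_pdivlMr ?invr_gt0 ?ltr_wpDl// invrK.
by rewrite ltr_pM2l// ltrDl.
Qed.

Lemma pair_eq_pairing y v v' : cadlag_process T y -> admissible_pair T v ->
  admissible_pair T v' -> Defs.pair_eq P v v' -> pairing P T y v = pairing P T y v'.
Proof.
move=> cy av av' vv'; rewrite /pairing unlock; apply: ae_eq_integral => //.
- by apply/measurable_EFinP; exact: measurable_path_pairing.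
- by apply/measurable_EFinP; exact: measurable_path_pairing.
apply: filterS vv' => w vv' _ /=; congr EFin.
have cyw : cadlag T (y w) by have [] := cy.
have [_ _ /(_ w)[_ M2]] := av; have [_ _ /(_ w)[_ M2']] := av'.
rewrite !path_pairingE//; congr (_ + _); apply: sintegral_charge_ext => //.
- by move=> A /vv'[].
- exact: bm_cadlag.
- by move=> A /vv'[].
- exact: bm_left_path.
Qed.

(** The total variation of the difference of the two pairs has mean zero, by
[sign_process_norming] with [xi = 1]. *)
Lemma pairing_injective v v' : L1M P T v -> L1M P T v' ->
  (forall y, bounded_process T y -> pairing P T y v = pairing P T y v') ->
  Defs.pair_eq P v v'.
Proof.
move=> Mv Mv' H; have [av Lv] := L1M_admissible Mv; have [av' Lv'] := L1M_admissible Mv'.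
have Mw := L1M_lin (-1) Mv Mv'; have [aw Lw] := L1M_admissible Mw.
have b1 : @bounded_rv R d Omega (fun=> 1).
  by split; [exact: measurable_cst|exists 1 => w; rewrite normr1].
have le0 : mean P (pair_norm (pair_lin (-1) v v')) <= 0.
  apply/ler_addgt0Pr => e e0; rewrite add0r.
  have [z [cz bz _]] := sign_process_norming T0 b1 (fun=> ler01) Mw e0.
  have -> : mean P (path_pairing T z (pair_lin (-1) v v')) = 0.
    have -> : path_pairing T z (pair_lin (-1) v v') =
        fun w => (-1) * path_pairing T z v w + path_pairing T z v' w.
      apply/funext => w; apply: path_pairing_linr => //; first by have [] := cz.
        by have [_ _ /(_ w)[]] := av.
      by have [_ _ /(_ w)[]] := av'.
    have L := bounded_pairing_L1 T0 bz Mv; have L' := bounded_pairing_L1 T0 bz Mv'.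
    rewrite mean_lin//; have := H _ bz.
    by rewrite (meanE L : pairing P T z v = _) (meanE L' : pairing P T z v' = _) => -[->]; lra.
  rewrite (_ : (fun w => _) = pair_norm (pair_lin (-1) v v')); first by move/ltW; rewrite lerBlDr add0r.
  by apply/funext => w; rewrite mul1r.
have m0 : mean P (pair_norm (pair_lin (-1) v v')) = 0.
  by apply/eqP; rewrite eq_le le0 mean_ge0// => w; exact: pair_norm_ge0.
have := mean_eq0 Lw (fun w => pair_norm_ge0 _ w) m0.
apply: filterS => w /eqP; rewrite paddr_eq0 ?tv_ge0// => /andP[/eqP t1 /eqP t2] A mA.
have sub (u u' : smeasure (R := R)) : tv_norm (cadd (cscale (-1) u) u' : smeasure) = 0 -> u A = u' A.
  move=> t0; have := tv_ge (cadd (cscale (-1) u) u' : smeasure) mA.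
  rewrite t0 smeasure_linE => H0.
  have {H0} : ((-1)%:E * u A + u' A = 0)%E by apply/eqP; rewrite -abse_eq0 eq_le H0 abse_ge0.
  rewrite -(fineK (charge_fin_num u mA)) -(fineK (charge_fin_num u' mA)) -EFinM -EFinD => -[].
  by move=> E; congr EFin; move: E; lra.
by split; apply: sub.
Qed.

Lemma YD_dual_embedding : dual_embedding P T PP.
Proof.
split.
- by move=> y v Yy Uv; apply/L1P; exact: UM_pairing_L1.
- exact: pairing_linr.
- exact: pairing_topological_dual.
move=> v v' Uv Uv'; split=> [H|vv' y Yy].
  apply: pairing_injective Uv.1 Uv'.1 _ => y by_; apply: H; exact: bounded_YD.
apply: pair_eq_pairing => //; first by have /YP[] := Yy.
  exact: (L1M_admissible Uv.1).1.
exact: (L1M_admissible Uv'.1).1.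
Qed.

(** A seminorm that dominates two others has a smaller polar than both, up to a constant. *)
Lemma UM_lin (a : R) v v' : seminorm_directed P PP -> UM P T PP v -> UM P T PP v' ->
  UM P T PP (pair_lin a v v').
Proof.
move=> dir [Mv [p1 P1 [Lv f1]]] [Mv' [p2 P2 [Lv' f2]]].
have Mw := L1M_lin a Mv Mv'; split=> //; have [aw Lw] := L1M_admissible Mw.
have [p Pp [c c0 pc]] := dir _ _ P1 P2; exists p => //; split=> //.
have [ap1 ap2] := (PP_admissible P1, PP_admissible P2).
have pol1 := polar_ge0 ap1 Lv; have pol2 := polar_ge0 ap2 Lv'.
apply: (@le_lt_trans _ _ (`|a|%:E * (c%:E * polar P p1 (pair_norm v)) +
    c%:E * polar P p2 (pair_norm v')))%E; last first.
  rewrite -(fineK (_ : polar P p1 (pair_norm v) \is a fin_num)) ?ge0_fin_numE//.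
  rewrite -(fineK (_ : polar P p2 (pair_norm v') \is a fin_num)) ?ge0_fin_numE//.
  by rewrite -!EFinM -EFinD ltry.
apply: (polar_le (PP_admissible Pp)) => // [w|xi bxi xi0 xi1]; first exact: pair_norm_ge0.
have Lx := bounded_L1 P bxi; have [q1 q2] := pc _ Lx.
have B (p' : (Omega -> R) -> \bar R) eta : admissible P p' -> L1 P eta -> (p' xi <= c%:E * p xi)%E ->
    ((mean P (fun w => xi w * eta w))%:E <= c%:E * polar P p' eta)%E.
  move=> ap' Le q; apply: le_trans (polar_bounded ap' bxi Le) _.
  apply: lee_wpmul2r; first exact: polar_ge0.
  apply: le_trans q _; rewrite -[leRHS]mule1; apply: lee_wpmul2l => //.
  by rewrite lee_fin ltW.
apply: (@le_trans _ _ (`|a|%:E * (mean P (fun w => (xi w * pair_norm v w)%R))%:E +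
    (mean P (fun w => (xi w * pair_norm v' w)%R))%:E))%E; last first.
  apply: leeD; last exact: B.
  by apply: lee_wpmul2l; [rewrite lee_fin|exact: B].
have [L1v L2v] := (L1_bounded_mul bxi Lv, L1_bounded_mul bxi Lv').
rewrite -EFinM -EFinD lee_fin -mean_lin//; apply: mean_le.
- exact: L1_bounded_mul.
- by apply: L1_add => //; exact: L1Z.
- move=> w; rewrite mulrCA -mulrDr; apply: ler_wpM2l => //; exact: pair_norm_lin.
Qed.

End DualEmbedding.

(** * Positive and negative parts of a functional *)

Section Control.
Context {R : realType} {d : measure_display} {Omega : measurableType d}.
Variables (P : probability Omega R) (T : \bar R).
Hypothesis T0 : (0 < T)%E.
Implicit Types (xi zeta eta : Omega -> R) (x y z : Omega -> \bar R -> R)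
  (s : Omega -> \bar R) (A : set Omega) (rho : (Omega -> R) -> R).

Lemma bounded_rv_lin (a : R) xi zeta : bounded_rv xi -> bounded_rv zeta ->
  bounded_rv (fun w => a * xi w + zeta w).
Proof.
move=> [mx [M HM]] [mz [N HN]]; split.
  by apply: measurable_funD => //; exact: measurable_funM.
exists (`|a| * M + N) => w; apply: le_trans (ler_normD _ _) _.
by rewrite normrM lerD// ler_wpM2l.
Qed.

(** What an upper bound on bounded processes needs in order that a functional below it be
countably additive on events.  Multiples of admissible functions and means against an
integrable weight are examples ([control_admissible], [control_mean]). *)
Record control rho : Prop := Control {
  control_ge0 : forall xi, bounded_rv xi -> 0 <= rho xi ;
  control_mono : forall xi zeta, bounded_rv xi -> bounded_rv zeta ->
    (forall w, 0 <= xi w <= zeta w) -> rho xi <= rho zeta ;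
  control_lin : forall (a : R) xi zeta, 0 <= a -> bounded_rv xi -> bounded_rv zeta ->
    rho (fun w => a * xi w + zeta w) <= a * rho xi + rho zeta ;
  control_cvg0 : forall A : nat -> set Omega, (forall n, measurable (A n)) ->
    (forall n m, (n <= m)%N -> A m `<=` A n) -> \bigcap_n A n = set0 ->
    rho \1_(A n) @[n --> \oo] --> 0 ;
  control_null : forall A, measurable A -> P A = 0%E -> rho \1_A = 0 }.

Lemma controlD rho rho' : control rho -> control rho' ->
  control (fun xi => rho xi + rho' xi).
Proof.
move=> c c'; split.
- by move=> xi bx; rewrite addr_ge0 ?control_ge0.
- by move=> xi zeta bx bz xz; rewrite lerD ?control_mono.
- move=> a xi zeta a0 bx bz; rewrite mulrDr addrACA lerD//; exact: control_lin.
- move=> A mA dA A0; rewrite -[X in _ --> X]addr0.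
  by apply: cvgD; apply: control_cvg0.
- by move=> A mA PA; rewrite !control_null ?addr0.
Qed.

Lemma control_admissible p (C : R) : admissible P p -> 0 <= C ->
  control (fun xi => C * fine (p xi)).
Proof.
move=> ap C0.
have fin xi : bounded_rv xi -> p xi \is a fin_num.
  move=> bx; rewrite ge0_fin_numE; first exact/(adm_Linf_fin ap)/bounded_Linf.
  exact: (adm_ge0 ap (bounded_L1 P bx)).
split.
- move=> xi bx; rewrite mulr_ge0// fine_ge0//.
  exact: (adm_ge0 ap (bounded_L1 P bx)).
- move=> xi zeta bx bz xz; rewrite ler_wpM2l// fine_le ?fin//.
  apply: (adm_le ap); [by case: bx|exact: bounded_L1|].
  apply: ae_true => w; have /andP[x0 xz'] := xz w.
  by rewrite !ger0_norm// (le_trans x0).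
- move=> a xi zeta a0 bx bz; rewrite mulrCA -mulrDr ler_wpM2l//.
  have bxz := bounded_rv_lin a bx bz.
  rewrite -lee_fin EFinD EFinM !fineK ?fin//.
  have [Lx Lz] := (bounded_L1 P bx, bounded_L1 P bz).
  apply: le_trans (admD ap (L1Z a Lx) Lz) _.
  by rewrite (admZ ap)// ger0_norm.
- move=> A mA dA A0; rewrite -[X in _ --> X](mulr0 C); apply: cvgM; first exact: cvg_cst.
  by apply: fine_cvg; exact: (adm_indic_cvg0 ap).
- move=> A mA PA; rewrite (_ : p _ = p (fun=> 0)).
    by rewrite (adm_0 ap)/= mulr0.
  apply: (adm_eq ap); [exact/bounded_L1/bounded_indic|exact: L1_cst|].
  exists A; split=> // w /= H; apply: contrapT => nA; apply: H.
  by rewrite indicE memNset// !normr0.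
Qed.

Lemma control_mean eta : L1 P eta -> (forall w, 0 <= eta w) ->
  control (fun xi => mean P (fun w => `|xi w| * eta w)).
Proof.
move=> Le e0.
have bn xi : bounded_rv xi -> bounded_rv (fun w => `|xi w|).
  move=> [mx [M HM]]; split; first exact: measurableT_comp.
  by exists M => w; rewrite normr_id.
have L xi : bounded_rv xi -> L1 P (fun w => `|xi w| * eta w).
  by move=> bx; exact: L1_bounded_mul (bn _ bx) Le.
split.
- by move=> xi bx; apply: mean_ge0 => w; rewrite mulr_ge0.
- move=> xi zeta bx bz xz; apply: mean_le; [exact: L|exact: L|move=> w].
  have /andP[x0 xz'] := xz w.
  by rewrite ler_wpM2r// !ger0_norm// (le_trans x0).
- move=> a xi zeta a0 bx bz; rewrite -mean_lin; [|exact: L|exact: L].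
  apply: mean_le; first exact/L/bounded_rv_lin.
    by apply: L1_add; [exact/L1Z/L|exact: L].
  move=> w; rewrite mulrA -mulrDl ler_wpM2r//.
  by apply: le_trans (ler_normD _ _) _; rewrite normrM (ger0_norm a0).
- move=> A mA dA A0; rewrite -(mean_cst P 0).
  have [] := mean_dct (P := P) (F := fun n w => `|\1_(A n) w| * eta w) (f := fun=> 0) (g := eta) _ Le _ _ => //.
  + move=> n; apply: measurable_funM; last exact: L1_measurable Le.
    by apply: measurableT_comp => //; exact: measurable_indic.
  + move=> n w; rewrite normrM normr_id (ger0_norm (e0 w)) -[leRHS]mul1r ler_wpM2r//.
    by rewrite indicE; case: (_ \in _); rewrite ?normr1 ?normr0.
  + move=> w; have [n nA] : exists n, ~ A n w.
      apply: contrapT => H; have : (\bigcap_n A n) w.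
        by move=> n _; apply: contrapT => nA; apply: H; exists n.
      by rewrite A0.
    apply: cvg_near_cst; exists n => // m /= nm; rewrite indicE memNset ?normr0 ?mul0r//.
    by move=> /(dA _ _ nm).
- move=> A mA PA; rewrite -[RHS](mean_cst P 0); apply: mean_ae_eq.
  + exact/L/bounded_indic.
  + exact: L1_cst.
  + exists A; split=> // w /= H; apply: contrapT => nA; apply: H.
    by rewrite indicE memNset// normr0 mul0r.
Qed.

Lemma bounded_process_lin (a : R) x y : bounded_process T x -> bounded_process T y ->
  bounded_process T (a *: x + y).
Proof.
move=> [cx [M HM]] [cy [N HN]]; split; first exact: cadlag_process_lin.
exists (`|a| * M + N) => w t tT; apply: le_trans (ler_normD _ _) _.
by rewrite normrM lerD// ?HN// ler_wpM2l// HM.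
Qed.

Lemma bounded_process_add x y : bounded_process T x -> bounded_process T y ->
  bounded_process T (x + y).
Proof. by move=> bx by_; rewrite -[x]scale1r; exact: bounded_process_lin. Qed.

Lemma bounded_process_sub x y : bounded_process T x -> bounded_process T y ->
  bounded_process T (x - y).
Proof. by move=> bx by_; rewrite addrC -scaleN1r; exact: bounded_process_lin. Qed.

Lemma bounded_process0 : bounded_process T (0 : Omega -> \bar R -> R).
Proof.
split; last by exists 0 => w t _; rewrite normr0.
by apply: (cadlag_process_rv T (xi := fun=> 0)); exact: measurable_cst.
Qed.

Lemma bounded_process_min x y : bounded_process T x -> bounded_process T y ->
  bounded_process T (fun w t => Num.min (x w t) (y w t)).
Proof.
move=> [cx [M HM]] [cy [N HN]]; split; first exact: cadlag_process_min.
exists (Num.max M N) => w t tT; rewrite minEle; case: ifP => _.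
  by rewrite le_max HM.
by rewrite le_max HN// orbT.
Qed.

Definition ge0_process x := bounded_process T x /\ forall w t, times T t -> 0 <= x w t.

Lemma ge0_process_add x y : ge0_process x -> ge0_process y -> ge0_process (x + y).
Proof.
move=> [bx x0] [by_ y0]; split; first exact: bounded_process_add.
by move=> w t tT; rewrite addr_ge0 ?x0 ?y0.
Qed.

Record positive_functional rho (lam : (Omega -> \bar R -> R) -> R) : Prop := {
  pf_add : forall x y, ge0_process x -> ge0_process y -> lam (x + y) = lam x + lam y ;
  pf_ge0 : forall x, ge0_process x -> 0 <= lam x ;
  pf_le : forall x, ge0_process x -> lam x <= rho (proc_norm T x) }.

Lemma pf_mono rho lam x y : positive_functional rho lam -> ge0_process x ->
  bounded_process T y -> (forall w t, times T t -> x w t <= y w t) -> lam x <= lam y.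
Proof.
move=> pf gx by_ xy; have gd : ge0_process (y - x).
  split; first by apply: bounded_process_sub => //; case: gx.
  by move=> w t tT; rewrite subr_ge0 xy.
have -> : y = x + (y - x) by rewrite addrC subrK.
by rewrite (pf_add pf)// lerDl (pf_ge0 pf).
Qed.

Section Riesz.
Variables (rho : (Omega -> R) -> R) (phi : (Omega -> \bar R -> R) -> R).
Hypothesis crho : control rho.
Hypothesis phi_lin : forall (a : R) x y, bounded_process T x -> bounded_process T y ->
  phi (a *: x + y) = a * phi x + phi y.
Hypothesis phi_le : forall y, bounded_process T y -> `|phi y| <= rho (proc_norm T y).

Lemma functional_add x y : bounded_process T x -> bounded_process T y ->
  phi (x + y) = phi x + phi y.
Proof. by move=> bx by_; rewrite -{1}[x]scale1r phi_lin// mul1r. Qed.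

Lemma functional0 : phi 0 = 0.
Proof.
have := functional_add bounded_process0 bounded_process0; rewrite addr0; lra.
Qed.

(** The formula of Riesz for the positive part.  It is additive because a process z below
x + y is the sum of the minimum of z and x, and of a process below y. *)
Definition pos_functional x : R :=
  sup [set phi z | z in [set z | bounded_process T z /\
                                 forall w t, times T t -> 0 <= z w t <= x w t]].

Local Notation below x := [set phi z | z in [set z | bounded_process T z /\
  forall w t, times T t -> 0 <= z w t <= x w t]].

Lemma proc_norm_mono x y w : bounded_process T y ->
  (forall t, times T t -> `|x w t| <= `|y w t|) -> proc_norm T x w <= proc_norm T y w.
Proof.
move=> [[cy _] _] xy; apply: proc_norm_le => // t tT.
by apply: le_trans (xy t tT) _; exact: le_path_norm.
Qed.

Let below_ub x : ge0_process x -> ubound (below x) (rho (proc_norm T x)).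
Proof.
move=> [bx x0] _ [z [bz zx] <-]; apply: le_trans (ler_norm _) _.
apply: le_trans (phi_le bz) _; apply: (control_mono crho); try exact: bounded_process_norm.
move=> w; rewrite proc_norm_ge0//=; apply: proc_norm_mono => // t tT.
by have /andP[z0 zx'] := zx w t tT; rewrite !ger0_norm// (le_trans z0).
Qed.

Let below_sup x : ge0_process x -> has_sup (below x).
Proof.
move=> gx; split; last by exists (rho (proc_norm T x)); exact: below_ub.
exists (phi 0), 0 => //; split; first exact: bounded_process0.
by move=> w t tT; rewrite lexx; case: gx => _; exact.
Qed.

Lemma pos_functional_ge x z : ge0_process x -> bounded_process T z ->
  (forall w t, times T t -> 0 <= z w t <= x w t) -> phi z <= pos_functional x.
Proof.
move=> gx bz zx; apply: ub_le_sup; first by have [] := below_sup gx.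
by exists z.
Qed.

Lemma pos_functional_pf : positive_functional rho pos_functional.
Proof.
split.
- move=> x y gx gy; have gxy := ge0_process_add gx gy.
  have [[bx x0] [by_ y0]] := (gx, gy).
  apply/eqP; rewrite eq_le; apply/andP; split.
    apply: ge_sup; first by have [] := below_sup gxy.
    move=> _ [z [bz zxy] <-].
    pose z1 w t := Num.min (z w t) (x w t).
    have bz1 : bounded_process T z1 by exact: bounded_process_min.
    have -> : z = z1 + (z - z1) by rewrite addrC subrK.
    have bz2 := bounded_process_sub bz bz1.
    rewrite functional_add// lerD//; apply: pos_functional_ge => // w t tT.
      have /andP[z0 _] := zxy w t tT.
      by rewrite /z1 le_min z0 x0//= ge_min lexx orbT.
    have /andP[z0 zxy'] := zxy w t tT.
    change ((z - z1) w t) with (z w t - z1 w t); rewrite subr_ge0 /z1 ge_min lexx/=.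
    rewrite lerBlDr -lerBlDl le_min; move: zxy'; change ((x + y) w t) with (x w t + y w t).
    by have := y0 w t tT; move=> y0' zz; apply/andP; split; lra.
  rewrite -lerBrDr; apply: ge_sup; first by have [] := below_sup gx.
  move=> _ [z1 [b1 z1x] <-]; rewrite lerBrDr addrC -lerBrDr.
  apply: ge_sup; first by have [] := below_sup gy.
  move=> _ [z2 [b2 z2y] <-]; rewrite lerBrDr -functional_add//.
  apply: pos_functional_ge => //; first exact: bounded_process_add.
  move=> w t tT; have /andP[a1 a2] := z1x w t tT; have /andP[a3 a4] := z2y w t tT.
  by rewrite [(z2 + z1) w t]addrC; apply/andP; split; [apply: addr_ge0|apply: lerD].
- move=> x gx; rewrite -functional0; apply: pos_functional_ge => //.
    exact: bounded_process0.
  by move=> w t tT; rewrite lexx; case: gx => _; exact.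
- move=> x gx; apply: ge_sup; first by have [] := below_sup gx.
  exact: below_ub.
Qed.

Lemma neg_functional_pf : positive_functional (fun xi => rho xi + rho xi)
  (fun x => pos_functional x - phi x).
Proof.
have pf := pos_functional_pf; split.
- move=> x y gx gy; rewrite (pf_add pf)// functional_add; first by lra.
    by case: gx.
  by case: gy.
- move=> x gx; rewrite subr_ge0; apply: pos_functional_ge => //; first by case: gx.
  by move=> w t tT; rewrite lexx andbT; case: gx => _; exact.
- move=> x gx; apply: lerD; first exact: (pf_le pf).
  by apply: le_trans (phi_le _); [rewrite -normrN ler_norm|case: gx].
Qed.

End Riesz.

End Control.

(** * Densities of a positive functional *)

Section Density.
Context {R : realType} {d : measure_display} {Omega : measurableType d}.
Variables (P : probability Omega R) (T : \bar R).
Hypothesis T0 : (0 < T)%E.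
Implicit Types (xi : Omega -> R) (s : Omega -> \bar R) (A B : set Omega).

Definition istep A s (w : Omega) t : R := \1_A w * step (s w) t.

Lemma istep_ge0 A s : measurable A -> measurable_fun setT s -> ge0_process T (istep A s).
Proof.
move=> mA ms; have i01 w t : 0 <= istep A s w t <= 1.
  by rewrite /istep /step indicE; case: (_ \in _); case: (_ <= _)%E; rewrite ?mul1r ?mul0r ?lexx ?ler01.
split; last by move=> w t _; case/andP: (i01 w t).
split; last by exists 1 => w t _; case/andP: (i01 w t) => ? ?; rewrite ger0_norm.
apply: cadlag_processZ; first exact: measurable_indic.
exact: cadlag_process_step.
Qed.

Lemma istep_norm A s w : proc_norm T (istep A s) w <= \1_A w.
Proof.
apply: proc_norm_le => // t _; rewrite /istep normrM -[leRHS]mulr1.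
rewrite (@ger0_norm _ (\1_A w)) ?indicE// ler_wpM2l// /step.
by case: (_ <= _)%E; rewrite ?normr1 ?normr0.
Qed.

Lemma istepU A B s : A `&` B = set0 -> istep (A `|` B) s = istep A s + istep B s.
Proof.
move=> AB; apply/funext => w; apply/funext => t.
change (istep (A `|` B) s w t = istep A s w t + istep B s w t).
rewrite /istep -mulrDl; congr (_ * _); rewrite !indicE in_setU.
case: (boolP (w \in A)) => wA; case: (boolP (w \in B)) => wB; rewrite ?addr0 ?add0r//.
by have : (A `&` B) w by [split; apply/set_mem]; rewrite AB.
Qed.

Variables (rho : (Omega -> R) -> R) (lam : (Omega -> \bar R -> R) -> R).
Hypothesis crho : control P rho.
Hypothesis pf : positive_functional T rho lam.

Lemma lam_istep_le A s : measurable A -> measurable_fun setT s ->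
  0 <= lam (istep A s) <= rho \1_A.
Proof.
move=> mA ms; have g := istep_ge0 mA ms; rewrite (pf_ge0 pf)//=.
apply: le_trans (pf_le pf g) _; apply: (control_mono crho).
- by apply: bounded_process_norm => //; case: g.
- exact: bounded_indic.
- by move=> w; rewrite proc_norm_ge0//= istep_norm.
Qed.

Lemma lam_istepU A B s : measurable A -> measurable B -> measurable_fun setT s ->
  A `&` B = set0 -> lam (istep (A `|` B) s) = lam (istep A s) + lam (istep B s).
Proof. by move=> mA mB ms AB; rewrite istepU// (pf_add pf)//; exact: istep_ge0. Qed.

Section Charge.
Variable s : Omega -> \bar R.
Hypothesis ms : measurable_fun setT s.

Definition lam_charge A : \bar R := (lam (istep A s))%:E.

Let lam_charge0 : lam_charge set0 = 0%E.
Proof.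
have := lam_istepU measurable0 measurable0 ms (setI0 set0); rewrite setU0 => H.
by congr EFin; move: H; lra.
Qed.

Let lam_charge_fin A : measurable A -> lam_charge A \is a fin_num.
Proof. by []. Qed.

Let lam_charge_sigma_additive : semi_sigma_additive lam_charge.
Proof.
move=> F mF tF mU.
pose B n := \bigcup_(i in [set i | (n <= i)%N]) F i.
have mB n : measurable (B n) by apply: bigcup_measurable.
have BS n : B n = F n `|` B n.+1.
  apply/seteqP; split => w.
    move=> [i /= ni Fi]; move: ni; rewrite leq_eqVlt => /predU1P[ni|ni].
      by left; rewrite ni.
    by right; exists i.
  by move=> [Fn|[i /= ni Fi]]; [exists n => /=|exists i => //=; exact: ltnW].
have FB n : F n `&` B n.+1 = set0.
  apply/seteqP; split => // w [Fn [i /= ni Fi]].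
  have := tF n i I I => /(_ (ex_intro _ w (conj Fn Fi))) nE.
  by rewrite nE ltnn in ni.
have E n : \sum_(0 <= i < n) lam (istep (F i) s) + lam (istep (B n) s) = lam (istep (\bigcup_i F i) s).
  elim: n => [|n IH].
    by rewrite big_geq// add0r; congr (lam (istep _ s)); apply: eq_bigcupl; split.
  by rewrite big_nat_recr//= -IH [in RHS]BS lam_istepU// addrA.
have B0 : lam (istep (B n) s) @[n --> \oo] --> 0.
  have dB n m : (n <= m)%N -> B m `<=` B n.
    by move=> nm w [i /= mi Fi]; exists i => //=; exact: leq_trans nm mi.
  have B00 : \bigcap_n B n = set0.
    apply/seteqP; split => // w H; have [i _ Fi] := H 0%N I.
    have [j /= ij Fj] := H i.+1 I.
    have := tF i j I I => /(_ (ex_intro _ w (conj Fi Fj))) nE.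
    by rewrite nE ltnn in ij.
  apply: (@squeeze_cvgr _ _ _ _ (fun=> 0) (fun n => rho \1_(B n))).
  - by apply: nearW => n; exact: lam_istep_le.
  - exact: cvg_cst.
  - exact: (control_cvg0 crho).
rewrite (_ : (fun n => _) = fun n => (lam (istep (\bigcup_i F i) s) - lam (istep (B n) s))%:E).
  rewrite /lam_charge -[X in _ --> X%:E]subr0; apply: cvg_EFin; first exact: nearW.
  by apply: cvgB => //; exact: cvg_cst.
by apply/funext => n; rewrite -(E n) addrK /lam_charge -sumEFin.
Qed.

HB.instance Definition _ := isCharge.Build _ _ _ lam_charge
  lam_charge0 lam_charge_fin lam_charge_sigma_additive.

Let lam_charge_dominated : lam_charge `<< P.
Proof.
move=> A nA B mB BA.
have PB : P B = 0%E by exact: nA.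
have := lam_istep_le mB ms; rewrite (control_null crho)// => H.
by congr EFin; apply/eqP; rewrite eq_le andbC.
Qed.

(** In the event [A] the functional is a measure: it is absolutely continuous by
[control_null] and countably additive by [control_cvg0]. *)
Lemma density_exists : exists F : Omega -> R,
  [/\ measurable_fun setT F, L1 P F &
      forall A, measurable A -> lam (istep A s) = mean P (fun w => \1_A w * F w)].
Proof.
pose f := Radon_Nikodym lam_charge P; pose F w := fine (f w).
have fE w : f w = (F w)%:E by rewrite /F fineK//; exact: Radon_Nikodym_fin_num.
have LF : L1 P F.
  apply/L1P; rewrite (_ : EFin \o F = f); first exact: Radon_Nikodym_integrable.
  by apply/funext => w; rewrite fE.
exists F; split=> //; first exact: L1_measurable LF.
move=> A mA; have := Radon_Nikodym_integral lam_charge_dominated mA.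
rewrite -/f integral_mkcond /mean /Rintegral => H.
have -> : lam (istep A s) = fine (lam_charge A) by [].
rewrite [lam_charge A]H; congr fine; apply: eq_integral => w _.
by rewrite /patch fE indicE; case: (_ \in _); rewrite ?mul1r ?mul0r.
Qed.

End Charge.

Variable dens : (Omega -> \bar R) -> Omega -> R.
Hypothesis densP : forall s, measurable_fun setT s ->
  [/\ measurable_fun setT (dens s), L1 P (dens s) &
      forall A, measurable A -> lam (istep A s) = mean P (fun w => \1_A w * dens s w)].

Lemma mean_indic_le0 A xi : measurable A -> L1 P xi -> (forall w, A w -> 0 < xi w) ->
  mean P (fun w => \1_A w * xi w) <= 0 -> P A = 0%E.
Proof.
move=> mA Lx x0 m0; have Lm := L1_bounded_mul (bounded_indic (R := R) mA) Lx.
have p0 w : 0 <= \1_A w * xi w.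
  rewrite indicE; case: (boolP (w \in A)) => [/set_mem/x0/ltW|_]; rewrite ?mul1r ?mul0r//.
have := mean_eq0 Lm p0; move=> /(_ _)/= H.
have {H} : {ae P, forall w, \1_A w * xi w = 0}.
  by apply: H; apply/eqP; rewrite eq_le m0 mean_ge0.
move=> [N [mN PN HN]]; apply/eqP; rewrite eq_le measure_ge0 andbT -PN.
apply: le_measure; rewrite ?inE// => w Aw; apply: HN => /= H.
by have := x0 w Aw; move: H; rewrite indicE mem_set// mul1r => ->; rewrite ltxx.
Qed.

(** On an event where s is at most s', the indicator of [s, T] dominates that of [s', T]. *)
Lemma dens_anti s s' : measurable_fun setT s -> measurable_fun setT s' ->
  {ae P, forall w, (s w <= s' w)%E -> dens s' w <= dens s w}.
Proof.
move=> ms ms'; have [md Ld dE] := densP ms; have [md' Ld' dE'] := densP ms'.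
pose A := [set w | (s w <= s' w)%E] `&` [set w | dens s w < dens s' w].
have mA : measurable A.
  by apply: measurableI; [exact: measurable_lee_set|exact: measurable_ltr_set].
have PA : P A = 0%E.
  apply: (mean_indic_le0 (xi := fun w => (-1) * dens s w + dens s' w)) => //.
  - by apply: L1_add => //; exact: L1Z.
  - by move=> w [_ /=]; rewrite mulN1r addrC subr_gt0.
  rewrite (_ : (fun w => _) = fun w => (-1) * (\1_A w * dens s w) + \1_A w * dens s' w); last first.
    by apply/funext => w; rewrite mulrDr mulrCA.
  have bA := bounded_indic (R := R) mA.
  rewrite mean_lin; [|exact: L1_bounded_mul|exact: L1_bounded_mul].
  rewrite -dE// -dE'// mulN1r addrC subr_le0.
  apply: (pf_mono pf); [exact: istep_ge0| by case: (istep_ge0 mA ms)|].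
  move=> w t tT; rewrite /istep indicE; case: (boolP (w \in A)); last by rewrite !mul0r.
  move=> /set_mem[/= ss' _]; rewrite !mul1r /step ler_nat.
  by case: (leP (s' w) t) => // s't; rewrite (le_trans ss' s't).
exists A; split=> // w /= H; split => /=.
  by apply: contrapT => n; apply: H => /n.
by rewrite ltNge; apply/negP => le; apply: H.
Qed.

Lemma dens_ge0 s : measurable_fun setT s -> {ae P, forall w, 0 <= dens s w}.
Proof.
move=> ms; have [md Ld dE] := densP ms; pose A := [set w | dens s w < 0].
have mA : measurable A by apply: measurable_ltr_set => //; exact: measurable_cst.
exists A; split=> //; last by move=> w /= /negP; rewrite -ltNge.
apply: (mean_indic_le0 (xi := fun w => (-1) * dens s w)) => //; first exact: L1Z.
  by move=> w /=; rewrite mulN1r oppr_gt0.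
have bA := bounded_indic (R := R) mA.
rewrite (_ : (fun w => _) = fun w => (-1) * (\1_A w * dens s w) + 0); last first.
  by apply/funext => w; rewrite addr0 mulrCA.
rewrite mean_lin ?mean_cst; [|exact: L1_bounded_mul|exact: L1_cst].
by rewrite -dE// addr0 mulN1r oppr_le0; case/andP: (lam_istep_le mA ms).
Qed.

Lemma dens_eq s s' : measurable_fun setT s -> measurable_fun setT s' ->
  {ae P, forall w, s w = s' w -> dens s w = dens s' w}.
Proof.
move=> ms ms'; have := dens_anti ms ms'; have := dens_anti ms' ms.
apply: filterS2 => w H H' E; apply/eqP; rewrite eq_le.
by rewrite H ?H'// E.
Qed.

End Density.

(** * Representation of a positive functional *)

Section PointMeasure.
Context {R : realType}.
Variables (b : nat -> R) (K : R) (s : nat -> \bar R).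
Hypothesis b0 : forall j, 0 <= b j.
Hypothesis bK : forall n, \sum_(j < n) b j <= K.

Definition point_measure : set (\bar R) -> \bar R :=
  mseries (fun j => mscale (NngNum (b0 j)) (dirac (s j))) 0.

Let point_measure0 : point_measure set0 = 0%E. Proof. exact: measure0. Qed.
Let point_measure_ge0 A : (0 <= point_measure A)%E. Proof. exact: measure_ge0. Qed.
Let point_measure_sigma_additive : semi_sigma_additive point_measure.
Proof. exact: measure_semi_sigma_additive. Qed.

HB.instance Definition _ := isMeasure.Build _ _ _ point_measure
  point_measure0 point_measure_ge0 point_measure_sigma_additive.

Lemma point_measureE A :
  point_measure A = (\sum_(0 <= j <oo) (b j * \1_A (s j))%:E)%E.
Proof.
rewrite /point_measure /mseries; apply: eq_eseriesr => j _.
by rewrite EFinM.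
Qed.

Lemma point_measure_le A : (point_measure A <= K%:E)%E.
Proof.
rewrite point_measureE; apply: lime_le.
  apply: is_cvg_nneseries => j _ _; by rewrite lee_fin mulr_ge0.
apply: nearW => n; rewrite sumEFin lee_fin big_mkord; apply: le_trans (bK n).
apply: ler_sum => j _; rewrite indicE -[leRHS]mulr1 ler_wpM2l//.
by case: (s j \in A).
Qed.

Let point_measure_fin : fin_num_fun point_measure.
Proof.
move=> A mA; rewrite ge0_fin_numE//; exact: le_lt_trans (point_measure_le A) (ltry _).
Qed.

HB.instance Definition _ := @Measure_isFinite.Build _ _ _ point_measure point_measure_fin.

Definition point_fmeasure : {finite_measure set (\bar R) -> \bar R} := point_measure.

Lemma point_measure_eq0 (A : set (\bar R)) : (forall j, A (s j) -> b j = 0) -> point_measure A = 0%E.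
Proof.
move=> H; rewrite point_measureE; apply: eseries0 => j _ _.
rewrite indicE; case: (boolP (s j \in A)) => [/set_mem/H ->|_]; by rewrite ?mul0r ?mulr0.
Qed.

Lemma point_measure1 t j : s j = t -> (forall i, s i = t -> i <> j -> b i = 0) ->
  point_measure [set t] = (b j)%:E.
Proof.
move=> sj H; rewrite point_measureE; apply/cvg_lim => //.
apply: cvg_near_cst; exists j.+1 => // n /= jn.
rewrite sumEFin big_mkord (bigD1 (Ordinal jn))//= big1 ?addr0.
  by rewrite indicE mem_set// mulr1.
move=> i ij; rewrite indicE; case: (boolP (s i \in [set t : \bar R])) => [/set_mem/= si|_]; last by rewrite mulr0.
rewrite (H i si) ?mul0r// => E.
by move/negP: ij; apply; apply/eqP/val_inj.
Qed.

End PointMeasure.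

Section Representation.
Context {R : realType} {d : measure_display} {Omega : measurableType d}.
Variables (P : probability Omega R) (T : \bar R).
Hypothesis T0 : (0 < T)%E.
Implicit Types (xi : Omega -> R) (s : Omega -> \bar R) (A B : set Omega).
Variables (rho : (Omega -> R) -> R) (lam : (Omega -> \bar R -> R) -> R).
Hypothesis crho : control P rho.
Hypothesis pf : positive_functional T rho lam.
Variable dens : (Omega -> \bar R) -> Omega -> R.
Hypothesis densP : forall s, measurable_fun setT s ->
  [/\ measurable_fun setT (dens s), L1 P (dens s) &
      forall A, measurable A -> lam (istep A s) = mean P (fun w => \1_A w * dens s w)].

Let dg n k : Omega -> R := dens (fun=> grid T n k).
Let d0 : Omega -> R := dens (fun=> 0%E).

Let mcst (t : \bar R) : measurable_fun setT (fun _ : Omega => t).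
Proof. exact: measurable_cst. Qed.
Let mdg n k : measurable_fun setT (dg n k). Proof. by have [] := densP (mcst (grid T n k)). Qed.
Let md0 : measurable_fun setT d0. Proof. by have [] := densP (mcst 0%E). Qed.
Let Ld0 : L1 P d0. Proof. by have [] := densP (mcst 0%E). Qed.


Lemma ae_dens_grid : {ae P, forall w, forall n k, 0 <= dg n k w /\
  forall m l, (grid T n k <= grid T m l)%E -> dg m l w <= dg n k w}.
Proof.
apply/ae_foralln => n; apply/ae_foralln => k.
have H0 := dens_ge0 T0 crho pf densP (mcst (grid T n k)).
suff H1 : {ae P, forall w, forall m l, (grid T n k <= grid T m l)%E -> dg m l w <= dg n k w}.
  by apply: filterS2 H0 H1.
apply/ae_foralln => m; apply/ae_foralln => l.
by apply: filterS (dens_anti pf densP (mcst (grid T n k)) (mcst (grid T m l))) => w H; exact: H.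
Qed.

Variable G : set Omega.
Hypothesis mG : measurable G.
Hypothesis PG : {ae P, forall w, G w}.
Hypothesis G_dens : forall w, G w -> forall n k, 0 <= dg n k w /\
  forall m l, (grid T n k <= grid T m l)%E -> dg m l w <= dg n k w.

Let dg0 n : dg n 0 = d0. Proof. by rewrite /dg grid0. Qed.

(** The mass before [t] of the measure to be constructed. *)
Let N w t : R := \1_G w * (d0 w - dens (fun=> t) w).
Let M w : R := \1_G w * d0 w.

Let NE w n k : G w -> N w (grid T n k) = d0 w - dg n k w.
Proof. by move=> Gw; rewrite /N indicE mem_set// mul1r. Qed.

Let ME w : G w -> M w = d0 w.
Proof. by move=> Gw; rewrite /M indicE mem_set// mul1r. Qed.

Let N_G w t : ~ G w -> N w t = 0.
Proof. by move=> Gw; rewrite /N indicE memNset// mul0r. Qed.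

Let M_ge0 w : 0 <= M w.
Proof.
have [Gw|Gw] := pselect (G w); last by rewrite /M indicE memNset// mul0r.
by rewrite ME// -(dg0 0); have [] := G_dens Gw 0 0.
Qed.

Let N_bd w n k : 0 <= N w (grid T n k) <= M w.
Proof.
have [Gw|Gw] := pselect (G w); last by rewrite N_G// lexx M_ge0.
rewrite NE// ME// -(dg0 0); have [_ H] := G_dens Gw 0 0; have [H0 _] := G_dens Gw n k.
rewrite subr_ge0 lerBlDr lerDl H0 andbT; apply: H; rewrite (grid0 T0).
by case/andP: (grid_times T0 n k).
Qed.

Let mN n k : measurable_fun setT (fun w => N w (grid T n k)).
Proof.
by apply: measurable_funM; [exact: measurable_indic|exact: (measurable_funB md0 (mdg n k))].
Qed.

Let mM : measurable_fun setT M.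
Proof. by apply: measurable_funM => //; exact: measurable_indic. Qed.

Let q w : {finite_measure set (\bar R) -> \bar R} := qmeasure T (N w) (M w).
Let m w : smeasure (R := R) := charge_of_finite_measure (q w).

Let rm : random_measure m.
Proof. by move=> A mA; exact: measurable_qmeasure. Qed.

Let Mm w : Mspace T (m w).
Proof. by move=> A mA AT; exact: qmeasure_times. Qed.

Let qfin w (E : set (\bar R)) : measurable E -> q w E = (fine (q w E))%:E.
Proof. by move=> mA; rewrite fineK//; exact: fin_num_measure. Qed.

Let qT w : q w setT = (M w)%:E. Proof. exact: qmeasureT. Qed.

Let mge (t : \bar R) : measurable [set r | (t <= r)%E].
Proof.
rewrite (_ : [set r | _] = [set` `[t, +oo[]); first exact: emeasurable_itv.
by apply/seteqP; split => r /=; rewrite in_itv/= andbT.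
Qed.

(** The mass from the time [s] on. *)
Let later s w : R := sintegral T (m w) (step (s w)).

Let laterE s w : later s w = M w - fine (q w [set r | (r < s w)%E]).
Proof.
rewrite /later (_ : step (s w) = \1_[set r | (s w <= r)%E]); last first.
  by apply/funext => r; rewrite /step indicE mem_setb.
rewrite sintegral_indic//.
have mlt := measurable_ray (s w).
have : (q w setT = q w [set r | (r < s w)%E] + q w [set r | (s w <= r)%E])%E.
  rewrite -measureU//; last first.
    by apply/seteqP; split => // r [/= rs]; rewrite leNgt rs.
  congr (q w _); apply/seteqP; split => // r _ /=.
  by case: (ltP r (s w)) => H; [left|right].
rewrite qT (qfin w mlt) (qfin w (mge _)) => -[->].
by rewrite [X in _ = X - _]addrC addrK.
Qed.

(** The density at a random time counts the whole mass after this time and a part of the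
atom at this time. *)
Let sandwich s : measurable_fun setT s -> (forall w, times T (s w)) ->
  {ae P, forall w, 0 <= later s w - dens s w <= fine (m w [set s w])}.
Proof.
move=> ms sT.
have H1 : {ae P, forall w, forall n k, (grid T n k <= s w)%E -> dens s w <= dg n k w}.
  apply/ae_foralln => n; apply/ae_foralln => k.
  by apply: filterS (dens_anti pf densP (mcst (grid T n k)) ms) => w H; exact: H.
have H2 : {ae P, forall w, forall n k, (s w <= grid T n k)%E -> dg n k w <= dens s w}.
  apply/ae_foralln => n; apply/ae_foralln => k.
  by apply: filterS (dens_anti pf densP ms (mcst (grid T n k))) => w H; exact: H.
have H3 := dens_ge0 T0 crho pf densP ms.
apply: filterS (filterI PG (filterI H1 (filterI H2 H3))) => w [Gw [{}H1 [{}H2 {}H3]]].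
have /andP[s0 sTw] := sT w; have mlt := measurable_ray (s w).
have c0 : 0 <= M w - dens s w.
  by rewrite ME// subr_ge0 -(dg0 0); apply: H1; rewrite (grid0 T0).
have up : fine (q w [set r | (r < s w)%E]) <= M w - dens s w.
  rewrite -lee_fin -qfin//; apply: qmeasure_lt_le => // n k /ltW ns.
  by rewrite NE// ME// lerB// H1.
have mle : measurable [set r | (r <= s w)%E].
  rewrite (_ : [set r | _] = [set` `]-oo, s w]]); first exact: emeasurable_itv.
  by apply/seteqP; split => r /=; rewrite in_itv.
have lo : M w - dens s w <= fine (q w [set r | (r <= s w)%E]).
  rewrite -lee_fin -qfin//; have [sT'|] := ltP (s w) T.
    apply: qmeasure_le_ge; rewrite ?c0 ?lerBlDr ?lerDl ?s0//.
    by move=> n k /ltW ns; rewrite NE// ME// lerB// H2.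
  move=> Ts; have -> : q w [set r | (r <= s w)%E] = q w setT.
    apply: (@qmeasure_ext _ T T0) => //.
    apply/seteqP; split => r [_ tr]; split => //=.
    by have /andP[_ rT] := tr; exact: le_trans rT Ts.
  by rewrite [leRHS]qT lee_fin lerBlDr lerDl.
have split_le : fine (q w [set r | (r <= s w)%E]) =
    fine (q w [set r | (r < s w)%E]) + fine (q w [set s w]).
  have ms1 := emeasurable_set1 (s w).
  rewrite -fineD ?fin_num_measure// -measureU//; last first.
    by apply/seteqP; split => // r [/= rs re]; rewrite re ltxx in rs.
  congr (fine (q w _)); apply/seteqP; split => r /=.
    by rewrite le_eqVlt => /predU1P[->|]; [right|left].
  by case=> [/ltW|->].
rewrite laterE [m w _]/(q w _); move: up lo; rewrite split_le; lra.
Qed.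

Let sj j w := atom_time T m j w.

Let msj j : measurable_fun setT (sj j). Proof. exact: measurable_atom_time. Qed.
Let sjT j w : times T (sj j w). Proof. exact: atom_time_times. Qed.

Let mlater s : measurable_fun setT s -> measurable_fun setT (later s).
Proof.
move=> ms; have cs := @cadlag_process_step R d Omega T s ms.
exact: (@measurable_sintegral _ _ _ T T0 (fun w => step (s w))).
Qed.

(** Every atom is counted at its first occurrence in the enumeration; the time 0 is left out
since the measure that integrates left limits must not charge it. *)
Let fresh j : set Omega :=
  [set w | sj j w <> 0%E] `&` \bigcap_(i in [set i | (i < j)%N]) [set w | sj i w <> sj j w].

Let measurable_neq (f g : Omega -> \bar R) : measurable_fun setT f -> measurable_fun setT g ->
  measurable [set w | f w <> g w].
Proof.
move=> mf mg; rewrite (_ : [set w | _] = [set w | (f w < g w)%E] `|` [set w | (g w < f w)%E]).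
  by apply: measurableU; exact: measurable_lte_set.
apply/seteqP; split => w /=.
  by case: (ltgtP (f w) (g w)) => //; [left|right].
by case=> H E; rewrite E ltxx in H.
Qed.

Let mfresh j : measurable (fresh j).
Proof.
apply: measurableI; first by apply: measurable_neq => //; exact: measurable_cst.
by apply: bigcap_measurableType => i _; exact: measurable_neq.
Qed.

(** The part of the atom that the density does not count, made nonnegative and at most the
mass of the atom for every outcome. *)
Let b w j : R := \1_(fresh j) w *
  Num.max 0 (Num.min (later (sj j) w - dens (sj j) w) (fine (m w [set sj j w]))).

Let b0 w j : 0 <= b w j.
Proof. by rewrite /b mulr_ge0// le_max lexx. Qed.

Let mass0 w t : 0 <= fine (m w [set t]).
Proof. by apply: fine_ge0; rewrite [m w _]/(q w _) measure_ge0. Qed.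

Let b_fresh w j : ~ fresh j w -> b w j = 0.
Proof. by move=> nf; rewrite /b indicE memNset// mul0r. Qed.

Let b_mass w j : b w j <= fine (m w [set sj j w]).
Proof.
have [fj|/b_fresh ->//] := pselect (fresh j w).
by rewrite /b indicE mem_set// mul1r ge_max mass0/= ge_min lexx orbT.
Qed.

Let mb j : measurable_fun setT (fun w => b w j).
Proof.
apply: measurable_funM; first exact: measurable_indic.
apply: measurable_maxr; first exact: measurable_cst.
apply: measurable_minr; last exact: (measurable_mass_at T0 rm Mm (msj j) (sjT j)).
by apply: measurable_funB; [exact: mlater|have [] := densP (msj j)].
Qed.

Let b_sum w n : \sum_(j < n) b w j <= M w.
Proof.
pose S k : set (\bar R) := [set t | exists2 j, (j < k)%N & sj j w = t].
have mS k : measurable (S k).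
  apply: countable_emeasurable; apply: finite_set_countable.
  by rewrite /S; exact: (finite_image (fun j => sj j w) (finite_II k)).
suff : \sum_(j < n) b w j <= fine (q w (S n)).
  move=> H; apply: le_trans H _; rewrite -lee_fin -qfin// -qT.
  by apply: le_measure; rewrite ?inE.
elim: n => [|n IH]; first by rewrite big_ord0 fine_ge0.
rewrite big_ord_recr/=; have [fn|/b_fresh ->] := pselect (fresh n w); last first.
  rewrite addr0; apply: le_trans IH _; rewrite fine_le ?fin_num_measure//.
  apply: le_measure; rewrite ?inE// => t [j jn jt]; exists j => //; exact: ltnW.
have ms1 := emeasurable_set1 (sj n w).
have -> : S n.+1 = S n `|` [set sj n w].
  apply/seteqP; split => t.
    move=> [j]; rewrite ltnS leq_eqVlt => /predU1P[-> <-|jn jt]; first by right.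
    by left; exists j.
  by case=> [[j jn jt]|/= ->]; [exists j => //; exact: ltnW|exists n].
rewrite [q w _]measureU//; last first.
  by apply/seteqP; split => // t [[j jn jt] /= tn]; have [_ /(_ j jn)] := fn; apply; rewrite jt.
by rewrite fineD ?fin_num_measure// lerD//; exact: b_mass.
Qed.

Let pm w : {finite_measure set (\bar R) -> \bar R} :=
  point_fmeasure (sj ^~ w) (b0 w) (b_sum w).
Let ut w : smeasure (R := R) := charge_of_finite_measure (pm w).
Let uu w : smeasure (R := R) := cadd (cscale (-1) (ut w)) (m w).

(** The second measure collects the parts of the atoms of [m] that the densities do not
count, and the first one is the rest of [m]. *)
Definition representing_pair : @rmpair R d Omega := (uu, ut).

Let rut : random_measure ut.
Proof.
move=> A mA; rewrite (_ : (fun w => _) = fun w => (\sum_(0 <= j <oo) (b w j * \1_A (sj j w))%:E)%E).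
  apply: ge0_emeasurable_sum => [j w _ _|j _]; first by rewrite lee_fin mulr_ge0.
  apply/measurable_EFinP/measurable_funM => //.
  have mi : measurable_fun setT (\1_A : \bar R -> R) by exact: measurable_indic.
  exact: (measurableT_comp mi (msj j)).
by apply/funext => w; exact: point_measureE.
Qed.

Let Mut w : Mtilde T (ut w).
Proof.
split.
- move=> A mA AT; apply: point_measure_eq0 => j Aj.
  by have : (A `&` times T) (sj j w) by []; rewrite AT.
- by apply: point_measure_eq0 => j /= sj0; apply: b_fresh => -[].
- exists (range (sj ^~ w)); first exact: card_image_le.
  move=> A mA AC; apply: point_measure_eq0 => j Aj.
  have : (A `&` range (sj ^~ w)) (sj j w) by split => //; exists j.
  by rewrite AC.
Qed.

Let Mu w : Mspace T (uu w).
Proof. by apply: Mspace_lin => //; case: (Mut w). Qed.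

Let admissible_uv : admissible_pair T representing_pair.
Proof. by split=> //; exact: random_measure_lin. Qed.

Let pair_norm_le w : pair_norm representing_pair w <= 3 * M w.
Proof.
have pmT : (pm w setT <= (M w)%:E)%E by exact: point_measure_le.
have t1 : tv_norm (uu w) <= M w + M w.
  rewrite -lee_fin; apply: le_trans (tv_le (a := q w) (b := pm w) _) _.
    move=> A mA; rewrite smeasure_linE mulN1e addeC; congr (_ - _)%E.
  by rewrite EFinD; apply: leeD => //; rewrite qT.
have t2 : tv_norm (ut w) <= M w.
  rewrite -lee_fin; apply: le_trans (tv_le (a := pm w) (b := mmul (NngNum (lexx 0)) (pm w)) _) _.
    by move=> A mA; rewrite mmulE/= mul0e sube0.
  by rewrite mmulE/= mul0e adde0.
by rewrite /pair_norm; lra.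
Qed.

Lemma representing_L1M : L1M P T representing_pair.
Proof.
have [r1 r2 MM] := admissible_uv; split=> //.
have LM : L1 P M by apply: L1_bounded_mul => //; exact: bounded_indic.
apply: (L1_le _ (L1Z 3 LM)); first exact: (measurable_pair_norm T0 admissible_uv).
apply: ae_true => w; rewrite ger0_norm ?pair_norm_ge0//.
by apply: le_trans (pair_norm_le w) (ler_norm _).
Qed.

Let pairing_step s w : times T (s w) ->
  path_pairing T (fun w => step (s w)) representing_pair w =
  later s w - fine (ut w [set s w]).
Proof.
move=> sT; have cs : cadlag T (step (s w) : \bar R -> R) by exact: cadlag_step.
rewrite path_pairingE//= sintegral_lin; last exact: bm_cadlag.
have [Mt _ _] := Mut w.
by rewrite -(sintegral_step_jump T0 Mt sT) -/(later s w) mulN1r; lra.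
Qed.

Let pairing_dens s : measurable_fun setT s -> (forall w, times T (s w)) ->
  {ae P, forall w, path_pairing T (fun w => step (s w)) representing_pair w = dens s w}.
Proof.
move=> ms sT.
have E1 : {ae P, forall w, forall j, sj j w = s w -> dens (sj j) w = dens s w}.
  apply/ae_foralln => j; exact: (dens_eq pf densP (msj j) ms).
have E0 : {ae P, forall w, 0%E = s w -> d0 w = dens s w}.
  exact: (dens_eq pf densP (mcst 0%E) ms).
have E2 : {ae P, forall w, forall j, 0 <= later (sj j) w - dens (sj j) w <= fine (m w [set sj j w])}.
  apply/ae_foralln => j; exact: sandwich.
have E3 := sandwich ms sT.
apply: filterS (filterI PG (filterI E0 (filterI E1 (filterI E2 E3)))) => w [Gw [{}E0 [{}E1 [{}E2 {}E3]]]].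
rewrite pairing_step//.
have later_ext s' : s' w = s w -> later s' w = later s w by move=> E; rewrite /later E.
have [m0|m0] := eqVneq (m w [set s w]) 0%E.
  move: E3; rewrite m0 => /= /andP[l0 l1].
  have -> : ut w [set s w] = 0%E.
    apply: point_measure_eq0 => j /= sjs; apply/eqP; rewrite eq_le b0 andbT.
    by apply: le_trans (b_mass w j) _; rewrite sjs m0.
  by rewrite subr0; lra.
have [j0 j0s] := atom_time_onto T0 (Mm w) m0.
have exj : exists j, sj j w == s w by exists j0; apply/eqP.
pose j := ex_minn exj; have [js jmin] : sj j w = s w /\ forall i, sj i w = s w -> (j <= i)%N.
  by rewrite /j; case: ex_minnP => k /eqP ks kmin; split=> // i /eqP /kmin.
have -> : ut w [set s w] = (b w j)%:E.
  apply: point_measure1 => // i si ij; apply: b_fresh => -[_ /(_ j)]; apply; last by rewrite js si.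
  by rewrite /= ltn_neqAle jmin// andbT; apply/eqP => E; apply: ij; rewrite E.
rewrite /=; have [s0|s0] := eqVneq (s w) 0%E.
  rewrite b_fresh; last by move=> [H _]; apply: H; rewrite js.
  rewrite subr0 laterE s0 -E0// (_ : [set r | _] = [set r | (r < 0)%E])//.
  have -> : q w [set r : \bar R | (r < 0)%E] = 0%E.
    apply: qmeasure_times => //; apply/seteqP; split => // r [/= r0 /andP[r0' _]].
    by rewrite ltNge r0' in r0.
  by rewrite subr0 ME.
have fj : fresh j w.
  split; first by rewrite /= js; exact/eqP.
  by move=> i /= ij E; have := jmin i; rewrite E => /(_ js); rewrite leqNgt ij.
have /andP[e1 e2] := E2 j.
rewrite /b indicE mem_set// mul1r min_l// max_r// (later_ext _ js) E1//.
by rewrite opprB addrC subrK.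
Qed.

Lemma representing_pairE s A : measurable_fun setT s -> (forall w, times T (s w)) ->
  measurable A -> lam (istep A s) = mean P (path_pairing T (istep A s) representing_pair).
Proof.
move=> ms sT mA; have [md Ld ->//] := densP ms.
have bA := bounded_indic (R := R) mA.
have by_ : bounded_process T (istep A s) by case: (@istep_ge0 _ _ _ T A s mA ms).
apply: mean_ae_eq; first exact: L1_bounded_mul.
  by apply: bounded_pairing_L1 => //; exact: representing_L1M.
apply: filterS (pairing_dens ms sT) => w <-; apply/esym/path_pairingZ => //.
exact: cadlag_step.
Qed.

End Representation.

(** The exceptional set of [ae_dens_grid] is first enlarged to a measurable null set, outside
of which the measures are constructed and on which they vanish. *)
Lemma positive_representation (R : realType) (d : measure_display) (Omega : measurableType d)
    (P : probability Omega R) (T : \bar R) (rho : (Omega -> R) -> R)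
    (lam : (Omega -> \bar R -> R) -> R) :
  (0 < T)%E -> control P rho -> positive_functional T rho lam ->
  exists2 v, L1M P T v & forall s A, measurable_fun setT s -> (forall w, times T (s w)) ->
    measurable A -> lam (istep A s) = mean P (path_pairing T (istep A s) v).
Proof.
move=> T0 crho pf.
have /choice[dens densP] : forall s : Omega -> \bar R, exists F : Omega -> R,
    measurable_fun setT s -> [/\ measurable_fun setT F, L1 P F &
    forall A, measurable A -> lam (istep A s) = mean P (fun w => \1_A w * F w)].
  move=> s; have [ms|ms] := pselect (measurable_fun setT s); last by exists (fun=> 0).
  by have [F HF] := density_exists T0 crho pf ms; exists F.
have [N [mN PN HN]] := ae_dens_grid T0 crho pf densP.
have mG : measurable (~` N) by exact: measurableC.
have PG : {ae P, forall w, (~` N) w}.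
  by exists N; split=> // w /= H; apply: contrapT.
have GG w : (~` N) w -> forall n k, 0 <= dens (fun=> grid T n k) w /\
    forall m l, (grid T n k <= grid T m l)%E -> dens (fun=> grid T m l) w <= dens (fun=> grid T n k) w.
  by move=> Nw; apply: contrapT => H; apply: Nw; exact: HN.
exists (@representing_pair _ _ _ T T0 dens (~` N) GG).
  exact: (representing_L1M T0 densP mG GG).
by move=> s A ms sT mA; exact: (representing_pairE T0 crho pf).
Qed.

(** * Functionals that vanish on stochastic intervals *)

Section Vanishing.
Context {R : realType} {d : measure_display} {Omega : measurableType d}.
Variables (P : probability Omega R) (T : \bar R).
Hypothesis T0 : (0 < T)%E.
Variables (rho : (Omega -> R) -> R) (phi : (Omega -> \bar R -> R) -> R).
Hypothesis crho : control P rho.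
Hypothesis phi_lin : forall (a : R) x y, bounded_process T x -> bounded_process T y ->
  phi (a *: x + y) = a * phi x + phi y.
Hypothesis phi_le : forall y, bounded_process T y -> `|phi y| <= rho (proc_norm T y).
Hypothesis phi_istep : forall s A, measurable_fun setT s -> (forall w, times T (s w)) ->
  measurable A -> phi (istep A s) = 0.
Implicit Types (xi : Omega -> R) (x y z : Omega -> \bar R -> R) (s : Omega -> \bar R).

Let null y := bounded_process T y /\ phi y = 0.

Let null_lin (a : R) x y : null x -> null y -> null (a *: x + y).
Proof.
move=> [bx px] [by_ py]; split; first exact: bounded_process_lin.
by rewrite phi_lin// px py mulr0 addr0.
Qed.

Let null0 : null 0.
Proof.
split; first exact: bounded_process0.
by have := phi_lin 1 (bounded_process0 T) (bounded_process0 T); rewrite scaler0 addr0; lra.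
Qed.

Let null_approx y (K : R) : 0 <= K -> bounded_process T y ->
  (forall e, 0 < e -> exists z B, [/\ null z, measurable B, rho \1_B <= e &
     forall w t, times T t -> `|y w t - z w t| <= e + K * \1_B w]) -> null y.
Proof.
move=> K0 by_ H; split=> //; apply/eqP; rewrite -normr_le0.
have b1 : @bounded_rv R d Omega (fun=> 1).
  by split; [exact: measurable_cst|exists 1 => w; rewrite normr1].
have b0 : @bounded_rv R d Omega (fun=> 0).
  by split; [exact: measurable_cst|exists 0 => w; rewrite normr0].
have rho0 : rho (fun=> 0) = 0.
  have := control_null crho measurable0 (measure0 P); rewrite (_ : \1_set0 = (fun=> 0))//.
  by apply/funext => w; rewrite indicE in_set0.
have r1 : 0 <= rho (fun=> 1) by exact: (control_ge0 crho).
suff Hle e : 0 < e -> `|phi y| <= (rho (fun=> 1) + K) * e.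
  apply/ler_addgt0Pr => e e0; rewrite add0r.
  have c0 : 0 < rho (fun=> 1) + K + 1 by rewrite ltr_wpDl// addr_ge0.
  apply: le_trans (Hle (e / (rho (fun=> 1) + K + 1)) _) _; first by rewrite divr_gt0.
  by rewrite mulrCA ler_piMr ?(ltW e0)// ler_pdivrMr// mul1r lerDl.
move=> e0; have [z [B [[bz pz] mB rB yz]]] := H e e0.
have bB := bounded_indic (R := R) mB.
have -> : phi y = phi (y - z).
  by rewrite addrC -scaleN1r phi_lin// pz mulr0 add0r.
have byz : bounded_process T (y - z) by exact: bounded_process_sub.
have bK : bounded_rv (fun w => K * \1_B w + 0) by exact: bounded_rv_lin.
have bKe : bounded_rv (fun w => e * 1 + (K * \1_B w + 0)) by exact: bounded_rv_lin.
apply: le_trans (phi_le byz) _.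
apply: (@le_trans _ _ (rho (fun w => e * 1 + (K * \1_B w + 0)))).
  apply: (control_mono crho) => //; first exact: bounded_process_norm.
  move=> w; rewrite proc_norm_ge0//= mulr1 addr0.
  by apply: proc_norm_le => // t tT; exact: yz.
apply: le_trans (control_lin crho (ltW e0) b1 bK) _.
apply: (@le_trans _ _ (e * rho (fun=> 1) + (K * rho \1_B + rho (fun=> 0)))).
  by rewrite lerD2l; exact: (control_lin crho).
rewrite rho0 addr0 mulrDl mulrC lerD2l; exact: ler_wpM2l.
Qed.

Let null_sum n (c : nat -> R) (F : nat -> Omega -> \bar R -> R) :
  (forall k, null (F k)) -> null (fun w t => \sum_(k < n) c k * F k w t).
Proof.
move=> nF; elim: n => [|n IH].
  rewrite (_ : (fun _ _ => _) = 0)//.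
  by apply/funext => w; apply/funext => t; rewrite big_ord0.
rewrite (_ : (fun _ _ => _) = c n *: F n + (fun w t => \sum_(k < n) c k * F k w t)).
  exact: null_lin.
by apply/funext => w; apply/funext => t; rewrite big_ord_recr/= addrC.
Qed.

Let layers_full (e x : R) n : 0 < e -> n%:R * e <= x ->
  \sum_(k < n) e * (k.+1%:R * e <= x)%R%:R = n%:R * e.
Proof.
move=> e0 nx; rewrite (eq_bigr (fun=> e)) => [|k _].
  by rewrite sumr_const card_ord mulr_natl.
rewrite (_ : (_ <= x) = true) ?mulr1//; apply: le_trans nx.
by rewrite ler_wpM2r ?ler_nat ?(ltW e0).
Qed.

(** Rounding down to multiples of [e] as a sum of indicators: a bounded random variable is
uniformly approximated by combinations of indicators. *)
Let layers (e x : R) n : 0 < e -> 0 <= x <= n.+1%:R * e ->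
  0 <= x - \sum_(k < n) e * (k.+1%:R * e <= x)%R%:R <= e.
Proof.
move=> e0; elim: n => [|n IH] /andP[x0 xn].
  by rewrite big_ord0 subr0 x0; move: xn; rewrite mul1r.
have [xs|xs] := leP (n.+1%:R * e) x.
  rewrite (layers_full e0 xs) subr_ge0 xs lerBlDr.
  by move: xn; rewrite -[in X in X -> _](addn1 n.+1) natrD mulrDl mul1r addrC.
rewrite big_ord_recr/= [(n.+1%:R * e <= x)%R]leNgt xs/= mulr0 addr0; apply: IH.
by rewrite x0 ltW.
Qed.

Let null_rv_step xi s : bounded_rv xi -> measurable_fun setT s ->
  (forall w, times T (s w)) -> null (fun w t => xi w * step (s w) t).
Proof.
move=> bxi ms sT; have [mxi [M' HM']] := bxi; pose M : R := `|M'|.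
have M0 : 0 <= M by exact: normr_ge0.
have HM w : `|xi w| <= M by apply: le_trans (HM' w) (ler_norm _).
apply: (null_approx (lexx 0)).
  have cs := @cadlag_process_step R d Omega T s ms.
  split; first exact: cadlag_processZ.
  exists M => w t tT; rewrite normrM -[leRHS]mulr1 ler_pM// /step.
  by case: (_ <= _)%E; rewrite ?normr1 ?normr0.
move=> e e0; have [n nM] : exists n : nat, 2 * M <= n.+1%:R * e.
  exists (Num.truncn (2 * M / e)); rewrite -ler_pdivrMr//; exact/ltW/truncnS_gt.
pose A k : set Omega := [set w | k.+1%:R * e <= xi w + M].
have mA k : measurable (A k).
  by apply: measurable_ler_set; [exact: measurable_cst|exact: measurable_funD].
have nI B : measurable B -> null (istep B s).
  move=> mB; split; last exact: phi_istep.
  by case: (@istep_ge0 _ _ _ T _ _ mB ms).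
exists ((- M) *: istep setT s + (fun w t => \sum_(k < n) e * istep (A k) s w t)), set0.
split=> //.
- apply: null_lin; first exact: nI.
  by apply: (@null_sum n (fun=> e) (fun k => istep (A k) s)) => k; exact: nI.
- by rewrite (control_null crho) ?(ltW e0).
move=> w t tT; rewrite indic0 mulr0 addr0.
have -> : ((- M) *: istep setT s + (fun w t => \sum_(k < n) e * istep (A k) s w t)) w t =
    (- M + \sum_(k < n) e * (k.+1%:R * e <= xi w + M)%R%:R) * step (s w) t.
  rewrite mulrDl mulr_suml; congr (_ + _).
    by rewrite -[LHS]/(- M * istep setT s w t) /istep indicT mul1r.
  by apply: eq_bigr => k _; rewrite /istep indicE mem_setb mulrA.
rewrite -mulrBl normrM; set S := \sum_(k < n) _.
have : 0 <= xi w + M - S <= e.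
  apply: layers => //; have := HM w; rewrite ler_norml => /andP[h1 h2].
  by apply/andP; split; lra.
move=> /andP[S0 S1]; rewrite -[leRHS]mulr1; apply: ler_pM => //.
  by rewrite (_ : _ - _ = xi w + M - S) ?ger0_norm//; lra.
by rewrite /step; case: (_ <= _)%E; rewrite ?normr1 ?normr0.
Qed.

(** The first time after [s] at which the path has moved by more than [e] from its value at
[s], the grid points being sufficient to detect this by right-continuity. *)
Definition next (e : R) (f : \bar R -> R) (s : \bar R) : \bar R :=
  quantile T (fun t => (s < t)%E%:R * `|f t - f s|) e.

Section Path.
Variables (f : \bar R -> R) (e : R).
Hypothesis cf : cadlag T f.
Hypothesis e0 : 0 < e.
Implicit Types t r : \bar R.

Let next_lt r t : (t <= T)%E -> (next e f r < t)%E ->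
  exists q, [/\ (r < q < t)%E & e < `|f q - f r|].
Proof.
move=> tT /quantile_lt[|[n [k [gt]]]]; first by rewrite ltNge tT.
case: (ltP r (grid T n k)) => rg; last by rewrite mul0r ltNge (ltW e0).
by rewrite mul1r => eg; exists (grid T n k); rewrite rg gt.
Qed.

Let next_gt r : (0 <= r < T)%E -> (r < next e f r)%E.
Proof.
move=> rT; have [q /andP[rq qT] Hq] := cadlag_right cf rT e0.
apply: lt_le_trans rq _; rewrite leNgt; apply/negP => /(next_lt qT)[a [/andP[ra aq]]].
by rewrite ltNge ltW// Hq// (ltW ra).
Qed.

Lemma next_ge r : times T r -> (r <= next e f r)%E.
Proof.
move=> /andP[r0 rT]; have [->|rT'] := eqVneq r T.
  have /andP[_] := quantile_times T0 (fun t => (T < t)%E%:R * `|f t - f T|) e.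
  rewrite leNgt; apply: contraNle => H; have [q [/andP[Tq qT] _]] := next_lt (lexx T) H.
  by have := lt_trans Tq qT; rewrite ltxx.
by apply/ltW/next_gt; rewrite r0 lt_neqAle rT' rT.
Qed.

Let next_le r t : times T r -> (r <= t)%E -> (t < next e f r)%E -> `|f t - f r| <= e.
Proof.
move=> /andP[r0 rT] rt tn.
have /andP[_ nT] := quantile_times T0 (fun t => (r < t)%E%:R * `|f t - f r|) e.
have tT : (0 <= t < T)%E by rewrite (le_trans r0 rt) (lt_le_trans tn nT).
apply/ler_addgt0Pr => c c0; have [q /andP[tq qT] Hq] := cadlag_right cf tT c0.
have t0 : (0 <= t)%E by case/andP: tT.
have tm : (t < Order.min q (next e f r))%E by rewrite lt_min tq.
have mT : (Order.min q (next e f r) <= T)%E by rewrite ge_min qT.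
have [n [k /andP[tg]]] := grid_dense T0 t0 tm mT; rewrite lt_min => /andP[gq gn].
have H1 : `|f (grid T n k) - f t| < c by apply: Hq; rewrite (ltW tg).
have H2 : `|f (grid T n k) - f r| <= e.
  rewrite leNgt; apply/negP => H; move: gn; rewrite ltNge => /negP; apply.
  rewrite leNgt; apply/negP => gn.
  have : (next e f r < next e f r)%E; last by rewrite ltxx.
  apply/quantile_lt; right; exists n, k; split=> //.
  by rewrite (le_lt_trans rt tg) mul1r.
rewrite (_ : f t - f r = (f (grid T n k) - f r) - (f (grid T n k) - f t)); last by lra.
by apply: le_trans (ler_normB _ _) _; rewrite lerD// ltW.
Qed.

Lemma iter_next_times k : times T (iter k (next e f) 0%E).
Proof. by case: k => [|k]; [exact: times0|exact: quantile_times]. Qed.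

(** Oscillations larger than [e] cannot accumulate at a time where the left limit exists. *)
Lemma iter_next_reach : exists k, iter k (next e f) 0%E = T.
Proof.
suff [k Tk] : exists k, (T <= iter k (next e f) 0)%E.
  exists k; apply/eqP; rewrite eq_le Tk andbT.
  by case/andP: (iter_next_times k).
apply: (@time_induction _ T T0 [set t | exists k, (t <= iter k (next e f) 0)%E]) => /=.
- by exists 0%N.
- move=> t /andP[t0 tT] [k tk]; have [kT|kT] := eqVneq (iter k (next e f) 0%E) T.
    by exists T; rewrite ?tT ?lexx// => r /andP[_ rT]; exists k; rewrite kT.
  have /andP[k0 kT'] := iter_next_times k.
  have kn : (iter k (next e f) 0 < iter k.+1 (next e f) 0)%E.
    by apply: next_gt; rewrite k0 lt_neqAle kT kT'.
  exists (iter k.+1 (next e f) 0%E).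
    rewrite (le_lt_trans tk kn)/=.
    by case/andP: (iter_next_times k.+1).
  by move=> r /andP[_ rk]; exists k.+1.
- move=> t tT H; have /andP[t0 tT'] := tT.
  have e2 : 0 < e / 2 by rewrite divr_gt0.
  have [s /andP[s0 st] Hs] := cadlag_leftP cf tT e2.
  have [r /andP[sr rt]] := ereal_dense s0 st.
  have [|k rk] := H r; first by rewrite rt andbT (le_trans s0 (ltW sr)).
  have [tk|kt] := leP t (iter k (next e f) 0%E); first by exists k.
  exists k.+1; rewrite leNgt; apply/negP => /(next_lt tT')[q [/andP[kq qt]]].
  have H1 := Hs q; have H2 := Hs (iter k (next e f) 0%E).
  rewrite ltNge => /negP; apply.
  have {}H1 : `|f q - left_lim f t| < e / 2.
    by apply: H1; rewrite qt andbT (lt_trans (lt_le_trans sr rk) kq).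
  have {}H2 : `|f (iter k (next e f) 0%E) - left_lim f t| < e / 2.
    by apply: H2; rewrite kt andbT (lt_le_trans sr rk).
  rewrite (_ : f q - _ = (f q - left_lim f t) - (f (iter k (next e f) 0%E) - left_lim f t)); last by lra.
  by apply: le_trans (ler_normB _ _) _; lra.
- exact: timesT.
Qed.

Let it k := iter k (next e f) 0%E.

Lemma iter_next_approx k t : times T t ->
  (forall j, (j <= k)%N -> (it k <= t)%E -> (it j <= t)%E) /\
  ((it k <= t)%E -> \sum_(i < k) f (it i) * (step (it i) t - step (it i.+1) t) = 0) /\
  ((t < it k)%E -> `|f t - \sum_(i < k) f (it i) * (step (it i) t - step (it i.+1) t)| <= e).
Proof.
move=> tT; elim: k => [|k [IH0 [IH1 IH2]]].
  split; first by move=> j; rewrite leqn0 => /eqP ->.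
  split; first by rewrite big_ord0.
  by rewrite ltNge; case/andP: tT => ->.
have kk : (it k <= it k.+1)%E by apply: next_ge; exact: iter_next_times.
split.
  move=> j; rewrite leq_eqVlt => /predU1P[->//|]; rewrite ltnS => jk kt.
  by apply: IH0 => //; exact: le_trans kk kt.
rewrite big_ord_recr/=; split=> [kt|tk].
  have kt' := le_trans kk kt.
  by rewrite IH1// add0r /step kt kt' subrr mulr0.
have sk : step (it k.+1) t = 0 :> R by rewrite /step leNgt tk.
rewrite sk subr0; have [kt|tk'] := leP (it k) t.
  rewrite IH1// add0r /step kt mulr1.
  by apply: next_le => //; exact: iter_next_times.
have -> : step (it k) t = 0 :> R by rewrite /step leNgt tk'.
by rewrite mulr0 addr0; exact: IH2.
Qed.

End Path.

(** Between successive times at which it moves by more than [e], a path is within [e] of a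
constant.  Off an event of small [rho], finitely many of these times reach [T], and the
process is within [e] of a combination of indicators of stochastic intervals. *)
Lemma vanishing y : bounded_process T y -> phi y = 0.
Proof.
move=> by_; suff [] : null y by [].
have [cy [M' HM']] := by_; have [cyw _] := cy; pose M : R := `|M'|.
have M0 : 0 <= M by exact: normr_ge0.
have HM w t : times T t -> `|y w t| <= M.
  by move=> tT; apply: le_trans (HM' w t tT) (ler_norm _).
apply: (null_approx M0) => // e e0.
pose s k w := iter k (next e (y w)) 0%E.
have sT k w : times T (s k w) by exact: iter_next_times.
have ms k : measurable_fun setT (s k).
  elim: k => [|k IH]; first exact: measurable_cst.
  apply: (@measurable_quantile _ T _ _ (fun w t => (s k w < t)%E%:R * `|y w t - y w (s k w)|) (fun=> e)) => //.
  move=> n l; apply: measurable_funM.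
    rewrite (_ : (fun w => _) = \1_[set w | (s k w < grid T n l)%E]).
      by apply: measurable_indic; apply: measurable_lte_set => //; exact: measurable_cst.
    by apply/funext => w; rewrite indicE mem_setb.
  apply: measurableT_comp => //; apply: measurable_funB.
    exact: (process_at cy (grid_times T0 n l)).
  exact: (process_eval cy IH (sT k)).
pose B k : set Omega := [set w | (s k w < T)%E].
have mB k : measurable (B k).
  by apply: measurable_lte_set => //; exact: measurable_cst.
have sS k w : (s k w <= s k.+1 w)%E by exact: next_ge.
have dB n m : (n <= m)%N -> B m `<=` B n.
  move=> nm w /=; apply: le_lt_trans; elim: m nm => [|m IH]; first by rewrite leqn0 => /eqP ->.
  by rewrite leq_eqVlt => /predU1P[->//|]; rewrite ltnS => /IH nm; exact: le_trans nm (sS m w).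
have B0 : \bigcap_n B n = set0.
  apply/seteqP; split => // w H; have [k kT] := iter_next_reach (cyw w) e0.
  by have := H k I; rewrite /B /= /s kT ltxx.
have [k _ /(_ k (leqnn k)) Hk] := cvgr_lt _ (control_cvg0 crho mB dB B0) e e0.
have bxi j : bounded_rv (fun w => y w (s j w)).
  by split; [exact: (process_eval cy (ms j) (sT j))|exists M => w; exact: HM].
have bT : bounded_rv (fun w => y w T).
  by split; [exact: (process_at cy (timesT T0))|exists M => w; apply: HM; exact: timesT].
pose z w t := \sum_(i < k) 1 * (y w (s i w) * (step (s i w) t - step (s i.+1 w) t)).
exists (1 *: z + (fun w t => y w T * step T t)), (B k); split=> //.
- apply: null_lin; last by apply: null_rv_step => // w; exact: timesT.
  apply: (@null_sum k (fun=> 1) (fun i w t => y w (s i w) * (step (s i w) t - step (s i.+1 w) t))) => j.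
  rewrite (_ : (fun _ _ => _) = (-1) *: (fun w t => y w (s j w) * step (s j.+1 w) t) +
      (fun w t => y w (s j w) * step (s j w) t)).
    by apply: null_lin; exact: null_rv_step.
  apply/funext => w; apply/funext => t.
  rewrite -[RHS]/((-1) * (y w (s j w) * step (s j.+1 w) t) + y w (s j w) * step (s j w) t).
  by rewrite mulN1r mulrBr addrC.
- exact: ltW.
move=> w t tT.
have -> : (1 *: z + (fun w t => y w T * step T t)) w t =
    \sum_(i < k) y w (s i w) * (step (s i w) t - step (s i.+1 w) t) + y w T * step T t.
  rewrite -[LHS]/(1 * z w t + y w T * step T t) mul1r; congr (_ + _).
  by apply: eq_bigr => i _; rewrite mul1r.
have [_ [H1 H2]] := iter_next_approx (cyw w) e0 k tT.
have /andP[t0 tT'] := tT.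
have iB : 0 <= M * \1_(B k) w by rewrite mulr_ge0.
have [tTe|tTn] := eqVneq t T.
  rewrite H1; last by rewrite tTe; case/andP: (sT k w).
  by rewrite tTe /step lexx mulr1 add0r subrr normr0 addr_ge0// ltW.
have -> : step T t = 0 :> R by rewrite /step leNgt lt_neqAle tTn tT'.
rewrite mulr0 addr0; have [kt|tk] := leP (s k w) t.
  rewrite H1// subr0 indicE mem_set; last by rewrite /B /= (le_lt_trans kt)// lt_neqAle tTn.
  by rewrite mulr1; apply: le_trans (HM w t tT) _; rewrite lerDr ltW.
by apply: le_trans (H2 tk) _; rewrite lerDl.
Qed.

End Vanishing.

(** * The dual space *)

Lemma signed_representation (R : realType) (d : measure_display) (Omega : measurableType d)
    (P : probability Omega R) (T : \bar R) (rho : (Omega -> R) -> R)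
    (phi : (Omega -> \bar R -> R) -> R) :
  (0 < T)%E -> control P rho ->
  (forall (a : R) x y, bounded_process T x -> bounded_process T y ->
     phi (a *: x + y) = a * phi x + phi y) ->
  (forall y, bounded_process T y -> `|phi y| <= rho (proc_norm T y)) ->
  exists2 v, L1M P T v & forall s A, measurable_fun setT s -> (forall w, times T (s w)) ->
    measurable A -> phi (istep A s) = mean P (path_pairing T (istep A s) v).
Proof.
move=> T0 crho phi_lin phi_le.
have [v Mv Hv] := positive_representation T0 crho (pos_functional_pf T0 crho phi_lin phi_le).
have [v' Mv' Hv'] := positive_representation T0 (controlD crho crho)
  (neg_functional_pf T0 crho phi_lin phi_le).
exists (pair_lin (-1) v' v); first exact: L1M_lin.
move=> s A ms sT mA; have by_ : bounded_process T (istep A s).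
  by case: (@istep_ge0 _ _ _ T A s mA ms).
have [[av _] [av' _]] := (L1M_admissible Mv, L1M_admissible Mv').
have -> : path_pairing T (istep A s) (pair_lin (-1) v' v) =
    fun w => (-1) * path_pairing T (istep A s) v' w + path_pairing T (istep A s) v w.
  apply/funext => w; apply: path_pairing_linr => //; first by case: by_ => -[].
    by have [_ _ /(_ w)[]] := av'.
  by have [_ _ /(_ w)[]] := av.
rewrite mean_lin; [|exact: bounded_pairing_L1|exact: bounded_pairing_L1].
by rewrite -Hv// -Hv'//; lra.
Qed.

Section Surjective.
Context {R : realType} {d : measure_display} {Omega : measurableType d}.
Variables (P : probability Omega R) (T : \bar R) (PP : set ((Omega -> R) -> \bar R)).
Hypothesis T0 : (0 < T)%E.
Hypothesis PP_admissible : forall p, PP p -> admissible P p.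
Hypothesis PP0 : PP !=set0.
Hypothesis PP_directed : seminorm_directed P PP.
Implicit Types (x y z : Omega -> \bar R -> R) (v : @rmpair R d Omega)
  (p : (Omega -> R) -> \bar R).

Lemma directed_finite (F : set ((Omega -> R) -> \bar R)) : F `<=` PP -> finite_set F ->
  exists2 p, PP p & exists2 c : R, 0 < c &
    forall p' xi, F p' -> L1 P xi -> (p' xi <= c%:E * p xi)%E.
Proof.
move=> FP fF; have [F0|F0] := pselect (F !=set0); last first.
  have [p Pp] := PP0; exists p => //; exists 1 => // p' xi Fp'.
  by exfalso; apply: F0; exists p'.
have [f [Ff fonto]] := countable_enum (finite_set_countable fF) F0.
have H n : exists2 p, PP p & exists2 c : R, 0 < c &
    forall k xi, (k <= n)%N -> L1 P xi -> (f k xi <= c%:E * p xi)%E.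
  elim: n => [|n [p Pp [c c0 pc]]].
    exists (f 0%N); first exact: FP.
    by exists 1 => // k xi; rewrite leqn0 => /eqP -> _; rewrite mul1e.
  have [p2 P2 [c2 c20 pc2]] := PP_directed Pp (FP _ (Ff n.+1)).
  exists p2 => //; exists ((c + 1) * c2); first by rewrite mulr_gt0// addr_gt0.
  move=> k xi kn Lx; have [q1 q2] := pc2 _ Lx.
  have p20 := adm_ge0 (PP_admissible P2) Lx.
  have [kn'|kn'] := leqP k n.
    apply: le_trans (pc k xi kn' Lx) _.
    apply: (@le_trans _ _ (c%:E * (c2%:E * p2 xi))%E).
      by apply: lee_wpmul2l => //; rewrite lee_fin ltW.
    rewrite muleA -EFinM; apply: lee_wpmul2r => //.
    by rewrite lee_fin ler_wpM2r ?lerDl// ltW.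
  have -> : k = n.+1 by apply/eqP; rewrite eqn_leq kn.
  apply: le_trans q2 _; apply: lee_wpmul2r => //.
  by rewrite lee_fin ler_peMl ?(ltW c20)// lerDr ltW.
have /choice[idx Hidx] : forall p', exists n, F p' -> f n = p'.
  move=> p'; have [Fp|Fp] := pselect (F p'); last by exists 0%N.
  by have [n Hn] := fonto _ Fp; exists n.
have [N HN] := finite_set_bound idx fF.
have [p Pp [c c0 Hc]] := H N; exists p => //; exists c => // p' xi Fp' Lx.
by rewrite -(Hidx _ Fp'); apply: Hc => //; exact: HN.
Qed.

Variable l : (Omega -> \bar R -> R) -> R.
Hypothesis l_dual : topological_dual PP (proc_seminorm T) (YD P T PP) l.

Let YB y : bounded_process T y -> YD P T PP y. Proof. exact: bounded_YD. Qed.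

Let q_fin p y : PP p -> YD P T PP y -> proc_seminorm T p y = (fine (proc_seminorm T p y))%:E.
Proof.
move=> Pp Yy; have ap := PP_admissible Pp; rewrite fineK// ge0_fin_numE.
  by have [_ Yn] := Yy; exact: (Yspace_fin Yn Pp).
exact: (adm_ge0 ap Yy.1.2).
Qed.

Let q_ge0 p y : PP p -> YD P T PP y -> 0 <= fine (proc_seminorm T p y).
Proof. by move=> Pp Yy; apply: fine_ge0; exact: (adm_ge0 (PP_admissible Pp) Yy.1.2). Qed.

(** A neighbourhood of zero on which |l| < 1 contains a ball of a single seminorm, since the
seminorms are directed; rescale. *)
Lemma dual_bound : exists2 p, PP p & exists2 C : R, 0 <= C &
  forall y, YD P T PP y -> `|l y| <= C * fine (proc_seminorm T p y).
Proof.
have [l_lin l_cont] := l_dual.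
have Y0 : YD P T PP 0 by apply: YB; exact: bounded_process0.
have l0 : l 0 = 0 by have := l_lin 1 0 0 Y0 Y0; rewrite scaler0 addr0; lra.
have := l_cont 0 Y0 _ (nbhsx_ballx (l 0) 1 ltr01).
move=> [F [e [FP fF e0 HF]]].
have [p Pp [c c0 Hc]] := directed_finite FP fF.
have ap := PP_admissible Pp.
exists p => //; exists (2 * c / e); first by rewrite divr_ge0 ?mulr_ge0 ?ltW.
move=> y Yy; set r := fine _; have r0 : 0 <= r by exact: q_ge0.
apply/ler_addgt0Pr => a a0.
pose D := r + a * e / (2 * c).
have D0 : 0 < D by rewrite ltr_wpDl// divr_gt0 ?mulr_gt0.
pose b := e / (2 * c * D).
have b0 : 0 < b by rewrite divr_gt0// !mulr_gt0.
have rD : r < D by rewrite ltrDl divr_gt0 ?mulr_gt0.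
have Yb : YD P T PP (b *: y) by rewrite -[b *: y]addr0; exact: YD_lin.
have lb : l (b *: y) = b * l y by rewrite -[b *: y]addr0 l_lin// l0 addr0.
have : `|l (b *: y)| < 1.
  have := HF _ Yb; rewrite /ball/= l0 sub0r normrN; apply => p' Fp'.
  have ap' := PP_admissible (FP _ Fp').
  rewrite subr0 (qZ T0 ap' _ Yy.1) gtr0_norm//.
  apply: (@le_lt_trans _ _ (b%:E * (c%:E * proc_seminorm T p y))%E).
    by apply: lee_wpmul2l; [rewrite lee_fin ltW|exact: (Hc _ _ Fp' Yy.1.2)].
  rewrite (q_fin Pp Yy) -/r -!EFinM lte_fin.
  have -> : b * (c * r) = e / 2 * (r / D).
    by rewrite /b; field; rewrite !gt_eqF.
  have rD1 : r / D < 1 by rewrite ltr_pdivrMr// mul1r.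
  have e2 : 0 < e / 2 by rewrite divr_gt0.
  have : e / 2 * (r / D) < e / 2 * 1 by rewrite ltr_pM2l.
  lra.
rewrite lb normrM gtr0_norm// mulrC -ltr_pdivlMr// => /ltW/le_trans; apply.
rewrite mul1r /b invf_div /D.
have -> : 2 * c * (r + a * e / (2 * c)) / e = 2 * c / e * r + a.
  by field; rewrite !gt_eqF.
exact: lexx.
Qed.

(** On bounded processes [l] and the pairing agree by [vanishing].  Then
[sign_process_norming] bounds the polar of the pair by the constant of [dual_bound],
and both sides are continuous on [YD], where the bounded processes are dense. *)
Lemma dual_representation : exists2 v, UM P T PP v &
  forall y, YD P T PP y -> (l y)%:E = pairing P T y v.
Proof.
have [l_lin l_cont] := l_dual.
have [p Pp [C C0 lC]] := dual_bound; have ap := PP_admissible Pp.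
have crho := control_admissible ap C0.
have lB_lin (a : R) x y : bounded_process T x -> bounded_process T y ->
    l (a *: x + y) = a * l x + l y by move=> bx by_; apply: l_lin; exact: YB.
have lB_le y : bounded_process T y -> `|l y| <= C * fine (p (proc_norm T y)).
  by move=> by_; apply: lC; exact: YB.
have [v Mv Hv] := signed_representation T0 crho lB_lin lB_le.
have [av Lv] := L1M_admissible Mv.
have cw y w : bounded_process T y -> cadlag T (y w) by case=> -[].
have Mt w : Mtilde T (v.2 w) by have [_ _ /(_ w)[]] := av.
have lB y : bounded_process T y -> l y = mean P (path_pairing T y v).
  move=> by_; apply/eqP; rewrite -subr_eq0; apply/eqP.
  have crho2 := controlD crho (control_mean Lv (fun w => pair_norm_ge0 v w)).
  apply: (@vanishing _ _ _ P T T0 _ (fun y => l y - mean P (path_pairing T y v)) crho2) => //.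
  - move=> a x z bx bz; cbv beta; rewrite lB_lin//.
    have -> : path_pairing T (a *: x + z) v =
        fun w => a * path_pairing T x v w + path_pairing T z v w.
      by apply/funext => w; apply: path_pairing_linl => //; exact: cw.
    rewrite mean_lin; [|exact: bounded_pairing_L1|exact: bounded_pairing_L1].
    move: (l x) (l z) (mean P (path_pairing T x v)) (mean P (path_pairing T z v)) => ? ? ? ?.
    by rewrite mulrBr opprD addrACA.
  - move=> z bz; apply: le_trans (ler_normB _ _) _; apply: lerD; first exact: lB_le.
    have Lz := bounded_pairing_L1 T0 bz Mv.
    apply: le_trans (mean_norm Lz) _; apply: mean_le.
    + exact: L1_norm.
    + apply: L1_bounded_mul => //; have [mz [M HM]] := bounded_process_norm T0 bz.
      by split; [exact: measurableT_comp|exists M => w; rewrite normr_id].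
    + move=> w; rewrite proc_norm_abs//; apply: path_pairing_le_norm => //; exact: cw.
  - by move=> s A ms sT mA; rewrite Hv// subrr.
have polC : (polar P p (pair_norm v) <= C%:E)%E.
  apply: (polar_le ap) => // [w|xi bxi xi0 xi1]; first exact: pair_norm_ge0.
  apply/lee_addgt0Pr => e e0.
  have [z [cz bz zle] Hz] := sign_process_norming T0 bxi xi0 Mv e0.
  rewrite -EFinD lee_fin.
  suff : mean P (path_pairing T z v) <= C by move: Hz; lra.
  rewrite -lB//; apply: le_trans (ler_norm _) _; apply: le_trans (lC _ (YB bz)) _.
  rewrite -[leRHS]mulr1; apply: ler_wpM2l => //.
  rewrite -lee_fin -q_fin//; last exact: YB.
  apply: le_trans xi1; apply: (adm_le ap); [exact: measurable_proc_norm|exact: bounded_L1|].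
  by apply: ae_true => w; rewrite proc_norm_abs// ger0_norm.
have Uv : UM P T PP v.
  split=> //; exists p => //; split=> //; exact: le_lt_trans polC (ltry _).
exists v => // y Yy; rewrite (UM_pairingE T0 PP_admissible Yy Uv); congr EFin.
apply/eqP; rewrite -subr_eq0 -normr_le0; apply/ler_addgt0Pr => e e0; rewrite add0r.
have c0 : 0 < 2 * C + 1 by rewrite ltr_wpDl// mulr_ge0.
have a0 : 0 < e / (2 * C + 1) by rewrite divr_gt0.
have [n Hn] : exists n, (proc_seminorm T p (clip n y - y)%R < (e / (2 * C + 1))%:E)%E.
  apply: (bounded_process_dense (N := [set z | proc_seminorm T p (z - y)%R < (e / (2 * C + 1))%:E]%E) T0 PP_admissible Yy).
  exists [set p], (e / (2 * C + 1)); split=> //; first by move=> _ ->.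
  by move=> z _ /(_ p erefl).
set z := clip n y in Hn.
have bz : bounded_process T z by apply: clip_bounded => //; case: Yy => -[].
have Yz := YB bz; have Yzy : YD P T PP (z - y) by exact: YDB.
have zyE : z - y = (-1) *: y + z by rewrite scaleN1r addrC.
have lz : l (z - y) = l z - l y by rewrite zyE l_lin// mulN1r addrC.
have mz : mean P (path_pairing T (z - y) v) =
    mean P (path_pairing T z v) - mean P (path_pairing T y v).
  by rewrite zyE (mean_pairing_linl T0 PP_admissible)// mulN1r addrC.
have -> : l y - mean P (path_pairing T y v) =
    mean P (path_pairing T (z - y) v) - l (z - y).
  by rewrite lz mz (lB z bz) opprB [RHS]addrC addrA subrK.
apply: le_trans (ler_normB _ _) _.
set r := fine (proc_seminorm T p (z - y)).
have r0 : 0 <= r by exact: q_ge0.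
have re : r < e / (2 * C + 1) by rewrite -lte_fin -q_fin.
have h1 : `|l (z - y)| <= C * r by exact: lC.
have h2 : `|mean P (path_pairing T (z - y) v)| <= r * C.
  rewrite -lee_fin EFinM -q_fin//.
  apply: le_trans (mean_pairing_le T0 ap Yzy.1 Mv (UM_pairing_L1 T0 PP_admissible Yzy Uv)) _.
  by apply: lee_wpmul2l => //; exact: (adm_ge0 ap Yzy.1.2).
have rC : r * (2 * C + 1) < e by rewrite -ltr_pdivlMr.
apply: le_trans (lerD h2 h1) _; apply: le_trans (ltW rC).
by rewrite [C * r]mulrC -mulrDr ler_wpM2l// mulr_natl mulr2n lerDl.
Qed.

End Surjective.

Theorem theorem5 (R : realType) (d : measure_display) (Omega : measurableType d)
    (P : probability Omega R) (T : \bar R)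
    (PP : set ((Omega -> R) -> \bar R))
    (P_complete : measure_is_complete P)
    (T_gt0 : (0 < T)%E)
    (PP_countable : countable PP)
    (PP_nonempty : PP !=set0)
    (PP_admissible : forall p, PP p -> admissible P p) :
  [/\ frechet_mod PP (proc_seminorm T) (YD P T PP) (proc_null P T),
      dual_embedding P T PP,
      (seminorm_directed P PP -> dual_identification P T PP),
      seminorm_dense PP (proc_seminorm T) (YD P T PP) (LinfD P T) &
      forall p, PP p ->
      [/\ (forall y v, L1D P T y -> L1M P T v ->
             ((proc_seminorm T p y * polar P p (pair_norm v) < +oo)%E ->
                P.-integrable [set: Omega] (EFin \o path_pairing T y v)) /\
             (pairing P T y v
                <= proc_seminorm T p y * polar P p (pair_norm v))%E),
          (forall v, L1M P T v ->
             polar P p (pair_norm v) =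
             ereal_sup [set pairing P T y v |
                        y in [set y | LinfD P T y /\
                                      (proc_seminorm T p y <= 1)%E]]) &
          (forall v, UM P T PP v ->
             polar P p (pair_norm v) =
             ereal_sup [set pairing P T y v |
                        y in [set y | YD P T PP y /\
                                      (proc_seminorm T p y <= 1)%E]])]].
Proof.
have emb : dual_embedding P T PP by exact: YD_dual_embedding.
split=> //; first exact: YD_frechet.
- move=> dir; split=> //; first by move=> a v v' Uv Uv'; exact: UM_lin.
  by move=> l; exact: dual_representation.
- exact: LinfD_dense.
move=> p Pp; have ap := PP_admissible p Pp.
have LinfL1 : LinfD P T `<=` L1D P T.
  by move=> y [cy Ly]; split=> //; exact: Linf_L1.
split.
- by move=> y v Ly Mv; exact: pairing_holder.
- by move=> v Mv; apply: polar_norming.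
- move=> v [Mv _]; apply: polar_norming => //; last by move=> y [].
  by move=> y; exact: LinfD_YD.
Qed.
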